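(* Let $\sigma>0$, let $f:\mathbb{R}^n\to\mathbb{R}$ be locally Lipschitz continuous, and let $g(x):=f(x)+\frac{\sigma}{2}\|x\|^2$. Assume: (A1) $f$ is path-differentiable and admits a convex-valued set-valued mapping $\mathcal{D}_f$ as its conservative field; (A2) the set $\{g(x):x\in\mathbb{R}^n,\ 0\in\mathcal{D}_f(x)+\sigma x\}$ has empty interior in $\mathbb{R}$; (A3) $\inf_{x\in\mathbb{R}^n}g(x)>-\infty$. Let $\{(x_k,m_k,v_k)\}$ be generated by the framework (AFMDW) described in the context, and assume: (C1) there exists a constant $M_x$ such that almost surely $\max\{\|m_0\|,\sup_{k\ge0}\|x_k\|\}\le M_x$; (C2) there exist a locally bounded mapping $W:\mathbb{R}^n\times\mathbb{R}^n\to\mathbb{R}^n_+$ and a fixed constant $\tau_2>0$ such that $v_{k+1}=v_k-\tau_2\eta_k\,(v_k-W(g_k,m_{k+1}))$ for all $k\ge0$; (C3) $H(v)=(\max\{v,0\}+\varepsilon)^{-1/2}$ (entrywise) for a fixed constant $\varepsilon>0$; (C4) the stepsizes $\{\eta_k\}$, $\{\theta_k\}$ are positive and satisfy $\sum_{k=0}^\infty\theta_k=\infty$, $\lim_{k\to\infty}\theta_k\log(k)=0$, $\lim_{k\to\infty}\frac{\theta_k}{\eta_k}=\tau_1$ for a fixed constant $\tau_1\in[\frac{\tau_2}{4},\infty)$, $\tau_1>0$; (C5) there exists a nonnegative sequence $\{\delta_k\}$ with $\lim_{k\to\infty}\delta_k=0$ and $d_k\in\mathcal{D}_f^{\delta_k}(x_k)$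 for all $k$; (C6) $\{\xi_k\}$ is a uniformly bounded martingale difference sequence. Then almost surely: 1. any cluster point of $\{x_k\}$ is a $\mathcal{D}_g$-stationary point of $g$; 2. $\lim_{k\to\infty}\|m_k+\sigma x_k\|=0$; 3. the sequence of function values $\{g(x_k)\}$ converges.
   Context: All random variables live on a probability space $(\Omega,\mathcal{F},\mathbb{P})$ with a filtration $\{\mathcal{F}_k\}$. $\odot$ is the entrywise product; $\mathbb{R}^n_+$ is the nonnegative orthant. A uniformly bounded martingale difference sequence $\{\xi_k\}$ is one adapted to $\{\mathcal{F}_k\}$ with $\mathbb{E}[\xi_{k+1}\mid\mathcal{F}_k]=0$ and, for some constant $M_\xi$, $\sup_k\|\xi_k\|\le M_\xi$ almost surely. Framework (AFMDW): from an initial point $(x_0,m_0,v_0)$, for $k\ge0$: $g_k=d_k+\xi_{k+1}$; $m_{k+1}=(1-\theta_k)m_k+\theta_k g_k$; choose an estimator $v_{k+1}\in\mathbb{R}^n$ (here by the rule in (C2)); $x_{k+1}=x_k-\eta_k H(v_{k+1})\odot(m_{k+1}+\sigma x_k)$. A conservative field on $\mathbb{R}^n$ is a graph-closed set-valued mapping $\mathcal{D}:\mathbb{R}^n\rightrightarrows\mathbb{R}^n$ with nonempty compact values such that $\int_0^1\max_{v\in\mathcal{D}(\gamma(t))}\langle\gamma'(t),v\rangle\,dt=0$ for every absolutely continuous $\gamma:[0,1]\to\mathbb{R}^n$ with $\gamma(0)=\gamma(1)$. A function $f$ is a potential for $\mathcal{D}$ (equivalently, $f$ admits $\mathcal{D}$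 as its conservative field) if $f(\gamma(1))=f(\gamma(0))+\int_0^1\max_{d\in\mathcal{D}(\gamma(t))}\langle\gamma'(t),d\rangle\,dt$ for every absolutely continuous $\gamma:[0,1]\to\mathbb{R}^n$. A locally Lipschitz function is path-differentiable if it is the potential of some conservative field. For a set-valued mapping $\mathcal{D}$ and $\delta\ge0$, $\mathcal{D}^\delta(x):=\{w\in\mathbb{R}^n:\exists z\in\mathbb{B}_\delta(x),\ \mathrm{dist}(w,\mathcal{D}(z))\le\delta\}$, where $\mathbb{B}_\delta(x)$ is the ball of radius $\delta$ centred at $x$. $\mathcal{D}_g(x):=\mathcal{D}_f(x)+\sigma x$, a convex-valued conservative field for $g$. A point $x$ is $\mathcal{D}_g$-stationary for $g$ if $0\in\mathrm{conv}(\mathcal{D}_g(x))$ (i.e. $0\in\mathcal{D}_g(x)$ here). *)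

(* Defs.v *)
From HB Require Import structures.
From mathcomp Require Import all_boot all_order all_algebra.
From mathcomp Require Import all_classical all_reals all_analysis.
Set Implicit Arguments.
Unset Strict Implicit.
Unset Printing Implicit Defensive.
Import Order.TTheory GRing.Theory Num.Theory.
Import numFieldNormedType.Exports.
Local Open Scope classical_set_scope.
Local Open Scope ring_scope.

Section Euclidean.
Context {R : realType} {n : nat}.
Implicit Types (u v : 'rV[R]_n) (A : set 'rV[R]_n).

Definition dotp u v : R := \sum_i u 0 i * v 0 i.

(* The library norm [`|u|] on row vectors is the max norm; this is the
   Euclidean one.  The two induce the same topology. *)
Definition enorm u : R := Num.sqrt (dotp u u).

Definition hadamard u v : 'rV[R]_n := \row_i (u 0 i * v 0 i).

Definition edist u A : R := inf [set enorm (u - a) | a in A].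

Definition conv A : set 'rV[R]_n := smallest (@convex_set R 'rV[R]_n) A.

End Euclidean.

Section ConservativeFields.
Context {R : realType} {n : nat}.
Implicit Types (f : 'rV[R]_n -> R) (D : 'rV[R]_n -> set 'rV[R]_n)
  (gam : R -> 'rV[R]_n).

(* Absolute continuity on [0, 1] of the restriction of [gam]; its values
   elsewhere are irrelevant. *)
Definition absolutely_continuous01 gam : Prop :=
  forall e : R, 0 < e -> exists2 d : R, 0 < d &
    forall (N : nat) (a b : 'I_N -> R),
      (forall i, [/\ 0 <= a i, a i <= b i & b i <= 1]) ->
      (forall i j, i != j -> `]a i, b i[ `&` `]a j, b j[ = set0) ->
      \sum_i (b i - a i) < d ->
      \sum_i enorm (gam (b i) - gam (a i)) < e.

(* Integral over [0, 1] of t |-> max_{v in D (gam t)} <gam'(t), v>.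
   The sup is a max since the values of a conservative field are nonempty and
   compact. [derive1] takes a default value where [gam] is not differentiable,
   which is a null set when [gam] is absolutely continuous. *)
Definition max_path_integral D gam : \bar R :=
  (\int[@lebesgue_measure R]_(t in `[0%R, 1%R])
     (sup [set dotp (derive1 gam t) v | v in D (gam t)])%:E)%E.

Definition conservative_field D : Prop :=
  [/\ closed [set p : 'rV[R]_n * 'rV[R]_n | D p.1 p.2],
      (forall x, D x !=set0 /\ compact (D x)) &
      forall gam, absolutely_continuous01 gam -> gam 0 = gam 1 ->
        max_path_integral D gam = 0%E].

Definition potential f D : Prop :=
  forall gam, absolutely_continuous01 gam ->
    ((f (gam 1))%:E = (f (gam 0))%:E + max_path_integral D gam)%E.

Definition admits_conservative_field f D : Prop :=
  conservative_field D /\ potential f D.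

Definition locally_lipschitz f : Prop :=
  forall x : 'rV[R]_n, exists2 U : set 'rV[R]_n, nbhs x U & [lipschitz f y | y in U].

Definition path_differentiable f : Prop :=
  locally_lipschitz f /\ exists D, admits_conservative_field f D.

Definition enlarge (delta : R) D : 'rV[R]_n -> set 'rV[R]_n :=
  fun x => [set w | exists2 z, enorm (z - x) <= delta & edist w (D z) <= delta].

End ConservativeFields.

Section WeightDecay.
Context {R : realType} {n : nat}.
Variable sigma : R.

Definition reg_fun (f : 'rV[R]_n -> R) : 'rV[R]_n -> R :=
  fun x => f x + sigma / 2 * enorm x ^+ 2.

Definition reg_field (D : 'rV[R]_n -> set 'rV[R]_n) : 'rV[R]_n -> set 'rV[R]_n :=
  fun x => [set u + sigma *: x | u in D x].

End WeightDecay.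

Definition stationary (R : realType) (n : nat)
    (D : 'rV[R]_n -> set 'rV[R]_n) (x : 'rV[R]_n) : Prop :=
  conv (D x) 0.

Definition precond (R : realType) (n : nat) (eps : R) (v : 'rV[R]_n)
    : 'rV[R]_n :=
  \row_i (Num.max (v 0 i) 0 + eps) `^ (- 2^-1).

(* One sample path of the framework; the rule producing the estimators [v] is
   left open. *)
Definition AFMDW (R : realType) (n : nat) (sigma : R)
    (H : 'rV[R]_n -> 'rV[R]_n) (eta theta : R^nat)
    (g x m v : nat -> 'rV[R]_n) : Prop :=
  forall k,
    m k.+1 = (1 - theta k) *: m k + theta k *: g k /\
    x k.+1 = x k - eta k *: hadamard (H (v k.+1)) (m k.+1 + sigma *: x k).

Section Probability.
Context {d : measure_display} {T : measurableType d} {R : realType}.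
Variable P : probability T R.
Implicit Types (G : set_system T) (F : nat -> set_system T).

Definition filtration F : Prop :=
  [/\ (forall k, sigma_algebra setT (F k)),
      (forall k, F k `<=` measurable) &
      (forall k l, (k <= l)%N -> F k `<=` F l)].

Definition measurable_wrt G (X : T -> R) : Prop :=
  forall B, measurable B -> G (X @^-1` B).

(* [Y] is a version of the conditional expectation of [X] given [G] *)
Definition is_cond_expectation G (X Y : T -> R) : Prop :=
  [/\ P.-integrable setT (EFin \o X), P.-integrable setT (EFin \o Y),
      measurable_wrt G Y &
      forall A, G A ->
        (\int[P]_(w in A) (Y w)%:E = \int[P]_(w in A) (X w)%:E)%E].

Definition random_vector n (X : T -> 'rV[R]_n) : Prop :=
  forall i, measurable_fun setT (fun w => X w 0 i).

Definition bounded_martingale_difference n F (xi : nat -> T -> 'rV[R]_n)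
    : Prop :=
  [/\ (forall k i, measurable_wrt (F k) (fun w => xi k w 0 i)),
      (forall k i,
         is_cond_expectation (F k) (fun w => xi k.+1 w 0 i) (cst 0)) &
      exists M : R, {ae P, forall w, forall k, enorm (xi k w) <= M}].

End Probability.

(* Main.v *)
From HB Require Import structures.
Require Import Defs.
From mathcomp Require Import all_boot all_order all_algebra.
From mathcomp Require Import all_classical all_reals all_analysis.
From mathcomp Require Import measurable_realfun ring lra.
Set Implicit Arguments.
Unset Strict Implicit.
Unset Printing Implicit Defensive.
Import Order.TTheory GRing.Theory Num.Theory.
Import numFieldNormedType.Exports.
Local Open Scope classical_set_scope.
Local Open Scope ring_scope.

(** Why the theorem holds.

    The momentum [m] is a moving average of the directions [d] and of the noise
    [xi].  The recursion being linear, [m] splits into a noiseless momentum [mu]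
    and a filtered noise [nf].  Over a stretch of indices on which [theta] sums to
    a bounded amount, [nf] is a weighted sum of martingale increments with weights
    at most [theta]; exponential moments and [theta k * ln k --> 0] give it tails
    summable in the starting index, so [nf] tends to zero almost surely
    ([noise_filter_ae_null]).  The rest of the argument is about one sample path.

    Put [y = mu + sigma * x] and let [h] be the current preconditioner.  The energy
    [g x + (2 * tau1)^-1 * \sum_i h i * (y i)^2] decreases.  In the limit
    [theta / eta --> tau1] the cross terms of its two parts cancel, and what is left
    is a dissipation proportional to [eta * |y|^2].  It has to pay for the growth of
    [h]: the estimator [v] shrinks at relative rate at most [tau2 * eta], so [h]
    grows at relative rate at most [tau2 * eta * b / 2] for some [b < 1], and
    [tau2 <= 4 * tau1] leaves a positive fraction of the dissipation
    ([coordinate_descent], [precond1_growth]).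

    This bookkeeping needs a chain rule for the nonsmooth [f] along the iterates:
    over windows of bounded total step size, [f] decreases at least as much as the
    chosen elements of the field predict, up to a vanishing error
    ([discrete_chain_rule]).  If it failed, the bad windows would converge along an
    ultrafilter to a continuously differentiable path.  On that path the field
    predicts exactly the variation of [f], and the discrete predictions are
    asymptotically controlled by it, because the field has a closed graph and is
    locally bounded.  Local boundedness is not part of the definition of a
    conservative field; for convex values it follows from the potential being
    locally Lipschitz, by Baire's theorem ([locally_bounded_field]).

    The energy therefore decreases over windows by a multiple of
    [\sum eta * |y|^2], up to a vanishing error.  If it oscillated between two
    levels, some level in between would not be a critical value, since the critical
    values contain no interval.  At the last passage below that level before a large
    climb the energy does not drop, hence [y] is small on a window, hence the limit
    points of [x] there are critical at that very level: a contradiction.  So the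
    energy converges, [y] tends to zero, and the values [g (x k)] converge.  Finally,
    while [y] is small, the directions [d] average to [- sigma * x] over a short
    window; by semicontinuity and convexity this average is nearly a value of the
    field at a limit point of [x], which makes the limit point stationary
    ([window_limit_stationary], [descent_limits]). *)

(** * The two norms on row vectors *)

Section Norms.
Context {R : realType} {n : nat}.
Implicit Types (u v w : 'rV[R]_n).

Lemma coord_le_norm u i : `|u 0 i| <= `|u|.
Proof.
rewrite [leRHS]/Num.norm /= mx_normrE; apply/bigmax_geP; right => /=.
by exists (0, i).
Qed.

Lemma norm_le_coord u (B : R) : 0 <= B -> (forall i, `|u 0 i| <= B) -> `|u| <= B.
Proof.
move=> B0 h; rewrite [leLHS]/Num.norm /= mx_normrE; apply/bigmax_leP; split => //=.
by move=> [i j] _; rewrite ord1.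
Qed.

Lemma dotpDl u v w : dotp (u + v) w = dotp u w + dotp v w.
Proof. by rewrite /dotp -big_split; apply: eq_bigr => i _; rewrite mxE mulrDl. Qed.

Lemma dotpC u v : dotp u v = dotp v u.
Proof. by apply: eq_bigr => i _; rewrite mulrC. Qed.

Lemma dotpZl (a : R) u v : dotp (a *: u) v = a * dotp u v.
Proof. by rewrite /dotp mulr_sumr; apply: eq_bigr => i _; rewrite mxE mulrA. Qed.

Lemma dotpDr u v w : dotp u (v + w) = dotp u v + dotp u w.
Proof. by rewrite dotpC dotpDl !(dotpC _ u). Qed.

Lemma dotpNl u v : dotp (- u) v = - dotp u v.
Proof. by rewrite -scaleN1r dotpZl mulN1r. Qed.

Lemma dotp_ge0 u : 0 <= dotp u u.
Proof. by apply: sumr_ge0 => i _; rewrite -expr2 sqr_ge0. Qed.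

Lemma enorm_sqr u : enorm u ^+ 2 = dotp u u.
Proof. by rewrite sqr_sqrtr // dotp_ge0. Qed.

Lemma norm_le_enorm u : `|u| <= enorm u.
Proof.
apply: norm_le_coord => [|i]; first exact: sqrtr_ge0.
rewrite -sqrtr_sqr ler_wsqrtr // /dotp (bigD1 i) //= -expr2 lerDl.
by apply: sumr_ge0 => j _; rewrite -expr2 sqr_ge0.
Qed.

Lemma dotp_le_norm u v : `|dotp u v| <= n%:R * `|u| * `|v|.
Proof.
apply: (le_trans (ler_norm_sum _ _ _)).
apply: (@le_trans _ _ (\sum_(i < n) `|u| * `|v|)).
  by apply: ler_sum => i _; rewrite normrM ler_pM // coord_le_norm.
by rewrite sumr_const card_ord -[leLHS]mulr_natl mulrA.
Qed.

Lemma enorm_le_norm u : enorm u <= n%:R * `|u|.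
Proof.
rewrite -[leRHS]ger0_norm ?mulr_ge0 // -sqrtr_sqr ler_wsqrtr //.
apply: (le_trans (ler_norm _)); apply: (le_trans (dotp_le_norm _ _)).
rewrite exprMn -mulrA -expr2 ler_wpM2r // ?sqr_ge0 // -natrX ler_nat.
by case: (n) => // k; rewrite expnS expn1 leq_pmulr.
Qed.

End Norms.

(** * Set-valued fields and paths *)

Section Paths.
Context {R : realType} {n : nat}.
Implicit Types (gam : R -> 'rV[R]_n).

Lemma lipschitz_absolutely_continuous01 gam (C : R) :
  (forall s t, `|gam s - gam t| <= C * `|s - t|) ->
  absolutely_continuous01 gam.
Proof.
move=> h e e0.
have C0 : 0 <= C.
  by have := h 1 0; rewrite subr0 normr1 mulr1; apply: le_trans.
pose c := n%:R * C + 1.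
have c0 : 0 < c by rewrite ltr_wpDl // mulr_ge0.
exists (e / c); first by rewrite divr_gt0.
move=> N a b hab _; rewrite ltr_pdivlMr // => hlt.
apply: le_lt_trans hlt; rewrite mulr_suml; apply: ler_sum => i _.
have [_ ab _] := hab i.
apply: (le_trans (enorm_le_norm _)).
apply: (@le_trans _ _ (n%:R * (C * (b i - a i)))).
  by rewrite ler_wpM2l // (le_trans (h _ _)) // ger0_norm ?subr_ge0.
by rewrite mulrA mulrC ler_wpM2l ?subr_ge0 // lerDl.
Qed.

(** Monotonicity of the integral from below holds without measurability of the
    larger function, since integrals of nonnegative functions are suprema of
    integrals of simple functions. *)
Lemma cst_le_integral01 (phi : R -> \bar R) (c : R) : 0 <= c ->
  (forall t, 0 <= t <= 1 -> (c%:E <= phi t)%E) ->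
  (c%:E <= \int[@lebesgue_measure R]_(t in `[0%R, 1%R]) phi t)%E.
Proof.
move=> c0 h.
have phi0 : forall t, `[0%R, 1%R]%classic t -> (0 <= phi t)%E.
  by move=> t; rewrite /= in_itv /= => /h; apply: le_trans; rewrite lee_fin.
have m01 : measurable (`[0%R, 1%R]%classic : set R) by exact: measurable_itv.
have -> : c%:E = (\int[@lebesgue_measure R]_(t in `[0%R, 1%R]) (cst c%:E) t)%E.
  by rewrite integral_cst //= lebesgue_measure_itv /= lte01 oppr0 adde0 mule1.
rewrite ge0_integralE; last by move=> *; rewrite lee_fin.
rewrite ge0_integralE //.
apply: ereal_sup_le => _ [hf hle <-]; exists hf => // t.
apply: (le_trans (hle t)).
rewrite !patchE; case: ifPn => // /set_mem; rewrite /= in_itv /=.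
exact: h.
Qed.

End Paths.

Section ClosedGraph.
Context {R : realType} {n : nat}.
Variable D : 'rV[R]_n -> set 'rV[R]_n.
Hypothesis closedD : closed [set p : 'rV[R]_n * 'rV[R]_n | D p.1 p.2].

(** The projection along a compact set is a closed map. *)
Lemma closed_dom_compact (K : set 'rV[R]_n) : compact K ->
  closed [set z | exists2 v, D z v & K v].
Proof.
move=> /compact_near_coveringP Kcov.
rewrite -openC openE => z /= nz.
have : \forall w \near z, K `<=` [set v | ~ D w v].
  apply: (Kcov _ (nbhs z) (fun w v => ~ D w v)) => v Kv.
  have : nbhs (z, v) (~` [set p : 'rV[R]_n * 'rV[R]_n | D p.1 p.2]).
    apply: open_nbhs_nbhs; split; first by rewrite openC.
    by move=> /= Dzv; apply: nz; exists v.
  case=> -[A B] /= [Az Bv] AB.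
  exists (B, A); first by split.
  by move=> [b a] /= [Bb Aa]; apply: (AB (a, b)).
apply: filterS => w Kw [v Dwv /Kw]; exact.
Qed.

Lemma compact_normball (M : R) : compact [set v : 'rV[R]_n | `|v| <= M].
Proof.
apply: bounded_closed_compact.
  exists M; split; first exact: num_real.
  by move=> x Mx v /= vM; apply: (le_trans vM); apply: ltW.
apply: (@closed_comp _ _ (fun v : 'rV[R]_n => `|v|) [set x | x <= M]).
  by move=> v _; apply: norm_continuous.
exact: closed_le.
Qed.

(** Upper semicontinuity: the points of the nearby values far from [D y] lie in
    a compact set that [D y] misses. *)
Lemma upper_semicontinuous (y : 'rV[R]_n) (B e : R) :
  (\forall z \near y, forall v, D z v -> `|v| <= B) -> 0 < e ->
  \forall z \near y, forall v, D z v -> exists2 a, D y a & `|v - a| < e.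
Proof.
move=> hB e0.
pose K := [set v : 'rV[R]_n | `|v| <= B] `&` [set v | forall a, D y a -> e <= `|v - a|].
have Kc : compact K.
  apply: compact_closedI; first exact: compact_normball.
  have -> : [set v : 'rV[R]_n | forall a, D y a -> e <= `|v - a|] =
     \bigcap_(a in D y) [set v | e <= `|v - a|].
    by apply/seteqP; split => v /= h a Da; apply: h.
  apply: closed_bigI => a _.
  apply: (@closed_comp _ _ (fun v : 'rV[R]_n => `|v - a|) [set x | e <= x]).
    move=> v _; apply: (@cvg_norm _ _ _ (nbhs v)).
    by apply: (@cvgB _ _ _ (nbhs v)); [exact: cvg_id|exact: cvg_cst].
  exact: closed_ge.
have oK := closed_dom_compact Kc; rewrite -openC openE in oK.
have yK : (~` [set z | exists2 v, D z v & K v]) y.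
  by move=> [v Dv [_ /(_ v Dv)]]; rewrite subrr normr0 leNgt e0.
apply: (@filterS _ (nbhs y) _ _ _ _ (filterI hB (oK _ yK))) => z [zB zK] v Dv.
apply: contrapT => h.
apply: zK; exists v => //; split; first exact: zB.
by move=> a Da; rewrite leNgt; apply/negP => va; apply: h; exists a.
Qed.

End ClosedGraph.

Section Calculus.
Context {R : realType} {n : nat}.

Lemma convex_setP (A : set 'rV[R]_n) : @convex_set R 'rV[R]_n A ->
  forall x y (t : R), 0 <= t <= 1 -> A x -> A y -> A (t *: x + (1 - t) *: y).
Proof.
move=> cA x y t /andP[t0 t1] Ax Ay.
have := cA x y (Itv01 t0 t1); rewrite !inE => /(_ Ax Ay).
by [].
Qed.

(** Differentiability read off a first-order expansion with a quadratic
    remainder. *)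
Lemma derive1_quadratic (gam : R -> 'rV[R]_n) (w : 'rV[R]_n) (t C : R) :
  (forall s, `|gam s - gam t - (s - t) *: w| <= C * (s - t) ^+ 2) ->
  derive1 gam t = w.
Proof.
move=> h; rewrite /derive1; apply: cvg_lim => //.
apply/cvgrPdist_le => e e0.
have C0 : 0 <= C.
  have := h (t + 1); have -> : t + 1 - t = 1 by ring.
  rewrite expr1n mulr1.
  exact: le_trans.
have C1 : 0 < C + 1 by rewrite ltr_wpDl.
near=> s.
have s0 : s != 0 by near: s; exact: nbhs_dnbhs_neq.
have -> : w - s^-1 *: (gam (s + t) - gam t) =
    - (s^-1 *: (gam (s + t) - gam t - s *: w)).
  by rewrite [in RHS]scalerBr scalerA mulVf // scale1r opprB.
rewrite normrN normrZ normfV ler_pdivrMl ?normr_gt0 //.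
have := h (s + t); rewrite addrK => /le_trans; apply.
rewrite -real_normK ?num_real // expr2 mulrA mulrC ler_wpM2l //.
apply: (@le_trans _ _ ((C + 1) * `|s|)); first by rewrite ler_wpM2r // lerDl.
rewrite -ler_pdivlMl //; near: s.
apply: dnbhs0_le; by rewrite mulr_gt0 ?invr_gt0.
Unshelve. all: by end_near. Qed.

End Calculus.

(** * Conservative fields with convex values are locally bounded *)

(** Baire's theorem asks for a type that is complete and normed at once; this
    declares that join for matrices. *)
HB.instance Definition _ (R : realType) m n := Complete.on 'M[R]_(m, n).

Section Fields.
Context {R : realType} {n : nat}.
Variables (f : 'rV[R]_n -> R) (D : 'rV[R]_n -> set 'rV[R]_n).

Lemma dotp_le_sup (u v : 'rV[R]_n) (A : set 'rV[R]_n) (B : R) :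
  (forall w, A w -> `|w| <= B) -> A v ->
  dotp u v <= sup [set dotp u w | w in A].
Proof.
move=> AB Av; apply: ub_le_sup; last by exists v.
exists (n%:R * `|u| * B) => _ [w Aw <-].
apply: (le_trans (ler_norm _)); apply: (le_trans (dotp_le_norm _ _)).
by rewrite ler_wpM2l ?mulr_ge0 // AB.
Qed.

Lemma compact_normP (A : set 'rV[R]_n) : compact A ->
  exists B, forall w, A w -> `|w| <= B.
Proof.
move=> /compact_bounded [M [Mr h]]; exists (M + 1) => w Aw.
by apply: (h (M + 1)) => //; rewrite ltrDl.
Qed.

(** On a segment along which every value of the field contains a vector of large
    slope, the path formula would make [f] increase faster than its Lipschitz
    constant allows. *)
Lemma large_values_not_open (O : set 'rV[R]_n) (L s : R) (i : 'I_n) :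
  potential f D -> (forall x, compact (D x)) ->
  `|s| = 1 -> 0 <= L -> O !=set0 -> open O ->
  (forall y z, O y -> O z -> `|f y - f z| <= L * `|y - z|) ->
  exists2 z, O z & forall v, D z v -> s * v 0 i < L + 1.
Proof.
move=> pfD Dc s1 L0 [z0 Oz0] openO lipf; apply: contrapT => hO.
have {}hO z : O z -> exists2 v, D z v & L + 1 <= s * v 0 i.
  move=> Oz; apply: contrapT => h; apply: hO; exists z => // v Dv.
  by rewrite ltNge; apply/negP => hv; apply: h; exists v.
have [r r0 rO] : exists2 r, 0 < r & forall z, `|z - z0| < r -> O z.
  have /nbhs_ballP[r /= r0 h] := open_nbhs_nbhs (conj openO Oz0).
  by exists r => // z hz; apply: h; rewrite -ball_normE /= distrC.
pose c := s * (r / 2); pose e := delta_mx 0 i : 'rV[R]_n.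
have nc : `|c| = r / 2 by rewrite normrM s1 mul1r ger0_norm // divr_ge0 // ltW.
have ne : `|e| <= 1.
  apply: norm_le_coord => // j; rewrite mxE /=.
  by case: eqP => _; rewrite ?normr1 ?normr0.
pose gam (t : R) := z0 + t *: (c *: e).
have gamO t : 0 <= t <= 1 -> O (gam t).
  move=> /andP[t0 t1]; apply: rO; rewrite /gam addrC addKr normrZ normrZ nc ger0_norm //.
  have r20 : 0 <= r / 2 by rewrite divr_ge0 // ltW.
  apply: (@le_lt_trans _ _ (r / 2)); last by rewrite ltr_pdivrMr // ltr_pMr // ltr1n.
  rewrite -[leRHS]mul1r; apply: ler_pM => //; first by rewrite mulr_ge0.
  by rewrite ler_piMr.
have dgam t : derive1 gam t = c *: e.
  apply: (@derive1_quadratic _ _ _ _ _ 0) => u.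
  by rewrite /gam opprD addrACA subrr add0r -scalerBl subrr normr0 mul0r.
have ac : absolutely_continuous01 gam.
  apply: (@lipschitz_absolutely_continuous01 _ _ _ (`|c *: e|)) => u v.
  by rewrite /gam opprD addrACA subrr add0r -scalerBl normrZ mulrC.
have := pfD _ ac.
have g0O : O (gam 0) by apply: gamO; rewrite lexx ler01.
have g1O : O (gam 1) by apply: gamO; rewrite lexx ler01.
have fle : f (gam 1) <= f (gam 0) + L * (r / 2).
  rewrite -lerBlDl (le_trans (ler_norm _)) // (le_trans (lipf _ _ g1O g0O)) //.
  rewrite ler_wpM2l // /gam scale1r scale0r addr0 addrC addKr normrZ nc.
  by rewrite ler_piMr // divr_ge0 // ltW.
have := @cst_le_integral01 R (fun t => (sup [set dotp (derive1 gam t) v | v in D (gam t)])%:E)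
  ((L + 1) * (r / 2)).
rewrite -/(max_path_integral D gam) => h hpot.
have {}h : (((L + 1) * (r / 2))%:E <= max_path_integral D gam)%E.
  apply: h => [|t t01].
    by rewrite mulr_ge0 ?addr_ge0 // divr_ge0 // ltW.
  rewrite lee_fin dgam.
  have [v Dv hv] := hO _ (gamO t t01).
  have [B hB] := compact_normP (Dc (gam t)).
  apply: le_trans (dotp_le_sup (c *: e) hB Dv).
  have -> : dotp (c *: e) v = s * v 0 i * (r / 2).
    rewrite dotpZl /dotp (bigD1 i) //= big1 => [|j ji].
      by rewrite addr0 mxE !eqxx mul1r /c mulrAC.
    by rewrite mxE (negbTE ji) andbF mul0r.
  by rewrite ler_wpM2r // divr_ge0 // ltW.
have : ((f (gam 0))%:E + ((L + 1) * (r / 2))%:E <= (f (gam 0) + L * (r / 2))%:E)%E.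
  apply: (@le_trans _ _ (f (gam 1))%:E); last by rewrite lee_fin.
  by rewrite hpot leeD2l.
rewrite -EFinD lee_fin lerD2l mulrDl gerDl mul1r leNgt => /negP; apply.
by rewrite divr_gt0.
Qed.

(** By Baire's theorem the points where every value is bounded by [L + 1] are
    dense near [x], hence every nearby point has at least one such value, the
    graph being closed.  If other nearby values were large, convexity would give
    values of norm exactly [B] arbitrarily close to [x].  These accumulate at a value
    of [D x] of norm [B], which is excluded when [B] exceeds the norms in [D x]. *)
Lemma locally_bounded_field : closed [set p : 'rV[R]_n * 'rV[R]_n | D p.1 p.2] ->
  (forall x, D x !=set0 /\ compact (D x)) ->
  (forall y, @convex_set R 'rV[R]_n (D y)) ->
  potential f D -> locally_lipschitz f ->
  forall x : 'rV[R]_n, exists2 B, 0 <= B & \forall z \near x, forall v, D z v -> `|v| <= B.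
Proof.
move=> cD D0 vD pfD lipf x.
have [U Ux] := lipf x; rewrite /lipschitz_on => /pinfty_ex_gt0 [L L0 hL].
have {}hL y z : U y -> U z -> `|f y - f z| <= L * `|y - z|.
  by move=> Uy Uz; have := hL (y, z); apply.
have [r r0 rU] : exists2 r, 0 < r & forall z, `|z - x| <= r -> U z.
  have /nbhs_ballP[r /= r0 h] := Ux.
  exists (r / 2); first by rewrite divr_gt0.
  move=> z hz; apply: h; rewrite -ball_normE /= distrC (le_lt_trans hz) //.
  by rewrite ltr_pdivrMr // ltr_pMr // ltr1n.
pose S (b : bool) : R := (-1) ^+ b.
have S1 b : `|S b| = 1 by rewrite normr_sign.
pose K (M : nat) (i : 'I_n) b := [set v : 'rV[R]_n | `|v| <= M%:R] `&`
   [set v : 'rV[R]_n | L + 1 <= S b * v 0 i].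
have Kc M i b : compact (K M i b).
  apply: compact_closedI; first exact: compact_normball.
  apply: (@closed_comp _ _ (fun v : 'rV[R]_n => S b * v 0 i) [set x | L + 1 <= x]).
    move=> v _.
    apply: (@continuousM _ _ (fun=> S b) (fun w : 'rV[R]_n => w 0 i)).
      exact: cst_continuous.
    exact: coord_continuous.
  exact: closed_ge.
pose N M i b := [set z : 'rV[R]_n | `|z - x| <= r] `&`
  [set z | exists2 v, D z v & K M i b v].
have Nc M i b : closed (N M i b).
  apply: closedI; last exact: closed_dom_compact.
  apply: (@closed_comp _ _ (fun v : 'rV[R]_n => `|v - x|) [set t | t <= r]).
    move=> v _; apply: (@cvg_norm _ _ _ (nbhs v)).
    by apply: (@cvgB _ _ _ (nbhs v)); [exact: cvg_id|exact: cvg_cst].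
  exact: closed_le.
(* Baire's theorem is about sequences, hence the encoding of the indices. *)
pose F (k : nat) := if @unpickle (nat * 'I_n * bool)%type k is Some (M, i, b)
  then ~` N M i b else setT.
have odF k : open (F k) /\ dense (F k).
  rewrite /F; case: unpickle => [[[M i] b]|]; last first.
    by split; [exact: openT|move=> O [y Oy] _; exists y].
  split; first by rewrite openC.
  move=> O O0 oO; apply: contrapT => ON.
  have {}ON z : O z -> N M i b z.
    by move=> Oz; apply: contrapT => Nz; apply: ON; exists z.
  have [y z Oy Oz|z Oz] := large_values_not_open i pfD (fun x => (D0 x).2) (S1 b) (ltW L0) O0 oO.
    by apply: hL; apply: rU; apply: (ON _ _).1.
  have [_ [v Dv [_ vL]]] := ON _ Oz.
  by move=> /(_ v Dv); rewrite ltNge vL.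
have dF := @Baire R 'rV[R]_n F odF.
pose K0 := [set v : 'rV[R]_n | `|v| <= L + 1].
have small z : `|z - x| < r -> exists2 v, D z v & K0 v.
  move=> zr; apply: contrapT => nz.
  pose O := ball x r `&` ~` [set z | exists2 v, D z v & K0 v].
  have oO : open O.
    apply: openI; first exact: ball_open.
    rewrite openC; apply: closed_dom_compact => //; exact: compact_normball.
  have [|w [[xw Ow] Fw]] := dF O _ oO.
    by exists z; split => //; rewrite -ball_normE /= distrC.
  have [[v Dv] _] := D0 w.
  apply: Ow; exists v => //; apply: norm_le_coord; first by rewrite addr_ge0 // ltW.
  move=> i; rewrite leNgt; apply/negP => vi.
  have [b vb] : exists b, L + 1 <= S b * v 0 i.
    move: vi; case: (ger0P (v 0 i)) => _ vi.
      by exists false; rewrite /S expr0 mul1r ltW.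
    by exists true; rewrite /S expr1 mulN1r ltW.
  have [M vM] : exists M : nat, `|v| <= M%:R.
    by exists (Num.truncn `|v|).+1; rewrite ltW // truncnS_gt.
  have := Fw (pickle (M, i, b)) Logic.I; rewrite /F pickleK; apply; split.
    by move: xw; rewrite -ball_normE /= distrC => /ltW.
  by exists v.
have [Bx hBx] := compact_normP (D0 x).2.
pose B := Num.max (L + 1) Bx + 1.
have LB : L + 1 < B by rewrite (@le_lt_trans _ _ (Num.max (L + 1) Bx)) ?ltrDl // le_max lexx.
have B0 : 0 <= B by rewrite (le_trans _ (ltW LB)) // addr_ge0 // ltW.
exists B => //.
have cB : closed [set z | exists2 w, D z w & `|w| = B].
  apply: closed_dom_compact => //.
  apply: (@subclosed_compact _ _ [set v : 'rV[R]_n | `|v| <= B]).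
  - apply: (@closed_comp _ _ (fun v : 'rV[R]_n => `|v|) [set t | t = B]).
      by move=> v _; apply: norm_continuous.
    exact: closed_eq.
  - exact: compact_normball.
  - by move=> v /= ->.
have nx : (~` [set z | exists2 w, D z w & `|w| = B]) x.
  move=> [w /hBx wB wE]; move: wB; rewrite wE leNgt => /negP; apply.
  by rewrite (@le_lt_trans _ _ (Num.max (L + 1) Bx)) ?ltrDl // le_max lexx orbT.
rewrite -openC openE in cB.
have xr : nbhs x (ball x r) by apply: nbhsx_ballx.
apply: (@filterS _ (nbhs x) _ _ _ _ (filterI xr (cB _ nx))) => z [xz zB] v Dv.
rewrite leNgt; apply/negP => vB.
have [|b Db bL] := small z; first by move: xz; rewrite -ball_normE /= distrC.
pose h (t : R) := `|t *: v + (1 - t) *: b|.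
have hc : {within `[0, 1], continuous h}.
  apply: continuous_subspaceT => t.
  apply: (@cvg_norm _ _ _ (nbhs t)); apply: (@cvgD _ _ _ (nbhs t)).
    by apply: cvgZr_tmp; exact: cvg_id.
  by apply: cvgZr_tmp; apply: cvgB; [exact: cvg_cst|exact: cvg_id].
have [|t] := @IVT R h 0 1 B ler01 hc.
  rewrite /h scale0r add0r subr0 scale1r subrr scale0r addr0 scale1r.
  by rewrite ge_min le_max (ltW vB) orbT andbT (le_trans bL) // ltW.
rewrite in_itv /= => t01 ht; apply: zB; exists (t *: v + (1 - t) *: b) => //.
exact: convex_setP.
Qed.
End Fields.

(** Local bounds are uniform on compact sets; [Q z B] reads: [B] bounds whatever
    is attached to [z]. *)
Lemma compact_uniform_bound (R : realType) (X : topologicalType) (K : set X)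
  (Q : X -> R -> Prop) : compact K ->
  (forall z B B', B <= B' -> Q z B -> Q z B') ->
  (forall x, K x -> exists B, \forall z \near x, Q z B) ->
  exists B, forall z, K z -> Q z B.
Proof.
move=> /compact_near_coveringP Kc mono loc.
have : \forall B \near +oo, K `<=` (Q ^~ B).
  apply: (Kc R (pinfty_nbhs R) (fun B z => Q z B)) => x Kx.
  have [B hB] := loc x Kx.
  exists ([set z | Q z B], [set B' | B < B']).
    by split => //=; exists B; split => //; exact: num_real.
  by move=> [z B'] /= [zB BB']; apply: mono zB; apply: ltW.
by move=> [B [_ hB]]; exists (B + 1) => z Kz; apply: (hB (B + 1)) => //; rewrite ltrDl.
Qed.

Lemma near_norm_lt (R : realType) (V : normedModType R) (y : V) (e : R) :
  0 < e -> \forall z \near y, `|z - y| < e.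
Proof.
by move=> e0; apply/nbhs_ballP; exists e => //= z; rewrite -ball_normE /= distrC.
Qed.

(** * Predictions of the field along a path *)

(** A lower sum for a subdivision [a] that decreases, as path times do when windows
    are run backwards. *)
Lemma step_le_integral (R : realType) (h : R -> R) (a c : nat -> R) k K :
  (k <= K)%N ->
  (@lebesgue_measure R).-integrable `]0%R, 1%R] (EFin \o h) ->
  (forall i, (k <= i <= K)%N -> 0 <= a i <= 1) ->
  (forall i, (k <= i < K)%N -> a i.+1 <= a i) ->
  (forall i t, (k <= i < K)%N -> a i.+1 < t -> t <= a i -> c i <= h t) ->
  ((\sum_(k <= i < K) (a i - a i.+1) * c i)%:E <=
   \int[@lebesgue_measure R]_(t in `]a K, a k]) (h t)%:E)%E.
Proof.
move=> kK inth; elim: K kK => [|K ih].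
  by rewrite leqn0 => /eqP -> *; rewrite big_geq // set_itvoc0 integral_set0.
rewrite leq_eqVlt => /predU1P[<- *|].
  by rewrite big_geq // set_itvoc0 integral_set0.
rewrite ltnS => kK a01 adecr ch.
have mono j : (k <= j <= K.+1)%N -> a j <= a k.
  elim: j => [|j jh]; first by case/andP; rewrite leqn0 => /eqP ->.
  rewrite leq_eqVlt => /andP[/predU1P[<- //|]]; rewrite ltnS => kj jK.
  by apply: le_trans (adecr j _) (jh _); rewrite kj //= ltnW.
have aKk : a K <= a k by apply: mono; rewrite kK leqnSn.
have kKK : (k <= K < K.+1)%N by rewrite kK ltnSn.
have aKK := adecr _ kKK.
rewrite big_nat_recr //= EFinD addeC.
have aK : 0 <= a K.+1 <= 1 by apply: a01; rewrite leqnn leqW.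
have ak : 0 <= a k <= 1 by apply: a01; rewrite leqnn leqW.
have sub u v : 0 <= u -> v <= 1 -> `]u, v]%classic `<=` (`]0%R, 1%R]%classic : set R).
  move=> u0 v1 t; rewrite /= !in_itv /= => /andP[ut tv].
  by rewrite (le_lt_trans u0) // (le_trans tv).
have sub1 : `]a K.+1, a k]%classic `<=` (`]0%R, 1%R]%classic : set R).
  by apply: sub; [case/andP: aK|case/andP: ak].
have mK : a K.+1 <= a K by [].
rewrite (@itv_bndbnd_setU _ _ (BRight (a K.+1)) (BRight (a K)) (BRight (a k))) ?bnd_simp //.
have intS u v : 0 <= u -> v <= 1 ->
    (@lebesgue_measure R).-integrable `]u, v] (EFin \o h).
  move=> u0 v1; apply: integrableS inth => //; exact: sub.
rewrite integral_setU //=; last 2 first.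
- rewrite -itv_bndbnd_setU ?bnd_simp //.
  by apply: (measurable_int lebesgue_measure); apply: integrableS inth.
- rewrite disj_set2E; apply/eqP; rewrite -subset0 => t [] /=.
  by rewrite !in_itv /= => /andP[_ h1] /andP[/lt_le_trans /(_ h1)]; rewrite ltxx.
apply: leeD; last first.
  by apply: ih => // i; [move=> /andP[ki iK]; apply: a01; rewrite ki leqW
    |move=> /andP[ki iK]; apply: adecr; rewrite ki ltnS ltnW
    |move=> t /andP[ki iK]; apply: ch; rewrite ki ltnS ltnW].
have aK1 : 0 <= a K <= 1 by apply: a01; rewrite kK leqnSn.
have -> : ((a K - a K.+1) * c K)%:E =
   (\int[@lebesgue_measure R]_(t in `]a K.+1, a K]) (c K)%:E)%E.
  rewrite integral_cst //= lebesgue_measure_itv /= lte_fin.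
  case: ltgtP aKK => // [aKK _|-> _]; first by rewrite -EFinB -EFinM mulrC.
  by rewrite subrr mul0r mule0.
apply: le_integral; first exact: measurable_itv.
- apply/integrableP; split; first exact: measurable_cst.
  rewrite /= integral_cst //= lebesgue_measure_itv /=.
  by case: ifP => _; rewrite ?mule0 // -EFinD -EFinM ltry.
- by apply: intS; [case/andP: aK|case/andP: aK1].
- move=> t; rewrite inE /= in_itv /= lee_fin => /andP[t1 t2].
  exact: ch t2.
Qed.

Section PathIntegral.
Context {R : realType} {n : nat}.
Variables (D : 'rV[R]_n -> set 'rV[R]_n) (gam w : R -> 'rV[R]_n) (C B : R).
Hypothesis closedD : closed [set p : 'rV[R]_n * 'rV[R]_n | D p.1 p.2].
Hypothesis D0 : forall x, D x !=set0.
Hypothesis lip_gam : forall s t, `|gam s - gam t| <= C * `|s - t|.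
Hypothesis lip_w : forall s t, `|w s - w t| <= C * `|s - t|.
Hypothesis w_le : forall t, `|w t| <= B.
Hypothesis D_le : forall t z v, `|z - gam t| <= 1 -> D z v -> `|v| <= B.

(** The support function of the values near the path, in the direction of its
    velocity.  Taking an open neighbourhood makes it lower semicontinuous. *)
Let near_values (r : R) t := [set v | exists2 z, `|z - gam t| < r & D z v].
Let phi (r : R) t := sup [set dotp (w t) v | v in near_values r t].
Let phi0 t := sup [set dotp (w t) v | v in D (gam t)].

Let B0 : 0 <= B.
Proof. exact: le_trans (w_le 0). Qed.

Let C0 : 0 <= C.
Proof. by have := lip_gam 1 0; rewrite subr0 normr1 mulr1; apply: le_trans. Qed.

Let phi_ge r t v : r <= 1 -> near_values r t v -> dotp (w t) v <= phi r t.
Proof.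
move=> r1 [z zt Dzv]; apply: (@dotp_le_sup _ _ _ _ _ B); last by exists z.
by move=> v' [z' zt' Dv']; apply: (@D_le t z') => //; rewrite ltW // (lt_le_trans zt').
Qed.

Let phi_le r t M : 0 < r -> (forall v, near_values r t v -> dotp (w t) v <= M) -> phi r t <= M.
Proof.
move=> r0 h; apply: ge_sup => [|_ [v /h + <-] //].
have [v Dv] := D0 (gam t); exists (dotp (w t) v); exists v => //.
by exists (gam t) => //; rewrite subrr normr0.
Qed.

Let dotp_bound t z v : `|z - gam t| <= 1 -> D z v -> `|dotp (w t) v| <= n%:R * B * B.
Proof.
move=> zt Dv; apply: (le_trans (dotp_le_norm _ _)).
by apply: ler_pM => //; rewrite ?mulr_ge0 // ?ler_wpM2l // (D_le zt).
Qed.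

Let phi_bound r t : 0 < r <= 1 -> `|phi r t| <= n%:R * B * B.
Proof.
move=> /andP[r0 r1]; rewrite ler_norml; apply/andP; split; last first.
  apply: phi_le => // v [z zt Dv]; apply: (le_trans (ler_norm _)).
  by apply: dotp_bound Dv; rewrite ltW // (lt_le_trans zt).
have [v Dv] := D0 (gam t).
apply: (@le_trans _ _ (dotp (w t) v)).
  rewrite lerNl; apply: le_trans (_ : `|dotp (w t) v| <= _).
    by rewrite -normrN ler_norm.
  by apply: (dotp_bound _ Dv); rewrite subrr normr0.
by apply: phi_ge => //; exists (gam t) => //; rewrite subrr normr0.
Qed.

Let phi_gtP r t M : 0 < r -> M < phi r t ->
  exists2 v, near_values r t v & M < dotp (w t) v.
Proof.
move=> r0 Mphi; apply: contrapT => h; move: Mphi; rewrite ltNge => /negP; apply.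
apply: phi_le => // v hv; rewrite leNgt; apply/negP => Mv; apply: h; by exists v.
Qed.

Let phi_measurable r : 0 < r <= 1 -> measurable_fun setT (EFin \o phi r).
Proof.
move=> /andP[r0 r1]; apply: lower_semicontinuous_measurable => t a; rewrite /= lte_fin.
move=> /(phi_gtP r0) [v [z zt Dv] av].
have zpos : 0 < r - `|z - gam t| by rewrite subr_gt0.
have apos : 0 < dotp (w t) v - a by rewrite subr_gt0.
have nBC : 0 < n%:R * C * B + 1 by rewrite ltr_wpDl // !mulr_ge0.
have CC : 0 < C + 1 by rewrite ltr_wpDl.
exists [set s | `|s - t| < (r - `|z - gam t|) / (C + 1) /\
                `|s - t| < (dotp (w t) v - a) / (n%:R * C * B + 1)].
  by apply: (@filterI _ (nbhs t)); apply: (@near_norm_lt R R^o); rewrite divr_gt0.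
move=> s [s1 s2]; rewrite lte_fin.
apply: lt_le_trans (_ : dotp (w s) v <= _); last first.
  apply: phi_ge => //; exists z => //.
  have -> : z - gam s = (z - gam t) + (gam t - gam s) by rewrite addrA subrK.
  apply: (le_lt_trans (ler_normD _ _)); rewrite -ltrBrDl.
  apply: (le_lt_trans (lip_gam _ _)).
  apply: (@le_lt_trans _ _ ((C + 1) * `|t - s|)); first by rewrite ler_wpM2r // lerDl.
  by rewrite -ltr_pdivlMl // mulrC distrC.
have -> : dotp (w s) v = dotp (w t) v - dotp (w t - w s) v.
  by rewrite dotpDl dotpNl opprD opprK addrA subrr add0r.
rewrite ltrBrDr -ltrBrDl; apply: (le_lt_trans (ler_norm _)).
apply: (le_lt_trans (dotp_le_norm _ _)).
apply: (@le_lt_trans _ _ ((n%:R * C * B + 1) * `|t - s|)).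
  rewrite mulrDl mul1r ler_wpDr //.
  rewrite (_ : n%:R * C * B * `|t - s| = n%:R * (C * `|t - s|) * B); last by ring.
  apply: ler_pM; rewrite ?mulr_ge0 //; first by rewrite ler_wpM2l.
  by apply: (D_le (t := t) _ Dv); rewrite ltW // (lt_le_trans zt).
by rewrite -ltr_pdivlMl // mulrC distrC.
Qed.

Let phi_cvg t : phi (m.+1%:R^-1) t @[m --> \oo] --> phi0 t.
Proof.
have locB : \forall z \near gam t, forall v, D z v -> `|v| <= B.
  have : nbhs (gam t) (ball (gam t) 1) by apply: nbhsx_ballx.
  apply: filterS => z; rewrite -ball_normE /= distrC => zt v.
  by apply: (D_le (t := t)); rewrite ltW.
apply/cvgrPdist_le => e e0.
have nB : 0 < n%:R * B + 1 by rewrite ltr_wpDl // mulr_ge0.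
have eB : 0 < e / (n%:R * B + 1) by rewrite divr_gt0.
have := upper_semicontinuous closedD locB eB => /nbhs_ballP [r /= r0 hr].
near=> m.
have m1 : (m.+1%:R^-1 : R) <= 1 by rewrite invf_le1 // ler1n.
have mr : (m.+1%:R^-1 : R) <= r.
  by apply: ltW; near: m; apply: (near_infty_natSinv_lt (PosNum r0)).
have le1 : phi0 t <= phi m.+1%:R^-1 t.
  apply: ge_sup => [|_ [v Dv <-]].
    by have [v Dv] := D0 (gam t); exists (dotp (w t) v); exists v.
  by apply: phi_ge => //; exists (gam t) => //; rewrite subrr normr0 invr_gt0.
rewrite distrC ger0_norm ?subr_ge0 // lerBlDl.
apply: phi_le => [|v [z zt Dv]]; first by rewrite invr_gt0.
have [a Da va] : exists2 a, D (gam t) a & `|v - a| < e / (n%:R * B + 1).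
  by apply: (hr z) Dv; rewrite -ball_normE /= distrC (lt_le_trans zt).
rewrite -(subrK a v) dotpDr addrC; apply: lerD.
  apply: (@dotp_le_sup _ _ _ _ _ B) => // v' Dv'.
  by apply: (D_le (t := t) _ Dv'); rewrite subrr normr0.
apply: (le_trans (ler_norm _)); apply: (le_trans (dotp_le_norm _ _)).
apply: (@le_trans _ _ ((n%:R * B + 1) * `|v - a|)).
  by rewrite ler_wpM2r // ler_wpDr // ler_wpM2l.
by rewrite -ler_pdivlMl // mulrC ltW.
Unshelve. all: by end_near. Qed.

Let I01 : set R := `[0%R, 1%R]%classic.

Let m01 : measurable I01.
Proof. exact: measurable_itv. Qed.

Let integrable_cst01 (c : R) : (@lebesgue_measure R).-integrable I01 (cst c%:E).
Proof.
apply/integrableP; split; first exact: measurable_cst.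
rewrite /= integral_cst //= lebesgue_measure_itv /=.
by case: ifP => _; rewrite ?mule0 // -EFinD -EFinM ltry.
Qed.

Let inv_succ m : 0 < (m.+1%:R^-1 : R) <= 1.
Proof. by rewrite invr_gt0 ltr0Sn /= invf_le1 // ler1n. Qed.

Let mphi m : measurable_fun I01 (EFin \o phi m.+1%:R^-1).
Proof. by apply: measurable_funTS; apply: phi_measurable. Qed.

Let integrable_phi m : (@lebesgue_measure R).-integrable I01 (EFin \o phi m.+1%:R^-1).
Proof.
apply: (@le_integrable _ _ _ lebesgue_measure _ m01 _ (cst (n%:R * B * B)%:E)) => //.
  exact: mphi.
by move=> t _; rewrite /= lee_fin (le_trans (phi_bound _ _)) // ler_norm.
Qed.

Let integral_phi_cvg :
  (@lebesgue_measure R).-integrable I01 (EFin \o phi0) /\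
  (\int[@lebesgue_measure R]_(t in I01) (phi m.+1%:R^-1 t)%:E)%E @[m --> \oo] -->
  (\int[@lebesgue_measure R]_(t in I01) (phi0 t)%:E)%E.
Proof.
have cphi t : (EFin \o phi m.+1%:R^-1) t @[m --> \oo] --> (EFin \o phi0) t.
  by apply: cvg_EFin; [exact: nearW|exact: phi_cvg].
have [] := @dominated_convergence _ _ R (@lebesgue_measure R) _ m01
  (fun m => EFin \o phi m.+1%:R^-1) (EFin \o phi0) (cst (n%:R * B * B)%:E).
- by [].
- by apply: (@emeasurable_fun_cvg _ _ _ _ (fun m => EFin \o phi m.+1%:R^-1)).
- by apply: aeW => t _; exact: cphi.
- exact: integrable_cst01.
- by apply: aeW => t m _; rewrite /= lee_fin phi_bound.
by [].
Qed.

(** Sums of values of the field near the path, taken against its velocity, are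
    controlled by the path integral: they are at most the integral of the support
    function of a neighbourhood, which converges to the path integral as the
    neighbourhood shrinks. *)
Lemma step_sum_le_max_path_integral (e : R) :
  (forall t, derive1 gam t = w t) -> 0 < e ->
  exists2 r : R, 0 < r & forall (a c : nat -> R) k K, (k <= K)%N ->
    (forall i, (k <= i < K)%N -> a i.+1 <= a i) -> a k = 1 -> a K = 0 ->
    (forall i t, (k <= i < K)%N -> a i.+1 < t -> t <= a i ->
       exists z v, [/\ `|z - gam t| < r, D z v & c i <= dotp (w t) v + r]) ->
  ((\sum_(k <= i < K) (a i - a i.+1) * c i)%:E <= max_path_integral D gam + e%:E)%E.
Proof.
move=> dgam e0.
have [int0 cvgI] := integral_phi_cvg.
have e2 : 0 < e / 2 by rewrite divr_gt0.
pose I0 : \bar R := (\int[@lebesgue_measure R]_(t in I01) (phi0 t)%:E)%E.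
have I0fin : I0 \is a fin_num by apply: integrable_fin_num.
have [m hm] : exists m : nat,
   (\int[@lebesgue_measure R]_(t in I01) (phi m.+1%:R^-1 t)%:E < I0 + (e / 2)%:E)%E.
  have : (I0 < I0 + (e / 2)%:E)%E by rewrite lteDl // lte_fin.
  move=> /open_ereal_lt' /cvgI [N _ hN]; exists N; exact: (hN N (leqnn N)).
pose r := Num.min (m.+1%:R^-1) (e / 2).
have r0 : 0 < r by rewrite lt_min e2; case/andP: (inv_succ m) => ->.
exists r => // a c k K kK adecr ak aK hc.
have a01 i : (k <= i <= K)%N -> 0 <= a i <= 1.
  move=> /andP[ki iK]; rewrite -ak -aK; apply/andP; split.
    elim: K kK iK adecr {ak aK hc} => [|K ih] kK iK adecr.
      by move: iK; rewrite leqn0 => /eqP ->.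
    move: iK; rewrite leq_eqVlt => /predU1P[-> //|]; rewrite ltnS => iK.
    have kK' := leq_trans ki iK.
    apply: le_trans (ih kK' iK _); first by apply: adecr; rewrite kK' ltnSn.
    by move=> j /andP[kj jK]; apply: adecr; rewrite kj ltnS ltnW.
  elim: i ki iK => [|i ih]; first by rewrite leqn0 => /eqP ->.
  rewrite leq_eqVlt => /predU1P[<- //|]; rewrite ltnS => ki iK.
  by apply: le_trans (adecr i _) (ih ki (ltnW iK)); rewrite ki.
have step := @step_le_integral R (phi m.+1%:R^-1) a (fun i => c i - r) k K kK _ a01 adecr _.
have sumE : \sum_(k <= i < K) (a i - a i.+1) * (c i - r) =
   \sum_(k <= i < K) (a i - a i.+1) * c i - r.
  under eq_bigr do rewrite mulrBr.
  rewrite sumrB; congr (_ - _); rewrite -mulr_suml.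
  rewrite (eq_bigr (fun i => - a i.+1 - - a i)); last by move=> i _; rewrite opprK addrC.
  by rewrite (telescope_sumr (fun i => - a i)) // ak aK oppr0 sub0r opprK mul1r.
have {}step : ((\sum_(k <= i < K) (a i - a i.+1) * c i - r)%:E <= I0 + (e / 2)%:E)%E.
  rewrite -sumE; apply: (le_trans _ (ltW hm)).
  apply: (le_trans (step _ _)).
  - apply: integrableS (integrable_phi m) => //.
    by move=> t; rewrite /I01 /= !in_itv /= => /andP[/ltW ->].
  - move=> i t hi t1 t2.
    have [z [v [zt Dv cv]]] := hc i t hi t1 t2.
    rewrite lerBlDr (le_trans cv) // lerD2r; apply: phi_ge; first by case/andP: (inv_succ m).
    by exists z => //; apply: lt_le_trans zt _; rewrite ge_min lexx.
  rewrite ak aK integral_itv_obnd_cbnd //.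
  apply: measurable_funTS; exact: phi_measurable.
have -> : max_path_integral D gam = I0.
  by apply: eq_integral => t _; rewrite dgam.
have -> : \sum_(k <= i < K) (a i - a i.+1) * c i =
  \sum_(k <= i < K) (a i - a i.+1) * c i - r + r by rewrite subrK.
rewrite EFinD (le_trans (leeD2r _ step)) // -addeA leeD2l // -EFinD lee_fin.
by rewrite [leRHS](splitr e) lerD2l ge_min lexx orbT.
Qed.

End PathIntegral.

(** * Step sizes as a clock *)

Section Clock.
Context {R : realType}.
Variable eta : nat -> R.
Hypothesis eta_gt0 : forall k, 0 < eta k.
Hypothesis eta_div : series eta @ \oo --> +oo.

Lemma clockS j : series eta j.+1 = series eta j + eta j.
Proof. by rewrite /series /= big_nat_recr. Qed.

Lemma clock_le j l : (j <= l)%N -> series eta j <= series eta l.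
Proof.
elim: l => [|l ih]; first by rewrite leqn0 => /eqP ->.
rewrite leq_eqVlt => /predU1P[-> //|]; rewrite ltnS => /ih h.
by rewrite clockS (le_trans h) // lerDl ltW.
Qed.

Lemma clock_lt j l : (j < l)%N -> series eta j < series eta l.
Proof. by move=> /clock_le; apply: lt_le_trans; rewrite clockS ltrDl. Qed.

Lemma clock_sum k K : (k <= K)%N ->
  \sum_(k <= i < K) eta i = series eta K - series eta k.
Proof. by move=> kK; rewrite sub_series_geq. Qed.

Lemma clock_unbounded (M : R) : exists j, M < series eta j.
Proof.
have /cvgryPgt /(_ M) [N _ hN] := eta_div.
by exists N; exact: (hN N (leqnn N)).
Qed.

Lemma clock_index_ex (M : R) : exists j, M < series eta j.+1.
Proof.
have [j hj] := clock_unbounded M; exists j; apply: (lt_trans hj).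
by rewrite clockS ltrDl.
Qed.

(** The step in progress at time [M], when step [j] starts at time [series eta j]. *)
Definition clock_index (M : R) : nat := ex_minn (clock_index_ex M).

Lemma clock_index_lt M : M < series eta (clock_index M).+1.
Proof. by rewrite /clock_index; case: ex_minnP. Qed.

Lemma clock_index_between M j : series eta j <= M -> M < series eta j.+1 ->
  clock_index M = j.
Proof.
rewrite /clock_index; case: ex_minnP => i hi imin h1 h2; apply/eqP.
rewrite eqn_leq imin //= leqNgt; apply/negP => ij.
by have := clock_le ij; rewrite leNgt (le_lt_trans h1 hi).
Qed.

Lemma clock_index_le M : 0 <= M -> series eta (clock_index M) <= M.
Proof.
move=> M0; rewrite /clock_index; case: ex_minnP => -[|i] hi imin.
  by rewrite /series /= big_geq.
by rewrite leNgt; apply/negP => /imin; rewrite ltnn.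
Qed.

Lemma clock_index_clock j : clock_index (series eta j) = j.
Proof. by apply: clock_index_between; rewrite // clock_lt. Qed.

Lemma clock_index_ge M N : series eta N <= M -> (N <= clock_index M)%N.
Proof.
move=> h; rewrite leqNgt; apply/negP => /clock_le.
by rewrite leNgt (le_lt_trans h (clock_index_lt M)).
Qed.

End Clock.

Section Trajectory.
Context {R : realType} {n : nat}.
Variables (eta : nat -> R) (x p q : nat -> 'rV[R]_n) (C P : R).
Hypothesis eta_gt0 : forall k, 0 < eta k.
Hypothesis xS : forall k, x k.+1 = x k - eta k *: p k.
Hypothesis p_le : forall k, `|p k| <= P.
Hypothesis q_lip : forall k, `|q k.+1 - q k| <= C * eta k.

Local Notation s := (series eta).

Let C0 : 0 <= C.
Proof. by have := le_trans (normr_ge0 _) (q_lip 0); rewrite pmulr_lge0. Qed.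

Let P0 : 0 <= P. Proof. exact: le_trans (p_le 0). Qed.

Let q_dist_le j l : (j <= l)%N -> `|q l - q j| <= C * (s l - s j).
Proof.
elim: l => [|l ih]; first by rewrite leqn0 => /eqP ->; rewrite !subrr normr0 mulr0.
rewrite leq_eqVlt => /predU1P[->|]; first by rewrite !subrr normr0 mulr0.
rewrite ltnS => /ih h.
have -> : q l.+1 - q j = (q l.+1 - q l) + (q l - q j) by rewrite addrA subrK.
rewrite (le_trans (ler_normD _ _)) // clockS addrAC [_ - _ + _]addrC mulrDr.
exact: lerD.
Qed.

Let x_dist_le j l : (j <= l)%N -> `|x l - x j| <= P * (s l - s j).
Proof.
elim: l => [|l ih]; first by rewrite leqn0 => /eqP ->; rewrite !subrr normr0 mulr0.
rewrite leq_eqVlt => /predU1P[->|]; first by rewrite !subrr normr0 mulr0.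
rewrite ltnS => /ih h.
have -> : x l.+1 - x j = (x l - x j) - eta l *: p l by rewrite xS addrAC.
rewrite (le_trans (ler_normB _ _)) // clockS addrAC mulrDr lerD //.
by rewrite normrZ gtr0_norm // mulrC ler_wpM2r // ltW.
Qed.

Lemma q_dist j l : `|q l - q j| <= C * `|s l - s j|.
Proof.
have [jl|/ltnW lj] := leqP j l.
  by rewrite [`|s l - s j|]ger0_norm ?q_dist_le // subr_ge0 clock_le.
by rewrite distrC [`|s l - s j|]distrC ger0_norm ?q_dist_le // subr_ge0 clock_le.
Qed.

Lemma x_dist j l : `|x l - x j| <= P * `|s l - s j|.
Proof.
have [jl|/ltnW lj] := leqP j l.
  by rewrite [`|s l - s j|]ger0_norm ?x_dist_le // subr_ge0 clock_le.
by rewrite distrC [`|s l - s j|]distrC ger0_norm ?x_dist_le // subr_ge0 clock_le.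
Qed.

Let expand_le N e j l : (forall i, (N <= i)%N -> `|p i - q i| <= e) ->
  (N <= j)%N -> (j <= l)%N ->
  `|x l - x j + (s l - s j) *: q j| <= C * (s l - s j) ^+ 2 + e * (s l - s j).
Proof.
move=> he Nj; elim: l => [|l ih].
  by rewrite leqn0 => /eqP ->; rewrite !subrr scale0r addr0 normr0 expr0n !mulr0 addr0.
rewrite leq_eqVlt => /predU1P[->|].
  by rewrite !subrr scale0r addr0 normr0 expr0n !mulr0 addr0.
rewrite ltnS => jl; have {ih} := ih jl; rewrite clockS xS.
set u := s l - s j => ih.
have u0 : 0 <= u by rewrite subr_ge0 clock_le.
have -> : x l - eta l *: p l - x j + (s l + eta l - s j) *: q j =
   (x l - x j + u *: q j) - eta l *: ((p l - q l) + (q l - q j)).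
  have -> : s l + eta l - s j = u + eta l by rewrite /u addrAC.
  by apply/rowP => i; rewrite !mxE; ring.
have -> : s l + eta l - s j = u + eta l by rewrite /u addrAC.
rewrite (le_trans (ler_normB _ _)) // normrZ gtr0_norm //.
have h : `|(p l - q l) + (q l - q j)| <= e + C * u.
  by rewrite (le_trans (ler_normD _ _)) // lerD // ?q_dist_le // he // (leq_trans Nj).
apply: (@le_trans _ _ (C * u ^+ 2 + e * u + eta l * (e + C * u))).
  by rewrite lerD // ler_wpM2l // ltW.
have el : 0 <= eta l by rewrite ltW.
rewrite -subr_ge0 (_ : _ - _ = C * (eta l * u + eta l ^+ 2)); last by ring.
by rewrite mulr_ge0 // addr_ge0 // ?mulr_ge0 // sqr_ge0.
Qed.

(** While [p] is close to the slowly varying [q], the trajectory is a line of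
    slope [- q] up to second order. *)
Lemma x_expand N e j l : (forall i, (N <= i)%N -> `|p i - q i| <= e) ->
  (N <= j)%N -> (N <= l)%N ->
  `|x l - x j + (s l - s j) *: q j| <= 2 * C * (s l - s j) ^+ 2 + e * `|s l - s j|.
Proof.
move=> he Nj Nl; have [jl|/ltnW lj] := leqP j l.
  apply: (le_trans (expand_le he Nj jl)).
  rewrite ger0_norm ?subr_ge0 ?clock_le // lerD2r -mulrA ler_peMl //.
    by rewrite mulr_ge0 // sqr_ge0.
  by rewrite ler1n.
have -> : x l - x j + (s l - s j) *: q j =
  - (x j - x l + (s j - s l) *: q l) + (s j - s l) *: (q l - q j).
  by apply/rowP => i; rewrite !mxE; ring.
rewrite (le_trans (ler_normD _ _)) // normrN normrZ.
have h1 := expand_le he Nl lj.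
have h2 : `|q l - q j| <= C * (s j - s l) by rewrite distrC q_dist_le.
have u0 : 0 <= s j - s l by rewrite subr_ge0 clock_le.
have e1 : `|s l - s j| = s j - s l by rewrite distrC ger0_norm.
rewrite e1 (ger0_norm u0).
apply: (@le_trans _ _ (C * (s j - s l) ^+ 2 + e * (s j - s l) + (s j - s l) * (C * (s j - s l)))).
  by rewrite lerD // ler_wpM2l.
by rewrite -subr_ge0 (_ : _ - _ = 0) //; ring.
Qed.

End Trajectory.

(** * Limit path of a family of windows *)

(** Convergence along an ultrafilter comes for free in a compact set; this
    replaces the extraction of subsequences. *)
Lemma ultra_compact_cvg (I : Type) (T : topologicalType) (U : set_system I)
    (K : set T) (u : I -> T) : UltraFilter U -> compact K -> (forall k, K (u k)) ->
  exists2 l, K l & u @ U --> l.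
Proof.
move=> UU cK uK.
have UK : (u @ U) K by apply: (@nearW _ U).
have [l [Kl cl]] := cK (u @ U) _ UK.
exists l => // V lV; have [//|Vc] := in_ultra_setVsetC (u @^-1` V) UU.
by have [y [nVy Vy]] := cl (~` V) V Vc lV.
Qed.

Section LimitPath.
Context {R : realType} {n : nat}.
Variables (eta : nat -> R) (x p q : nat -> 'rV[R]_n) (K : nat -> nat) (C P B T : R).
Hypothesis eta_gt0 : forall k, 0 < eta k.
Hypothesis eta_div : series eta @ \oo --> +oo.
Hypothesis eta_cvg : eta @ \oo --> (0 : R).
Hypothesis xS : forall k, x k.+1 = x k - eta k *: p k.
Hypothesis p_le : forall k, `|p k| <= P.
Hypothesis x_le : forall k, `|x k| <= B.
Hypothesis q_le : forall k, `|q k| <= B.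
Hypothesis q_lip : forall k, `|q k.+1 - q k| <= C * eta k.
Hypothesis pq : forall e, 0 < e -> \forall k \near \oo, `|p k - q k| <= e.
Hypothesis K_ge : forall k, (k <= K k)%N.
Hypothesis K_le : forall k, series eta (K k) - series eta k <= T.

Local Notation s := (series eta).
Let S k := s (K k) - s k.

(** Windows are rescaled to unit duration and run backwards, so that their start, where
    [f] should be larger, is the end point of the path. *)
Definition back_time k t := s (K k) - S k * t.
Definition back_index k t := clock_index eta_gt0 eta_div (back_time k t).

Let S0 k : 0 <= S k. Proof. by rewrite subr_ge0 clock_le. Qed.
Let T0 : 0 <= T. Proof. exact: le_trans (S0 0) (K_le 0). Qed.
Let C0 : 0 <= C.
Proof. by have := le_trans (normr_ge0 _) (q_lip 0); rewrite pmulr_lge0. Qed.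
Let P0 : 0 <= P. Proof. exact: le_trans (p_le 0). Qed.

Lemma back_index_start k : back_index k 1 = k.
Proof. by rewrite /back_index /back_time mulr1 opprB addrCA subrr addr0 clock_index_clock. Qed.

Lemma back_index_end k : back_index k 0 = K k.
Proof. by rewrite /back_index /back_time mulr0 subr0 clock_index_clock. Qed.

Lemma back_time_ge k t : s k - T * `|t - 1| <= back_time k t.
Proof.
have -> : back_time k t = s k - S k * (t - 1) by rewrite /back_time /S; ring.
rewrite lerD2l lerN2 (le_trans (ler_norm _)) // normrM (ger0_norm (S0 k)).
by rewrite ler_wpM2r // K_le.
Qed.

Lemma back_index_ge01 k t : t <= 1 -> (k <= back_index k t)%N.
Proof.
move=> t1; apply: clock_index_ge; rewrite /back_time.
have -> : s k = s (K k) - S k by rewrite /S opprB addrCA subrr addr0.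
by rewrite lerD2l lerN2 ler_piMr.
Qed.

Lemma back_time_large t M : \forall k \near \oo, M <= back_time k t.
Proof.
have /cvgryPge /(_ (M + T * `|t - 1|)) := eta_div; apply: filterS => k hk.
by apply: le_trans (back_time_ge k t); rewrite lerBrDr.
Qed.

Lemma back_index_large t N : \forall k \near \oo, (N <= back_index k t)%N.
Proof.
by apply: filterS (back_time_large t (s N)) => k; apply: clock_index_ge.
Qed.

Lemma back_index_clock_dist k t (e : R) N : 0 <= back_time k t ->
  (N <= back_index k t)%N -> (forall i, (N <= i)%N -> eta i <= e) ->
  `|s (back_index k t) - back_time k t| <= e.
Proof.
move=> t0 Nk he; rewrite distrC ger0_norm ?subr_ge0 ?clock_index_le // lerBlDl.
apply: le_trans (ltW (clock_index_lt eta_gt0 eta_div _)) _.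
by rewrite clockS lerD2l he.
Qed.

Lemma eta_small (e : R) : 0 < e -> exists N, forall i, (N <= i)%N -> eta i <= e.
Proof.
move=> e0; have /cvgrPdist_le /(_ e e0) [N _ hN] := eta_cvg.
exists N => i /hN /=; rewrite sub0r normrN ger0_norm //; exact: ltW.
Qed.

Lemma back_index_clock_cvg t :
  (fun k => s (back_index k t) - back_time k t) @ \oo --> (0 : R).
Proof.
apply/cvgrPdist_le => e e0; have [N hN] := eta_small e0.
near=> k; rewrite sub0r normrN; apply: (back_index_clock_dist (N := N)) => //.
  by near: k; exact: back_time_large.
by near: k; exact: back_index_large.
Unshelve. all: by end_near. Qed.

Variable U : set_system nat.
Hypothesis UU : UltraFilter U.
Hypothesis ooU : \oo `<=` U.

(** Limits along [U] exist at every real time at once, so that no countable dense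
    set of times has to be chosen first. *)
Lemma limit_path_exists : exists (tau : R) (gam w : R -> 'rV[R]_n),
  [/\ 0 <= tau <= T, S @ U --> tau,
      forall t, x (back_index k t) @[k --> U] --> gam t &
      forall t, q (back_index k t) @[k --> U] --> w t].
Proof.
have [tau] : exists2 tau, `[0, T]%classic tau & S @ U --> tau.
  apply: (ultra_compact_cvg UU (@segment_compact R 0 T)) => k.
  by rewrite /= in_itv /= S0 K_le.
rewrite /= in_itv /= => tau0 Stau.
have [gam hgam] : {gam : R -> 'rV[R]_n &
    forall t, x (back_index k t) @[k --> U] --> gam t}.
  apply: (@boolp.choice R 'rV[R]_n (fun t l => x (back_index k t) @[k --> U] --> l)) => t.
  have [|l _ hl] := ultra_compact_cvg (u := fun k => x (back_index k t)) UU (@compact_normball R n B).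
    by move=> k; exact: x_le.
  by exists l.
have [w hw] : {w : R -> 'rV[R]_n &
    forall t, q (back_index k t) @[k --> U] --> w t}.
  apply: (@boolp.choice R 'rV[R]_n (fun t l => q (back_index k t) @[k --> U] --> l)) => t.
  have [|l _ hl] := ultra_compact_cvg (u := fun k => q (back_index k t)) UU (@compact_normball R n B).
    by move=> k; exact: q_le.
  by exists l.
by exists tau, gam, w.
Qed.

Variables (tau : R) (gam w : R -> 'rV[R]_n).
Hypothesis tau0 : 0 <= tau <= T.
Hypothesis Stau : S @ U --> tau.
Hypothesis hgam : forall t, x (back_index k t) @[k --> U] --> gam t.
Hypothesis hw : forall t, q (back_index k t) @[k --> U] --> w t.

Let clock_diff_cvg t t' :
  (fun k => s (back_index k t') - s (back_index k t)) @ U --> tau * (t - t').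
Proof.
have h t0 : (fun k => s (back_index k t0) - back_time k t0) @ U --> (0 : R).
  by move=> V hV; apply: ooU; exact: (@back_index_clock_cvg t0 V hV).
have h3 : (fun k => S k * (t - t')) @ U --> tau * (t - t').
  by apply: (@cvgM _ _ U); [exact: Stau|exact: cvg_cst].
have h4 := cvgD (cvgB (h t') (h t)) h3; rewrite subrr add0r in h4.
have -> : (fun k => s (back_index k t') - s (back_index k t)) =
  (fun k => s (back_index k t') - back_time k t') -
  (fun k => s (back_index k t) - back_time k t) + (fun k => S k * (t - t')).
  by apply/funext => k; rewrite !fctE /back_time; ring.
exact: h4.
Qed.

Let norm_le_limit (u : nat -> 'rV[R]_n) (b : nat -> R) l bl :
  u @ U --> l -> b @ U --> bl -> (\forall k \near U, `|u k| <= b k) -> `|l| <= bl.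
Proof.
move=> ul bbl h; apply: (ler_cvg_to (a := U) _ bbl h).
exact: cvg_norm.
Qed.

Lemma limit_path_le t : `|gam t| <= B.
Proof.
apply: (@norm_le_limit _ (fun=> B) _ _ (@hgam t)); first exact: cvg_cst.
exact: nearW.
Qed.

Lemma limit_velocity_le t : `|w t| <= B.
Proof.
apply: (@norm_le_limit _ (fun=> B) _ _ (@hw t)); first exact: cvg_cst.
exact: nearW.
Qed.

Lemma limit_path_lip t t' : `|gam t - gam t'| <= P * T * `|t - t'|.
Proof.
apply: (@le_trans _ _ (P * `|tau * (t' - t)|)).
  apply: (norm_le_limit (cvgB (@hgam t) (@hgam t'))
    (cvgM (cvg_cst P) (cvg_norm (@clock_diff_cvg t' t)))).
  by apply: nearW => k; rewrite !fctE; exact: (x_dist eta_gt0 xS p_le).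
case/andP: tau0 => t0 tT.
by rewrite normrM (ger0_norm t0) -mulrA ler_wpM2l // distrC ler_wpM2r.
Qed.

Lemma limit_velocity_lip t t' : `|w t - w t'| <= C * T * `|t - t'|.
Proof.
apply: (@le_trans _ _ (C * `|tau * (t' - t)|)).
  apply: (norm_le_limit (cvgB (@hw t) (@hw t'))
    (cvgM (cvg_cst C) (cvg_norm (@clock_diff_cvg t' t)))).
  by apply: nearW => k; rewrite !fctE; exact: (q_dist eta_gt0 q_lip).
case/andP: tau0 => t0 tT.
by rewrite normrM (ger0_norm t0) -mulrA ler_wpM2l // distrC ler_wpM2r.
Qed.

(** The second-order expansion of the trajectory passes to the limit. *)
Lemma limit_path_derive t : derive1 gam t = tau *: w t.
Proof.
apply: (@derive1_quadratic _ _ _ _ _ (2 * C * tau ^+ 2)) => t'.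
apply/ler_addgt0Pr => e e0.
pose e' := e / (`|tau * (t - t')| + 1).
have d0 : 0 < `|tau * (t - t')| + 1 by rewrite ltr_wpDl.
have e'0 : 0 < e' by rewrite divr_gt0.
apply: (@le_trans _ _ (2 * C * (tau * (t - t')) ^+ 2 + e' * `|tau * (t - t')|)).
  have -> : (t' - t) *: (tau *: w t) = - ((tau * (t - t')) *: w t).
    by rewrite scalerA -scaleNr; congr (_ *: _); ring.
  rewrite opprK.
  have [N _ hN] := pq e'0.
  apply: (norm_le_limit (cvgD (cvgB (@hgam t') (@hgam t))
    (cvgZ (@clock_diff_cvg t t') (@hw t)))
    (cvgD (cvgM (cvg_cst (2 * C)) (cvgM (@clock_diff_cvg t t') (@clock_diff_cvg t t')))
      (cvgM (cvg_cst e') (cvg_norm (@clock_diff_cvg t t'))))).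
  have hk : U (fun k => (N <= back_index k t)%N /\ (N <= back_index k t')%N).
    by apply: filterI; apply: ooU; exact: back_index_large.
  apply: filterS hk => k [k1 k2]; rewrite !fctE.
  exact: (x_expand eta_gt0 xS q_lip hN).
rewrite exprMn (_ : 2 * C * (tau ^+ 2 * (t - t') ^+ 2) = 2 * C * tau ^+ 2 * (t' - t) ^+ 2); last by ring.
rewrite lerD2l /e' mulrAC ler_pdivrMr // ler_pM2l //.
by rewrite lerDl.
Qed.

(** Pointwise convergence on [0, 1] is uniform, by equicontinuity. *)
Let uniform_cvg (G : nat -> R -> 'rV[R]_n) (L : R -> 'rV[R]_n) (c : R) :
  (forall t, G ^~ t @ U --> L t) -> (forall t t', `|L t - L t'| <= c * `|t - t'|) ->
  (forall e, 0 < e -> \forall k \near U, forall t t', 0 <= t <= 1 -> 0 <= t' <= 1 ->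
     `|G k t - G k t'| <= c * `|t - t'| + e) ->
  forall e, 0 < e -> \forall k \near U, forall t, 0 <= t <= 1 -> `|G k t - L t| <= e.
Proof.
move=> GL Llip Gequi e e0.
have c0 : 0 <= c.
  by have := Llip 1 0; rewrite subr0 normr1 mulr1; apply: le_trans.
have e4 : 0 < e / 4 by rewrite divr_gt0.
have /compact_near_coveringP cov := @segment_compact R 0 1.
have : \forall k \near U, `[0, 1]%classic `<=` (fun t => 0 <= t <= 1 -> `|G k t - L t| <= e).
  apply: (cov nat U (fun k t => 0 <= t <= 1 -> `|G k t - L t| <= e)) => t /=.
  rewrite in_itv /= => t01.
  have c1 : 0 < c + 1 by rewrite ltr_wpDl.
  exists ([set t' | `|t' - t| < e / 4 / (c + 1)],
     [set k | (forall t t', 0 <= t <= 1 -> 0 <= t' <= 1 ->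
       `|G k t - G k t'| <= c * `|t - t'| + e / 4) /\ `|L t - G k t| <= e / 4]).
    split => /=; first by apply: (@near_norm_lt R R^o); rewrite divr_gt0.
    apply: filterI; first exact: Gequi.
    by move/cvgrPdist_le: (GL t); apply.
  move=> [t' k] /= [t't [h1 h2]] t'01.
  have ct : c * `|t' - t| <= e / 4.
    apply: (@le_trans _ _ ((c + 1) * `|t' - t|)); first by rewrite ler_wpM2r // lerDl.
    by rewrite -ler_pdivlMl // mulrC ltW.
  have -> : G k t' - L t' = (G k t' - G k t) + (G k t - L t) + (L t - L t').
    by apply/rowP => i; rewrite !mxE; ring.
  have -> : e = (e / 4 + e / 4 + e / 4) + e / 4 by field.
  rewrite (le_trans (ler_normD _ _)) // lerD //; last first.
    by rewrite (le_trans (Llip _ _)) // distrC.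
  rewrite (le_trans (ler_normD _ _)) // lerD //; last by rewrite distrC.
  by rewrite (le_trans (h1 _ _ t'01 t01)) // lerD2r.
by apply: filterS => k hk t t01; apply: hk => //=; rewrite in_itv.
Qed.

Let back_equicontinuous (u : nat -> 'rV[R]_n) c : 0 <= c ->
  (forall j l, `|u l - u j| <= c * `|s l - s j|) ->
  forall e, 0 < e -> \forall k \near U, forall t t', 0 <= t <= 1 -> 0 <= t' <= 1 ->
     `|u (back_index k t) - u (back_index k t')| <= c * T * `|t - t'| + e.
Proof.
move=> c0 ulip e e0.
pose e' := e / (2 * c + 1).
have c1 : 0 < 2 * c + 1 by rewrite ltr_wpDl // mulr_ge0.
have e'0 : 0 < e' by rewrite divr_gt0.
have [N hN] := eta_small e'0.
apply: ooU; exists N => //= k Nk t t' /andP[t0 t1] /andP[t'0 t'1].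
have bt0 r : 0 <= r <= 1 -> 0 <= back_time k r.
  move=> /andP[r0 r1]; rewrite /back_time /S subr_ge0.
  rewrite (le_trans (_ : _ <= (s (K k) - s k) * 1)) ?ler_wpM2l ?S0 //.
  rewrite mulr1 gerBl (le_trans _ (clock_le eta_gt0 (leq0n k))) //.
  by rewrite /series /= big_geq.
have h r : 0 <= r <= 1 -> `|s (back_index k r) - back_time k r| <= e'.
  move=> r01; apply: (back_index_clock_dist (N := N)) => //; first exact: bt0.
  by apply: leq_trans Nk (back_index_ge01 _ _); case/andP: r01.
have ht := h t _; have ht' := h t' _.
apply: (le_trans (ulip _ _)).
apply: (@le_trans _ _ (c * (T * `|t - t'| + 2 * e'))).
  rewrite ler_wpM2l //.
  have -> : s (back_index k t) - s (back_index k t') =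
    (s (back_index k t) - back_time k t) - (s (back_index k t') - back_time k t')
      + S k * (t' - t) by rewrite /back_time; ring.
  rewrite (le_trans (ler_normD _ _)) // addrC lerD //.
    by rewrite normrM (ger0_norm (S0 k)) [`|t - t'|]distrC ler_wpM2r // K_le.
  rewrite (le_trans (ler_normB _ _)) // mulr_natl mulr2n lerD //.
    by apply: ht; rewrite t0.
  by apply: ht'; rewrite t'0.
rewrite mulrDr [c * (T * _)]mulrA lerD2l /e'.
rewrite (_ : c * (2 * (e / (2 * c + 1))) = e * (2 * c) / (2 * c + 1)); last by ring.
by rewrite ler_pdivrMr // ler_pM2l // lerDl.
Qed.

Lemma limit_path_uniform e : 0 < e -> \forall k \near U, forall t, 0 <= t <= 1 ->
  `|x (back_index k t) - gam t| <= e.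
Proof.
apply: (uniform_cvg hgam limit_path_lip).
apply: back_equicontinuous => // j l; exact: (x_dist eta_gt0 xS p_le).
Qed.

Lemma limit_velocity_uniform e : 0 < e -> \forall k \near U, forall t, 0 <= t <= 1 ->
  `|q (back_index k t) - w t| <= e.
Proof.
apply: (uniform_cvg hw limit_velocity_lip).
apply: back_equicontinuous => // j l; exact: (q_dist eta_gt0 q_lip).
Qed.

End LimitPath.

(** * The chain rule along the iterates *)

Section ChainRule.
Context {R : realType} {n : nat}.
Variables (f : 'rV[R]_n -> R) (D : 'rV[R]_n -> set 'rV[R]_n).
Hypothesis f_cont : continuous f.
Hypothesis closedD : closed [set p : 'rV[R]_n * 'rV[R]_n | D p.1 p.2].
Hypothesis D0 : forall x, D x !=set0.
Hypothesis D_loc : forall x : 'rV[R]_n,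
  exists B, \forall z \near x, forall v, D z v -> `|v| <= B.
Hypothesis potD : potential f D.

Lemma bounded_field_on_ball (M : R) :
  exists2 B, 0 <= B & forall z, `|z| <= M -> forall v, D z v -> `|v| <= B.
Proof.
have [B hB] := @compact_uniform_bound R 'rV[R]_n _
  (fun z B => forall v, D z v -> `|v| <= B) (@compact_normball R n M)
  (fun z B B' BB' h v Dv => le_trans (h v Dv) BB') (fun x _ => D_loc x).
exists `|B| => // z zM v Dv; exact: le_trans (hB z zM v Dv) (ler_norm _).
Qed.

Variables (eta : nat -> R) (x p q d z : nat -> 'rV[R]_n) (K : nat -> nat) (C P B T : R).
Hypothesis eta_gt0 : forall k, 0 < eta k.
Hypothesis eta_div : series eta @ \oo --> +oo.
Hypothesis eta_cvg : eta @ \oo --> (0 : R).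
Hypothesis xS : forall k, x k.+1 = x k - eta k *: p k.
Hypothesis p_le : forall k, `|p k| <= P.
Hypothesis x_le : forall k, `|x k| <= B.
Hypothesis q_le : forall k, `|q k| <= B.
Hypothesis q_lip : forall k, `|q k.+1 - q k| <= C * eta k.
Hypothesis pq : forall e, 0 < e -> \forall k \near \oo, `|p k - q k| <= e.
Hypothesis K_ge : forall k, (k <= K k)%N.
Hypothesis K_le : forall k, series eta (K k) - series eta k <= T.
Hypothesis zx : forall e, 0 < e -> \forall k \near \oo, `|z k - x k| <= e.
Hypothesis Dd : forall k, D (z k) (d k).

(** Discrete chain rule: over windows of bounded length, [f] decreases at least
    as much as the field predicts, up to a vanishing error.  Otherwise the
    windows with a given error have a limit path along an ultrafilter.  The path
    is differentiable with velocity the limit of the velocities, so that on it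
    the field predicts exactly the variation of [f], while by semicontinuity the
    discrete predictions are asymptotically bounded by the predictions on the
    limit path.  Running the path backwards gives the inequality in the
    direction of descent. *)
Lemma discrete_chain_rule e : 0 < e -> \forall k \near \oo,
  f (x (K k)) + \sum_(k <= i < K k) eta i * dotp (d i) (p i) <= f (x k) + e.
Proof.
move=> e0; apply: contrapT => bad.
pose A := [set k | ~ (f (x (K k)) + \sum_(k <= i < K k) eta i * dotp (d i) (p i) <= f (x k) + e)].
have PA : ProperFilter (within A \oo).
  apply: Build_ProperFilter; rewrite /within /= => h; apply: bad.
  by apply: filterS h => k h; apply: contrapT.
have [U [UU AU]] := ultraFilterLemma PA.
have ooU : \oo `<=` U.
  by move=> V hV; apply: AU; apply: (@filterS _ \oo _ _ _ _ hV) => k Vk _.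
have UA : U A by apply: AU; apply: (@filterE _ \oo).
have [tau [gam [w [tau0 Stau hgam hw]]]] :=
  limit_path_exists eta_gt0 eta_div x_le q_le K_ge K_le UU.
have gam_le := limit_path_le x_le UU hgam.
have w_le := limit_velocity_le q_le UU hw.
have gam_lip := limit_path_lip eta_cvg xS p_le K_ge K_le UU ooU tau0 Stau hgam.
have w_lip := limit_velocity_lip eta_cvg q_lip K_ge K_le UU ooU tau0 Stau hw.
have gam_der := limit_path_derive eta_cvg xS q_lip pq K_ge K_le UU ooU Stau hgam hw.
have [BD BD0 D_le] := bounded_field_on_ball (B + 1).
have [t0 tT] := andP tau0.
have T0 : 0 <= T := le_trans t0 tT.
have B0 : 0 <= B := le_trans (normr_ge0 _) (x_le 0%N).
have P0 : 0 <= P := le_trans (normr_ge0 _) (p_le 0%N).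
have C0 : 0 <= C.
  by have := le_trans (normr_ge0 _) (q_lip 0%N); rewrite pmulr_lge0.
have e4 : 0 < e / 4 by rewrite divr_gt0.
have [||||r r0 hr] := @step_sum_le_max_path_integral R n D gam (fun t => tau *: w t)
  (P * T + T * (C * T)) (T * B + BD) closedD D0 _ _ _ _ (e / 4) gam_der e4.
- move=> s t; apply: (le_trans (gam_lip s t)).
  by rewrite ler_wpM2r // lerDl !mulr_ge0.
- move=> s t; rewrite -scalerBr normrZ (ger0_norm t0).
  apply: (@le_trans _ _ (T * (C * T * `|s - t|))); first by rewrite ler_pM.
  by rewrite mulrA ler_wpM2r // lerDr mulr_ge0.
- move=> t; rewrite normrZ (ger0_norm t0).
  by apply: (@le_trans _ _ (T * B)); rewrite ?lerDl // ler_pM.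
- move=> t y v yt Dv; apply: (@le_trans _ _ BD); last by rewrite lerDr mulr_ge0.
  apply: (D_le y) Dv; rewrite -(subrK (gam t) y) addrC.
  by apply: (le_trans (ler_normD _ _)); rewrite lerD.
(* With [e1 = r / c], three errors of size [e1] in the velocities change the
   predictions by at most [r]. *)
pose c := (2 * T + B + 1) * (n%:R * BD + 1).
have c0 : 0 < c.
  by rewrite mulr_gt0 // ltr_wpDl // ?addr_ge0 ?mulr_ge0.
pose e1 := r / c.
have e10 : 0 < e1 by rewrite divr_gt0.
have r4 : 0 < r / 4 by rewrite divr_gt0.
have hx := limit_path_uniform eta_cvg xS p_le K_ge K_le UU ooU tau0 Stau hgam r4.
have hq := limit_velocity_uniform eta_cvg q_lip K_ge K_le UU ooU tau0 Stau hw e10.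
have hS : \forall k \near U, `|series eta (K k) - series eta k - tau| <= e1.
  by move/cvgrPdist_le : Stau => /(_ e1 e10); apply: filterS => k; rewrite distrC.
have r41 : 0 < Num.min (r / 4) 1 by rewrite lt_min r4 ltr01.
have [N1 _ hN1] := zx r41.
have [N2 _ hN2] := pq e10.
have hN : \forall k \near U, (maxn N1 N2 <= k)%N.
  by apply: ooU; exists (maxn N1 N2).
have hf t j : (forall k, back_index K eta_gt0 eta_div k t = j k) ->
    \forall k \near U, `|f (gam t) - f (x (j k))| <= e / 4.
  move=> hj.
  have h : f (x (back_index K eta_gt0 eta_div k t)) @[k --> U] --> f (gam t).
    by apply: continuous_cvg; [exact: f_cont|exact: hgam].
  move/cvgrPdist_le : h => /(_ _ e4); apply: filterS => k /=.
  by rewrite hj.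
have hf0 := hf 0 K (back_index_end K eta_gt0 eta_div).
have hf1 := hf 1 id (back_index_start K eta_gt0 eta_div).
have UT := filter_ex (filterI UA (filterI hx (filterI hq (filterI hS (filterI hN (filterI hf0 hf1)))))).
case: UT => k [kA [kx [kq [kS [kN [kf0 kf1]]]]]].
have kK : (k < K k)%N.
  rewrite ltn_neqAle K_ge andbT; apply/eqP => kK; apply: kA.
  by rewrite -kK big_geq // addr0 lerDl ltW.
set S := series eta (K k) - series eta k in kS.
have S0 : 0 < S by rewrite subr_gt0 clock_lt.
pose a i := (series eta (K k) - series eta i) / S.
have ac : absolutely_continuous01 gam.
  exact: (@lipschitz_absolutely_continuous01 _ _ _ (P * T)).
have pot := potD ac.
have hsum := hr a (fun i => S * dotp (p i) (d i)) k (K k) (ltnW kK).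
have {}hsum : ((\sum_(k <= i < K k) (a i - a i.+1) * (S * dotp (p i) (d i)))%:E <=
                max_path_integral D gam + (e / 4)%:E)%E.
  apply: hsum.
  - move=> i _; rewrite /a ler_pM2r ?invr_gt0 // lerD2l lerN2.
    by apply: clock_le.
  - by rewrite /a divff // gt_eqF.
  - by rewrite /a subrr mul0r.
  (* Between [a i.+1] and [a i] the window is at its step [i]. *)
  move=> i t /andP[ki iK] t1 t2.
  have ti : back_index K eta_gt0 eta_div k t = i.
    apply: clock_index_between; rewrite /back_time -/S.
      by rewrite lerBrDl -lerBrDr mulrC -ler_pdivlMr.
    by rewrite ltrBlDl -ltrBlDr mulrC -ltr_pdivrMr.
  have t01 : 0 <= t <= 1.
    apply/andP; split.
      by apply: (le_trans _ (ltW t1)); apply: divr_ge0; [rewrite subr_ge0 clock_le|exact: ltW].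
    by apply: (le_trans t2); rewrite ler_pdivrMr // mul1r lerD2l lerN2 clock_le.
  have Ni : (maxn N1 N2 <= i)%N := leq_trans kN ki.
  have N1i : (N1 <= i)%N by apply: leq_trans Ni; exact: leq_maxl.
  have N2i : (N2 <= i)%N by apply: leq_trans Ni; exact: leq_maxr.
  have xt := kx t t01; have qt := kq t t01; rewrite ti in xt qt.
  have zt : `|z i - gam t| <= r / 4 + r / 4.
    rewrite -(subrK (x i) (z i)) -addrA (le_trans (ler_normD _ _)) // lerD //.
    by apply: le_trans (hN1 _ N1i) _; rewrite ge_min lexx.
  have B1 : r / 4 + r / 4 < r by lra.
  exists (z i), (d i); split => //; first exact: le_lt_trans zt B1.
  have -> : S * dotp (p i) (d i) =
    dotp (tau *: w t) (d i) + dotp (S *: (p i - q i) + S *: (q i - w t) + (S - tau) *: w t) (d i).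
    rewrite -dotpDl -dotpZl; congr dotp.
    by apply/rowP => j; rewrite !mxE; ring.
  rewrite lerD2l (le_trans (ler_norm _)) // (le_trans (dotp_le_norm _ _)) //.
  have ST : S <= T by exact: K_le.
  have di : `|d i| <= BD.
    apply: D_le (Dd i).
    rewrite -(subrK (x i) (z i)) addrC (le_trans (ler_normD _ _)) // lerD //.
    by apply: le_trans (hN1 _ N1i) _; rewrite ge_min lexx orbT.
  have dist : `|S *: (p i - q i) + S *: (q i - w t) + (S - tau) *: w t| <= (2 * T + B + 1) * e1.
    apply: (@le_trans _ _ (T * e1 + T * e1 + e1 * B)).
      rewrite (le_trans (ler_normD _ _)) // lerD //.
        rewrite (le_trans (ler_normD _ _)) // !normrZ (gtr0_norm S0).
        by rewrite lerD // ler_pM // ?hN2 // ltW.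
      by rewrite normrZ ler_pM.
    rewrite -subr_ge0 (_ : _ - _ = e1); last by ring.
    exact: ltW.
  apply: (@le_trans _ _ (n%:R * ((2 * T + B + 1) * e1) * BD)).
    by apply: ler_pM => //; rewrite ?mulr_ge0 // ler_wpM2l.
  have -> : n%:R * ((2 * T + B + 1) * e1) * BD = r * ((2 * T + B + 1) * (n%:R * BD)) / c.
    by rewrite /e1; ring.
  rewrite ler_pdivrMr // ler_pM2l // ler_wpM2l ?lerDl //.
  by rewrite !addr_ge0 // mulr_ge0.
have sumE : \sum_(k <= i < K k) (a i - a i.+1) * (S * dotp (p i) (d i)) =
  \sum_(k <= i < K k) eta i * dotp (d i) (p i).
  apply: eq_bigr => i _.
  have -> : a i - a i.+1 = eta i / S by rewrite /a clockS; ring.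
  by rewrite mulrA divfK ?gt_eqF // dotpC.
rewrite sumE in hsum; apply: kA.
move: hsum pot; case: (max_path_integral D gam) => [I| |] //= hsum /eqP.
rewrite -EFinD eqe => /eqP fI; move: hsum; rewrite -EFinD lee_fin => hsum.
move: kf0 kf1; rewrite !ler_norml /= => /andP[k1 k2] /andP[k3 k4].
lra.
Qed.
End ChainRule.

(** * From descent over windows to convergence *)

Section Windows.
Context {R : realType}.
Variable eta : nat -> R.
Hypothesis eta_gt0 : forall k, 0 < eta k.
Hypothesis eta_div : series eta @ \oo --> +oo.
Hypothesis eta_cvg : eta @ \oo --> (0 : R).
Local Notation s := (series eta).

Definition window_end (delta : R) k := clock_index eta_gt0 eta_div (s k + delta).

Lemma clock_ge0 k : 0 <= s k.
Proof. by rewrite (le_trans _ (clock_le eta_gt0 (leq0n k))) // /series /= big_geq. Qed.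

Lemma window_end_ge delta k : 0 <= delta -> (k <= window_end delta k)%N.
Proof. by move=> d0; apply: clock_index_ge; rewrite lerDl. Qed.

Lemma window_length_le delta k : 0 <= delta -> s (window_end delta k) - s k <= delta.
Proof.
move=> d0; rewrite lerBlDl; apply: clock_index_le.
by rewrite addr_ge0 // clock_ge0.
Qed.

Lemma window_length_ge delta : 0 < delta ->
  \forall k \near \oo, delta / 2 <= s (window_end delta k) - s k.
Proof.
move=> d0; have d2 : 0 < delta / 2 by rewrite divr_gt0.
have /cvgrPdist_le /(_ _ d2) [N _ hN] := eta_cvg.
exists N => // k Nk; have Nw := leq_trans Nk (window_end_ge k (ltW d0)).
have := hN _ Nw; rewrite /= sub0r normrN ger0_norm => [h|]; last exact: ltW.
have := clock_index_lt eta_gt0 eta_div (s k + delta); rewrite -/(window_end delta k) clockS.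
move: h; set a := eta _; set b := s (window_end _ _); set c := s k; lra.
Qed.

Lemma window_end_gt delta : 0 < delta -> \forall k \near \oo, (k < window_end delta k)%N.
Proof.
move=> d0; apply: filterS (window_length_ge d0) => k h.
rewrite ltn_neqAle window_end_ge ?(ltW d0) // andbT; apply/eqP => kw.
by move: h; rewrite -kw subrr leNgt divr_gt0.
Qed.

Lemma window_end_le delta j k l : s j + delta <= s k + l ->
  (window_end delta j <= window_end l k)%N.
Proof.
move=> h; rewrite leqNgt; apply/negP => lt.
have := clock_index_lt eta_gt0 eta_div (s k + l); rewrite -/(window_end l k).
rewrite ltNge => /negP; apply; apply: le_trans h; apply: le_trans (clock_le eta_gt0 lt) _.
apply: clock_index_le; rewrite leNgt; apply/negP => neg.
move: lt; rewrite (_ : window_end delta j = 0%N) //; apply/eqP; rewrite -leqn0.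
rewrite /window_end /clock_index; case: ex_minnP => i _; apply.
by apply: lt_le_trans neg _; exact: clock_ge0.
Qed.

End Windows.

Lemma convex_average (R : realType) n (A : set 'rV[R]_n) (t : nat -> R) (a : nat -> 'rV[R]_n) k K :
  @convex_set R 'rV[R]_n A -> (k < K)%N -> (forall i, 0 < t i) ->
  (forall i, (k <= i < K)%N -> A (a i)) ->
  A ((\sum_(k <= i < K) t i)^-1 *: \sum_(k <= i < K) t i *: a i).
Proof.
move=> cA kK t0; elim: K kK => [//|K ih]; rewrite ltnS leq_eqVlt => /predU1P[<- Aa|kK Aa].
  rewrite !big_nat1 scalerA mulVf ?gt_eqF // scale1r; apply: Aa.
  by rewrite leqnn ltnSn.
rewrite !(big_nat_recr _ _ _ (ltnW kK)) /=.
set S := \sum_(k <= i < K) t i; set V := \sum_(k <= i < K) _.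
have S0 : 0 < S.
  rewrite /S big_ltn // ltr_pwDl //; apply: sumr_ge0 => i _; exact: ltW.
have ST : 0 < S + t K by rewrite addr_gt0.
have -> : (S + t K)^-1 *: (V + t K *: a K) =
   (S / (S + t K)) *: (S^-1 *: V) + (1 - S / (S + t K)) *: a K.
  have -> : 1 - S / (S + t K) = t K / (S + t K) by field; rewrite gt_eqF.
  rewrite scalerDr !scalerA; congr (_ *: _ + _ *: _); last by rewrite mulrC.
  by field; rewrite !gt_eqF.
apply: convex_setP => //.
- apply/andP; split; first by apply: divr_ge0; exact: ltW.
  by rewrite ler_pdivrMr // mul1r lerDl ltW.
- by apply: ih => // i /andP[ki iK]; apply: Aa; rewrite ki ltnS ltnW.
- by apply: Aa; rewrite ltnW //= ltnSn.
Qed.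

Section Descent.
Context {R : realType} {n : nat}.
Variables (D : 'rV[R]_n -> set 'rV[R]_n) (g : 'rV[R]_n -> R).
Hypothesis closedD : closed [set p : 'rV[R]_n * 'rV[R]_n | D p.1 p.2].
Hypothesis closed_values : forall x, closed (D x).
Hypothesis convD : forall x, @convex_set R 'rV[R]_n (D x).
Hypothesis D_loc : forall x : 'rV[R]_n,
  exists B, \forall z \near x, forall v, D z v -> `|v| <= B.
Hypothesis g_cont : continuous g.

Variables (eta theta Phi : nat -> R) (x p y d e z : nat -> 'rV[R]_n).
Variables (sigma c C Cp Ct ct Cg B : R).
Hypothesis eta_gt0 : forall k, 0 < eta k.
Hypothesis eta_div : series eta @ \oo --> +oo.
Hypothesis eta_cvg : eta @ \oo --> (0 : R).
Hypothesis sigma_ge0 : 0 <= sigma.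
Hypothesis c_gt0 : 0 < c.
Hypothesis ct_gt0 : 0 < ct.
Hypothesis Cp_ge0 : 0 <= Cp.
Hypothesis Cg_ge0 : 0 <= Cg.
Hypothesis theta_gt0 : forall k, 0 < theta k.
Hypothesis theta_le : forall k, theta k <= Ct * eta k.
Hypothesis theta_ge : \forall k \near \oo, ct * eta k <= theta k.
Hypothesis xS : forall k, x k.+1 = x k - eta k *: p k.
Hypothesis yS : forall k, y k.+1 =
  y k + theta k *: (d k + sigma *: x k - y k) - (sigma * eta k) *: p k.
Hypothesis y_lip : forall k, `|y k.+1 - y k| <= C * eta k.
Hypothesis p_le : forall e, 0 < e -> \forall k \near \oo, `|p k| <= Cp * `|y k| + e.
Hypothesis zx : forall e, 0 < e -> \forall k \near \oo, `|z k - x k| <= e.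
Hypothesis ed : forall r, 0 < r -> \forall k \near \oo, `|d k - e k| <= r.
Hypothesis De : forall k, D (z k) (e k).
Hypothesis Phi_le : forall k, `|Phi k| <= B.
Hypothesis Phi_g : forall k, `|Phi k - g (x k)| <= Cg * `|y k|.
Local Notation s := (series eta).
Hypothesis descent : forall K : nat -> nat, (forall k, (k <= K k)%N) ->
  (forall k, s (K k) - s k <= 1) -> forall r, 0 < r ->
  \forall k \near \oo, Phi (K k) + c * \sum_(k <= i < K k) eta i * `|y i| ^+ 2 <= Phi k + r.

Local Notation wend := (window_end eta_gt0 eta_div).

Let C0 : 0 <= C.
Proof. by have := le_trans (normr_ge0 _) (y_lip 0); rewrite pmulr_lge0. Qed.

Let sum_mono (u : nat -> R) k j l m : (forall i, 0 <= u i) -> (k <= j)%N -> (l <= m)%N ->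
  \sum_(j <= i < l) u i <= \sum_(k <= i < m) u i.
Proof.
move=> u0 kj lm; have [jl|/ltnW lj] := leqP j l; last first.
  by rewrite big_geq // sumr_ge0.
rewrite (big_cat_nat kj (leq_trans jl lm)) /=.
rewrite (big_cat_nat jl lm) /=.
by rewrite addrCA lerDl addr_ge0 // sumr_ge0.
Qed.

(** Windows on which [y] is small in mean square.  They are followed along a filter,
    so that the same statements serve for subsequences, for ultrafilters and for all
    late windows.  Since [y] moves slowly, it is then small at each time in the first
    half of the window. *)
Section SmallWindow.
Variable F : set_system nat.
Hypothesis FF : ProperFilter F.
Hypothesis ooF : \oo `<=` F.
Hypothesis small2 : forall r, 0 < r ->
  \forall k \near F, \sum_(k <= i < wend 1 k) eta i * `|y i| ^+ 2 <= r.

Let near_oo (P : nat -> Prop) (j : nat -> nat) :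
  (\forall k \near F, (k <= j k)%N) -> (\forall k \near \oo, P k) -> \forall k \near F, P (j k).
Proof.
move=> jk [N _ hN].
have NF : F (fun k => (N <= k)%N) by apply: ooF; exists N.
apply: (@filterS _ F _ _ _ _ (filterI jk NF)) => k [kj Nk].
by apply: hN; apply: leq_trans kj.
Qed.

Let small1 r : 0 < r -> \forall k \near F, \sum_(k <= i < wend 1 k) eta i * `|y i| <= r.
Proof.
move=> r0; have r2 : 0 < r / 2 by rewrite divr_gt0.
have := small2 (mulr_gt0 r2 r2); apply: filterS => k hk.
apply: (@le_trans _ _ (\sum_(k <= i < wend 1 k) (r / 2 * eta i + (r / 2)^-1 * (eta i * `|y i| ^+ 2)))).
  apply: ler_sum => i _.
  have -> : r / 2 * eta i + (r / 2)^-1 * (eta i * `|y i| ^+ 2) =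
    eta i * (r / 2 + (r / 2)^-1 * `|y i| ^+ 2) by ring.
  rewrite ler_pM2l //.
  have [h|h] := leP `|y i| (r / 2).
    by rewrite (le_trans h) // lerDl mulr_ge0 ?sqr_ge0 // invr_ge0 ltW.
  apply: (@le_trans _ _ ((r / 2)^-1 * `|y i| ^+ 2)); last by rewrite lerDr ltW.
  by rewrite ler_pdivlMl // expr2 ler_pM // ltW.
rewrite big_split /= -!mulr_sumr clock_sum ?window_end_ge //.
rewrite [leRHS]splitr; apply: lerD.
  by rewrite ler_piMr // ?window_length_le // ltW.
by rewrite ler_pdivrMl.
Qed.

Let small_y (j : nat -> nat) r : 0 < r -> (\forall k \near F, (k <= j k)%N) ->
  (\forall k \near F, s (j k) - s k <= 1 / 2) -> \forall k \near F, `|y (j k)| <= r.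
Proof.
move=> r0 jk jw.
pose delta := Num.min (1 / 2) (r / (2 * (C + 1))).
have C1 : 0 < 2 * (C + 1) by rewrite mulr_gt0 // ltr_wpDl.
have d0 : 0 < delta by rewrite lt_min !divr_gt0.
have Cd : C * delta <= r / 2.
  apply: (@le_trans _ _ ((C + 1) * (r / (2 * (C + 1))))).
    apply: ler_pM => //; rewrite ?lerDl //; first exact: ltW.
    by rewrite ge_min lexx orbT.
  rewrite le_eqVlt; apply/orP; left; apply/eqP; field.
  by rewrite gt_eqF // ltr_wpDl.
have rd : 0 < r * delta / 4 by rewrite divr_gt0 // mulr_gt0.
have wl := near_oo jk (window_length_ge eta_gt0 eta_div eta_cvg d0).
apply: (@filterS _ F _ _ _ _ (filterI jk (filterI jw (filterI (small1 rd) wl)))).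
move=> k [kj [jk1 [hk wk]]].
set l := wend delta (j k) in wk.
have jl : (j k <= l)%N by apply: window_end_ge; exact: ltW.
have lk : (l <= wend 1 k)%N.
  apply: window_end_le.
  have : delta <= 1 / 2 by rewrite ge_min lexx.
  move: jk1; set u := s (j k); set v := s k; lra.
have L0 : 0 < s l - s (j k) by apply: lt_le_trans wk; rewrite divr_gt0.
have Ld : s l - s (j k) <= delta by apply: window_length_le; exact: ltW.
have h1 : `|y (j k)| * (s l - s (j k)) <= r * delta / 4 + C * delta * (s l - s (j k)).
  rewrite -(clock_sum eta jl) !mulr_sumr.
  apply: (@le_trans _ _ (\sum_(j k <= i < l) (eta i * `|y i| + C * delta * eta i))).
    rewrite !big_nat; apply: ler_sum => i /andP[ji il].
    have -> : eta i * `|y i| + C * delta * eta i = eta i * (`|y i| + C * delta) by ring.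
    rewrite mulrC ler_pM2l //.
    have -> : y (j k) = y i - (y i - y (j k)) by rewrite opprB addrC subrK.
    rewrite (le_trans (ler_normB _ _)) // lerD2l.
    rewrite (le_trans (q_dist eta_gt0 y_lip _ _)) // ler_wpM2l //.
    rewrite ger0_norm ?subr_ge0 ?clock_le //; apply: le_trans Ld.
    by rewrite lerD2r clock_le // ltnW.
  rewrite big_split /= lerD //; apply: le_trans hk.
  by apply: sum_mono => // i; rewrite mulr_ge0 // ltW.
rewrite -(ler_pM2r L0); apply: (le_trans h1).
have -> : r * (s l - s (j k)) = r / 2 * (s l - s (j k)) + r / 2 * (s l - s (j k)).
  by rewrite -mulrDl -splitr.
rewrite lerD //; last by rewrite ler_pM2r.
rewrite (_ : r * delta / 4 = r / 2 * (delta / 2)); last by field.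
by rewrite ler_pM2l // divr_gt0.
Qed.

Lemma window_start_small r : 0 < r -> \forall k \near F, `|y k| <= r.
Proof.
move=> r0; apply: (@small_y id) => //; apply: (@filterE _ F) => k //.
by rewrite subrr divr_ge0.
Qed.

Variable xs : 'rV[R]_n.
Hypothesis x_cvg : x @ F --> xs.

(** Averaged over half a window, [d + sigma * x] is small because it drives [y], which
    is small at both ends.  By semicontinuity and convexity the average of [d] is
    almost a value of the field at the limit point. *)
Lemma window_limit_stationary : D xs (- sigma *: xs).
Proof.
suff approx r : 0 < r -> exists2 a, D xs a & `|a + sigma *: xs| <= r.
  apply: (@closed_values xs) => V /nbhs_ballP [r /= r0 rV].
  have [a Da ha] := approx (r / 2) (divr_gt0 r0 (ltr0Sn _ _)).
  exists a; split => //; apply: rV; rewrite -ball_normE /= scaleNr -opprD normrN addrC.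
  by apply: (le_lt_trans ha); rewrite ltr_pdivrMr // ltr_pMr // ltr1n.
move=> r0.
have Ct0 : 0 <= Ct.
  by have := le_trans (ltW (theta_gt0 0)) (theta_le 0); rewrite pmulr_lge0.
have [Bx hBx] := D_loc xs.
have r4 : 0 < r / 4 by rewrite divr_gt0.
have := upper_semicontinuous closedD hBx r4 => /nbhs_ballP [rho /= rho0 husc].
pose Q := 2 + Ct + sigma * (Cp + 1).
have Q0 : 0 < Q by rewrite ltr_wpDr ?mulr_ge0 ?addr_ge0 // ltr_wpDr.
have sig1 : 0 < 8 * (sigma + 1) by rewrite mulr_gt0 // ltr_wpDl.
have Cp1 : 0 < Cp + 1 by rewrite ltr_wpDl.
pose rho1 := Num.min rho (r / (8 * (sigma + 1))) / 4.
have rho10 : 0 < rho1 by rewrite divr_gt0 // lt_min rho0 divr_gt0.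
pose e1 := Num.min (r * ct / (8 * Q)) (rho1 / (Cp + 1)).
have e10 : 0 < e1.
  by rewrite lt_min; apply/andP; split; rewrite divr_gt0 // ?mulr_gt0.
have r8 : 0 < r / 8 by rewrite divr_gt0.
have near_all (P : nat -> Prop) : (\forall k \near \oo, P k) ->
    \forall k \near F, forall i, (k <= i)%N -> P i.
  move=> [N _ hN]; apply: ooF; exists N => // k Nk i ki.
  by apply: hN; apply: leq_trans ki.
have half0 : 0 < (1 / 2 : R) by rewrite divr_gt0.
pose J k := wend (1 / 2) k.
have kJ k : (k <= J k)%N by apply: window_end_ge; exact: ltW.
have JW k : (J k <= wend 1 k)%N by apply: window_end_le; lra.
have hyJ : \forall k \near F, `|y (J k)| <= e1.
  apply: small_y => //; first exact: (@filterE _ F).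
  by apply: (@filterE _ F) => k; apply: window_length_le; exact: ltW.
have hJ := near_all _ (window_length_ge eta_gt0 eta_div eta_cvg half0).
have hx : \forall k \near F, `|x k - xs| <= rho1.
  move/cvgrPdist_le : x_cvg => /(_ rho1 rho10); apply: filterS => k.
  by rewrite distrC.
have [k [yk [yJ [Sk [Jk [zk [dk [pk [tk xk]]]]]]]]] := filter_ex
  (filterI (window_start_small e10) (filterI hyJ (filterI (small1 e10) (filterI hJ
  (filterI (near_all _ (zx rho10)) (filterI (near_all _ (ed r8))
  (filterI (near_all _ (p_le e10)) (filterI (near_all _ theta_ge) hx)))))))).
have {}Jk : 1 / 2 / 2 <= s (J k) - s k by apply: Jk.
have sub (u : nat -> R) i : (forall l, 0 <= u l) -> (k <= i <= J k)%N ->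
    \sum_(k <= l < i) u l <= \sum_(k <= l < wend 1 k) u l.
  by move=> u0 /andP[_ iJ]; apply: sum_mono => //; apply: leq_trans iJ (JW k).
have len i : (k <= i <= J k)%N -> \sum_(k <= l < i) eta l <= 1.
  move=> ki; apply: (le_trans (sub eta i _ ki)) => [l|]; first exact: ltW.
  by rewrite clock_sum ?window_end_ge // window_length_le.
have sump i : (k <= i <= J k)%N -> \sum_(k <= l < i) eta l * `|p l| <= (Cp + 1) * e1.
  move=> ki; apply: (@le_trans _ _ (\sum_(k <= l < i) (Cp * (eta l * `|y l|) + e1 * eta l))).
    rewrite !big_nat; apply: ler_sum => l /andP[kl _].
    have -> : Cp * (eta l * `|y l|) + e1 * eta l = eta l * (Cp * `|y l| + e1) by ring.
    by rewrite ler_pM2l // pk.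
  rewrite big_split /= -!mulr_sumr mulrDl mul1r lerD //.
    rewrite ler_wpM2l // (le_trans _ Sk) // sub // => l.
    by rewrite mulr_ge0 // ltW.
  by rewrite ler_piMr ?len // ltW.
have e1rho : (Cp + 1) * e1 <= rho1.
  by rewrite mulrC -ler_pdivlMr // ge_min lexx orbT.
have xdist i : (k <= i <= J k)%N -> `|x i - x k| <= rho1.
  move=> ki; apply: le_trans e1rho; apply: le_trans (sump i ki).
  case/andP: ki => ki _; rewrite -(telescope_sumr x ki).
  apply: (le_trans (ler_norm_sum _ _ _)); apply: ler_sum => l _.
  by rewrite xS addrAC subrr add0r normrN normrZ gtr0_norm.
have xsdist i : (k <= i <= J k)%N -> `|x i - xs| <= rho1 + rho1.
  move=> ki; rewrite -(subrK (x k) (x i)) -addrA (le_trans (ler_normD _ _)) //.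
  by rewrite lerD // xdist.
have [a ha] : {a : nat -> 'rV[R]_n & forall i, (k <= i < J k)%N ->
    D xs (a i) /\ `|e i - a i| < r / 4}.
  apply: (@boolp.choice nat 'rV[R]_n (fun i a => (k <= i < J k)%N ->
    D xs a /\ `|e i - a| < r / 4)) => i.
  have [/andP[ki iJ]|nk] := boolP (k <= i < J k)%N; last by exists 0.
  have [|b Db hb] := husc (z i) _ _ (De i); last by exists b.
  rewrite -ball_normE /= distrC -(subrK (x i) (z i)) -addrA.
  have kiJ : (k <= i <= J k)%N by rewrite ki ltnW.
  apply: (le_lt_trans (ler_normD _ _)).
  apply: (@le_lt_trans _ _ (rho1 + (rho1 + rho1))); first by rewrite lerD ?zk ?xsdist.
  have h : rho1 * 4 <= rho by rewrite /rho1 divfK // ge_min lexx.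
  lra.
have kJ' : (k < J k)%N.
  rewrite ltn_neqAle kJ andbT; apply/eqP => kw.
  by move: Jk; rewrite -kw subrr leNgt !divr_gt0.
pose Th := \sum_(k <= i < J k) theta i.
have Th0 : ct / 4 <= Th.
  apply: (@le_trans _ _ (\sum_(k <= i < J k) ct * eta i)).
    rewrite -mulr_sumr clock_sum // ler_pM2l //.
    by apply: le_trans Jk; lra.
  by rewrite /Th !big_nat; apply: ler_sum => i /andP[ki _]; apply: tk.
have Thp : 0 < Th by apply: lt_le_trans Th0; rewrite divr_gt0.
exists (Th^-1 *: \sum_(k <= i < J k) theta i *: a i).
  by apply: convex_average => // i hi; case: (ha i hi).
(* Summing the recursion of [y] over the half window. *)
have id1 : \sum_(k <= i < J k) theta i *: (d i + sigma *: x i) =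
   y (J k) - y k + \sum_(k <= i < J k) (theta i *: y i + (sigma * eta i) *: p i).
  rewrite -(telescope_sumr y (kJ k)) -big_split /=; apply: eq_bigr => i _.
  by rewrite yS; apply/rowP => j; rewrite !mxE; ring.
have id2 : Th *: (Th^-1 *: (\sum_(k <= i < J k) theta i *: a i) + sigma *: xs) =
   \sum_(k <= i < J k) theta i *: (d i + sigma *: x i) +
   \sum_(k <= i < J k) theta i *: ((a i - e i) + (e i - d i) + sigma *: (xs - x i)).
  rewrite [LHS]scalerDr [Th *: (Th^-1 *: _)]scalerA divff ?gt_eqF // scale1r /Th scaler_suml -!big_split /=.
  by apply: eq_bigr => i _; apply/rowP => j; rewrite !mxE; ring.
have b1 : `|\sum_(k <= i < J k) theta i *: (d i + sigma *: x i)| <= Q * e1.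
  rewrite id1 (le_trans (ler_normD _ _)) //.
  have -> : Q * e1 = (e1 + e1) + (Ct * e1 + sigma * ((Cp + 1) * e1)) by rewrite /Q; ring.
  apply: lerD; first by rewrite (le_trans (ler_normB _ _)) // lerD.
  apply: (le_trans (ler_norm_sum _ _ _)).
  apply: (@le_trans _ _ (\sum_(k <= i < J k) (Ct * (eta i * `|y i|) + sigma * (eta i * `|p i|)))).
    apply: ler_sum => i _; rewrite (le_trans (ler_normD _ _)) // 2!normrZ.
    have se : `|sigma * eta i| = sigma * eta i.
      by rewrite ger0_norm // mulr_ge0 // ltW.
    rewrite (gtr0_norm (theta_gt0 i)) se !mulrA lerD2r.
    by rewrite ler_wpM2r.
  rewrite big_split /= -!mulr_sumr lerD // ler_wpM2l //; last first.
    by apply: sump; rewrite kJ leqnn.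
  apply: le_trans Sk; apply: sub; last by rewrite kJ leqnn.
  by move=> l; rewrite mulr_ge0 // ltW.
have b2 : `|\sum_(k <= i < J k) theta i *: ((a i - e i) + (e i - d i) + sigma *: (xs - x i))|
    <= Th * (r / 2).
  rewrite /Th mulr_suml (le_trans (ler_norm_sum _ _ _)) // !big_nat.
  apply: ler_sum => i hi; have [ki iJ] := andP hi.
  rewrite normrZ gtr0_norm // ler_pM2l //.
  have kiJ : (k <= i <= J k)%N by rewrite ki ltnW.
  have h1 : `|a i - e i| <= r / 4 by rewrite distrC ltW //; case: (ha i hi).
  have h2 : `|e i - d i| <= r / 8 by rewrite distrC dk.
  have h3 : `|sigma *: (xs - x i)| <= r / 8.
    rewrite normrZ ger0_norm // distrC.
    apply: (@le_trans _ _ ((sigma + 1) * (rho1 + rho1))).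
      by rewrite ler_pM // ?xsdist // lerDl.
    have : rho1 * 4 <= r / (8 * (sigma + 1)) by rewrite /rho1 divfK // ge_min lexx orbT.
    rewrite ler_pdivlMr // => h; have : 0 < rho1 * (sigma + 1) by rewrite mulr_gt0 // ltr_wpDl.
    nra.
  rewrite (le_trans (ler_normD _ _)) //.
  apply: (@le_trans _ _ (r / 4 + r / 8 + r / 8)); last by lra.
  by rewrite lerD // (le_trans (ler_normD _ _)) // lerD.
rewrite -(ler_pM2l Thp) -{1}(gtr0_norm Thp) -normrZ id2.
rewrite (le_trans (ler_normD _ _)) //.
apply: (@le_trans _ _ (Th * (r / 2) + Th * (r / 2))); last by rewrite -mulrDr -splitr.
rewrite lerD // (le_trans b1) //.
apply: (@le_trans _ _ (ct / 4 * (r / 2))); last by rewrite ler_wpM2r // ltW // divr_gt0.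
have : e1 <= r * ct / (8 * Q) by rewrite ge_min lexx.
rewrite ler_pdivlMr ?mulr_gt0 // => h; lra.
Qed.

End SmallWindow.

Variable Bx : R.
Hypothesis x_le : forall k, `|x k| <= Bx.
Hypothesis sard : [set g v | v in [set v | D v (- sigma *: v)]]° = set0.

Let energy_ge0 k K : 0 <= c * \sum_(k <= i < K) eta i * `|y i| ^+ 2.
Proof.
apply: mulr_ge0; first exact: ltW.
by apply: sumr_ge0 => i _; rewrite mulr_ge0 ?sqr_ge0 // ltW.
Qed.

Let within_proper (A : set nat) : (forall N, exists2 k, (N <= k)%N & A k) ->
  ProperFilter (within A \oo).
Proof.
move=> hA; apply: Build_ProperFilter; rewrite /within /= => -[N _ hN].
by have [k Nk Ak] := hA N; exact: hN Nk Ak.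
Qed.

Let within_oo (A : set nat) : \oo `<=` within A \oo.
Proof. by move=> V hV; apply: (@filterS _ \oo _ _ _ _ hV) => k Vk _. Qed.

Let within_self (A : set nat) : within A \oo A.
Proof. exact: (@filterE _ \oo). Qed.

Let freq (U : set_system nat) l r N : ProperFilter U -> \oo `<=` U -> Phi @ U --> l ->
  0 < r -> exists2 k, (N <= k)%N & `|Phi k - l| <= r.
Proof.
move=> PU ooU /cvgrPdist_le Ul r0.
have UN : U (fun k => (N <= k)%N) by apply: ooU; exists N.
have [k [h1 h2]] := filter_ex (filterI UN (Ul r r0)).
by exists k => //; rewrite distrC.
Qed.

(** Two limit values of [Phi] would enclose a noncritical level, by the Sard-type
    hypothesis.  From the last times [Phi] is below that level before climbing
    well above it, [Phi] stays above the level for a whole window: so [y] is small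
    there and the limit points of [x] are critical, with value that level. *)
Let no_oscillation (U0 U1 : set_system nat) a b :
  ProperFilter U0 -> ProperFilter U1 -> \oo `<=` U0 -> \oo `<=` U1 ->
  Phi @ U0 --> a -> Phi @ U1 --> b -> b <= a.
Proof.
move=> PU0 PU1 oo0 oo1 Ua Ub; rewrite leNgt; apply/negP => ab.
have [lv lvab nlv] : exists2 lv, a < lv < b & forall v, D v (- sigma *: v) -> g v <> lv.
  apply: contrapT => h.
  have : [set g v | v in [set v | D v (- sigma *: v)]]° ((a + b) / 2).
    have mab : (a + b) / 2 \in `]a, b[ by rewrite in_itv /=; apply/andP; split; lra.
    apply: filterS (near_in_itvoo mab) => t; rewrite /= in_itv /= => tab.
    apply: contrapT => ht; apply: h; exists t => // v Dv gv; apply: ht.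
    by exists v.
  by rewrite sard.
have /andP[alv lvb] := lvab.
pose top := (lv + b) / 2.
have lvtop : lv < top by rewrite /top; lra.
(* The last times below the level [lv] before a climb above [top]. *)
pose A := [set k | Phi k <= lv /\ exists l, [/\ (k < l)%N, top < Phi l &
  forall i, (k < i <= l)%N -> lv < Phi i]].
have Ainf N : exists2 k, (N <= k)%N & A k.
  have [k0 Nk0 hk0] : exists2 k, (N <= k)%N & Phi k <= lv.
    have r0 : 0 < lv - a by rewrite subr_gt0.
    have [k Nk hk] := freq N PU0 oo0 Ua r0; exists k => //.
    by move: hk; rewrite ler_norml => /andP[_]; lra.
  have [l kl hl] : exists2 l, (k0 <= l)%N & top < Phi l.
    have r0 : 0 < (b - lv) / 4 by lra.
    have [l kl hl] := freq k0 PU1 oo1 Ub r0; exists l => //.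
    by move: hl; rewrite ler_norml /top => /andP[+ _]; lra.
  have ex : exists k, (k <= l)%N && (Phi k <= lv) by exists k0; rewrite kl.
  have ub : forall k, (k <= l)%N && (Phi k <= lv) -> (k <= l)%N by move=> k /andP[].
  case: (ex_maxnP ex ub) => k /andP[kl' hk] kmax.
  exists k; first by apply: leq_trans Nk0 (kmax _ _); rewrite kl.
  split => //; exists l; split => //.
    rewrite ltn_neqAle kl' andbT; apply/eqP => kE.
    by move: hl; rewrite -kE ltNge (le_trans hk) // ltW.
  move=> i /andP[ki il]; rewrite ltNge; apply/negP => hi.
  by have := kmax i; rewrite il hi leqNgt ki => /(_ isT).
have [top_at htop] : {top_at : nat -> nat & forall k, A k ->
    [/\ (k < top_at k)%N, top < Phi (top_at k) & forall i, (k < i <= top_at k)%N -> lv < Phi i]}.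
  apply: (@boolp.choice nat nat (fun k l => A k -> [/\ (k < l)%N, top < Phi l &
     forall i, (k < i <= l)%N -> lv < Phi i])) => k.
  by have [[_ [l hl]]|nA] := pselect (A k); [exists l|exists 0%N].
pose FA := within A \oo.
have PFA : ProperFilter FA by exact: within_proper.
have small2 r : 0 < r -> \forall k \near FA, \sum_(k <= i < wend 1 k) eta i * `|y i| ^+ 2 <= r.
  move=> r0; pose r' := Num.min (c * r) ((top - lv) / 2).
  have r'0 : 0 < r' by rewrite lt_min mulr_gt0 //= divr_gt0 // subr_gt0.
  (* Stopping the window at [top_at k] would exhibit a climb that the descent
     forbids, so the whole window stays above the level. *)
  pose K k := if `[< A k >] then minn (wend 1 k) (top_at k) else k.
  have K_le k : (K k <= wend 1 k)%N.
    by rewrite /K; case: ifP => _; [exact: geq_minl|exact: window_end_ge].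
  have K_ge k : (k <= K k)%N.
    rewrite /K; case: ifP => // /asboolP Ak; rewrite leq_min window_end_ge //=.
    by have [/ltnW] := htop _ Ak.
  have := descent K_ge _ r'0 => /(_ _) [k|].
    apply: le_trans (window_length_le eta_gt0 eta_div k ler01).
    by rewrite lerD2r clock_le.
  move=> N _ hN.
  have [N1 _ hN1] := window_end_gt eta_gt0 eta_div eta_cvg ltr01.
  exists (maxn N N1) => // k /=; rewrite geq_max => /andP[Nk N1k] Ak.
  have /= := hN _ Nk; have /= kw := hN1 _ N1k.
  have [h1 h2 h3] := htop k Ak; have [Plv _] := Ak.
  rewrite /K asboolT //; have [lw|wl] := ltnP (top_at k) (wend 1 k).
    move=> h; exfalso.
    have : r' <= (top - lv) / 2 by rewrite ge_min lexx orbT.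
    have : 0 <= c * \sum_(k <= i < top_at k) eta i * `|y i| ^+ 2.
      exact: energy_ge0.
    move: h h2 lvtop Plv; lra.
  move=> h.
  have hw := h3 (wend 1 k); rewrite kw wl in hw.
  have hr : r' <= c * r by rewrite ge_min lexx.
  rewrite -(ler_pM2l c_gt0); move: h (hw isT) hr Plv; lra.
have [U [UU FU]] := ultraFilterLemma PFA.
have ooU : \oo `<=` U by move=> V hV; apply: FU; exact: within_oo.
have [xs _ Uxs] := ultra_compact_cvg (u := x) UU (@compact_normball R n Bx) x_le.
have small2U r : 0 < r -> \forall k \near U, \sum_(k <= i < wend 1 k) eta i * `|y i| ^+ 2 <= r.
  by move=> r0; apply: FU; exact: small2.
have PU : ProperFilter U by exact: ultra_proper.
apply: (nlv _ (window_limit_stationary PU ooU small2U Uxs)).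
suff close r : 0 < r -> `|g xs - lv| <= (2 + Cg) * r.
  apply/eqP; rewrite -subr_eq0 -normr_eq0 eq_le normr_ge0 andbT.
  apply/ler_addgt0Pr => r r0; rewrite add0r.
  have C2 : 0 < 2 + Cg by rewrite ltr_wpDr.
  by have := close (r / (2 + Cg)) (divr_gt0 r0 C2); rewrite mulrCA divff ?gt_eqF // mulr1.
move=> r0.
have yr := window_start_small PU ooU small2U r0.
have gr : \forall k \near U, `|g xs - g (x k)| <= r.
  have h : g (x k) @[k --> U] --> g xs by apply: continuous_cvg; [exact: g_cont|exact: Uxs].
  by move/cvgrPdist_le : h => /(_ _ r0).
(* A window of one step: just after its last passage below the level, [Phi] is
   above it, so that it was close to it before. *)
pose K k := if s k.+1 - s k <= 1 then k.+1 else k.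
have Pr : \forall k \near U, lv - r <= Phi k <= lv.
  have := descent (K := K) _ _ r0 => /(_ _ _) [k|k|].
  - by rewrite /K; case: ifP.
  - by rewrite /K; case: ifP => // _; rewrite subrr.
  move=> N _ hN; have /cvgrPdist_le /(_ _ ltr01) [N1 _ hN1] := eta_cvg.
  apply: FU; exists (maxn N N1) => // k /=; rewrite geq_max => /andP[Nk N1k] Ak.
  have /= := hN _ Nk; have [h1 _ h3] := htop k Ak; have [Plv _] := Ak.
  have /= := hN1 _ N1k; rewrite sub0r normrN gtr0_norm // => etak.
  have -> : K k = k.+1 by rewrite /K clockS addrAC subrr add0r etak.
  have : 0 <= c * \sum_(k <= i < k.+1) eta i * `|y i| ^+ 2.
    exact: energy_ge0.
  have := h3 k.+1; rewrite ltnSn h1 => /(_ isT) h4 h5 h6.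
  by rewrite Plv andbT; move: h4 h5 h6; lra.
have [k [yk [gk Pk]]] := filter_ex (filterI yr (filterI gr Pr)).
have -> : g xs - lv = (g xs - g (x k)) - (Phi k - g (x k)) + (Phi k - lv) by ring.
have Pk' : `|Phi k - lv| <= r.
  by move: Pk; rewrite ler_norml => /andP[]; lra.
have -> : (2 + Cg) * r = r + Cg * r + r by ring.
rewrite (le_trans (ler_normD _ _)) // lerD // (le_trans (ler_normB _ _)) // lerD //.
by apply: (le_trans (Phi_g k)); rewrite ler_wpM2l.
Qed.

(** All ultrafilters give the same limit, since any two limits are ordered both
    ways. *)
Lemma descent_cvg : cvgn Phi.
Proof.
have PhiB k : `[- B, B]%classic (Phi k) by rewrite /= in_itv /= -ler_norml.
have [U0 [UU0 oo0]] := ultraFilterLemma (@eventually_filter).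
have [a _ Ua] := ultra_compact_cvg UU0 (@segment_compact R (- B) B) PhiB.
apply/cvg_ex; exists a; apply: contrapT => na.
have [r r0 hr] : exists2 r, 0 < r & ~ \forall k \near \oo, `|a - Phi k| <= r.
  apply: contrapT => h; apply: na; apply/cvgrPdist_le => r r0.
  by apply: contrapT => hr; apply: h; exists r.
pose A := [set k | r < `|a - Phi k|].
have PA : ProperFilter (within A \oo).
  apply: within_proper => N; apply: contrapT => h; apply: hr.
  exists N => // k Nk /=; rewrite leNgt; apply/negP => hk; apply: h; by exists k.
have [U1 [UU1 F1]] := ultraFilterLemma PA.
have oo1 : \oo `<=` U1 by move=> V hV; apply: F1; exact: within_oo.
have [b _ Ub] := ultra_compact_cvg UU1 (@segment_compact R (- B) B) PhiB.
have ab : a = b.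
  have P0 : ProperFilter U0 by exact: ultra_proper.
  have P1 : ProperFilter U1 by exact: ultra_proper.
  apply/eqP; rewrite eq_le (no_oscillation P1 P0 oo1 oo0 Ub Ua).
  by rewrite (no_oscillation P0 P1 oo0 oo1 Ua Ub).
have : \forall k \near U1, `|b - Phi k| <= r by move/cvgrPdist_le : Ub => /(_ _ r0).
have UA : U1 A by apply: F1; exact: within_self.
move=> h; have P1 : ProperFilter U1 by exact: ultra_proper.
have [k [Ak hk]] := filter_ex (filterI UA h).
by move: Ak; rewrite /A /= ab ltNge hk.
Qed.

Let small2_oo r : 0 < r -> \forall k \near \oo, \sum_(k <= i < wend 1 k) eta i * `|y i| ^+ 2 <= r.
Proof.
move=> r0; have r'0 : 0 < c * r / 3 by rewrite divr_gt0 // mulr_gt0.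
have /cvg_ex [L /cvgrPdist_le /(_ _ r'0) [N _ hN]] := descent_cvg.
have := descent (K := wend 1) _ _ r'0 => /(_ _ _) [k|k|].
- exact: window_end_ge.
- exact: window_length_le.
move=> N1 _ hN1; exists (maxn N N1) => // k /=; rewrite geq_max => /andP[Nk N1k].
have /= h1 := hN1 _ N1k.
have /= := hN _ Nk; rewrite ler_norml => /andP[h2 h3].
have /= := hN _ (leq_trans Nk (window_end_ge eta_gt0 eta_div k ler01)).
rewrite ler_norml => /andP[h4 h5].
by rewrite -(ler_pM2l c_gt0); move: h1 h2 h3 h4 h5; lra.
Qed.

Lemma descent_y_cvg0 : y @ \oo --> (0 : 'rV[R]_n).
Proof.
apply/cvgrPdist_le => r r0.
have := window_start_small (@eventually_filter) (fun A hA => hA) small2_oo r0.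
by apply: filterS => k; rewrite sub0r normrN.
Qed.

Lemma descent_value_cvg : cvgn (fun k => g (x k)).
Proof.
have /cvg_ex [L PL] := descent_cvg; apply/cvg_ex; exists L.
apply/cvgrPdist_le => r r0; have r2 : 0 < r / 2 by rewrite divr_gt0.
have C1 : 0 < Cg + 1 by rewrite ltr_wpDl.
have ry : 0 < r / 2 / (Cg + 1) by rewrite divr_gt0.
move/cvgrPdist_le : PL => /(_ _ r2); move/cvgrPdist_le : descent_y_cvg0 => /(_ _ ry).
apply: filterS2 => k; rewrite sub0r normrN => yk Pk.
have -> : L - g (x k) = (L - Phi k) + (Phi k - g (x k)) by rewrite addrA subrK.
rewrite (le_trans (ler_normD _ _)) // [leRHS]splitr lerD // (le_trans (Phi_g k)) //.
apply: (@le_trans _ _ ((Cg + 1) * `|y k|)); first by rewrite ler_wpM2r // lerDl.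
by rewrite -ler_pdivlMl // mulrC.
Qed.

Lemma descent_cluster_stationary xs : cluster (x @ \oo) xs -> D xs (- sigma *: xs).
Proof.
move=> clx.
(* The filter of the indices that are late and whose iterate is close to [xs]. *)
pose F := [set A : set nat | exists V N, nbhs xs V /\ forall k, (N <= k)%N -> V (x k) -> A k].
have FF : ProperFilter F.
  apply: Build_ProperFilter_ex.
    move=> A [V [N [xV VA]]].
    have [_ [[k Nk <-] Vk]] : (x @` [set k | (N <= k)%N]) `&` V !=set0.
      by apply: clx xV; exists N => // k Nk; exists k.
    by exists k; apply: VA.
  split.
  - by exists setT, 0%N; split => //; exact: filterT.
  - move=> A1 A2 [V1 [N1 [x1 h1]]] [V2 [N2 [x2 h2]]].
    exists (V1 `&` V2), (maxn N1 N2); split; first exact: filterI.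
    by move=> k; rewrite geq_max => /andP[k1 k2] [v1 v2]; split; [apply: h1|apply: h2].
  - move=> A1 A2 A12 [V [N [xV VA]]]; exists V, N; split => // k Nk Vk.
    by apply: A12; apply: VA.
have ooF : \oo `<=` F.
  move=> A [N _ hN]; exists setT, N; split; first exact: filterT.
  by move=> k Nk _; apply: hN.
apply: (window_limit_stationary FF ooF) => [r r0|].
  by apply: ooF; exact: small2_oo.
by move=> V xV; exists V, 0%N; split.
Qed.

Theorem descent_limits :
  [/\ forall xs, cluster (x @ \oo) xs -> D xs (- sigma *: xs),
      y @ \oo --> (0 : 'rV[R]_n) & cvgn (fun k => g (x k))].
Proof.
split; [exact: descent_cluster_stationary|exact: descent_y_cvg0|exact: descent_value_cvg].
Qed.

End Descent.

(** * Descent of the energy in one coordinate *)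

Section NullSequences.
Context {R : realType}.
Implicit Types u v : nat -> R.

Definition bounded_seq u := exists M, forall k, `|u k| <= M.
Definition null_seq u := u @ \oo --> (0 : R).

Lemma bounded_seqD u v : bounded_seq u -> bounded_seq v -> bounded_seq (fun k => u k + v k).
Proof.
by move=> [M hM] [N hN]; exists (M + N) => k; rewrite (le_trans (ler_normD _ _)) // lerD.
Qed.

Lemma bounded_seqN u : bounded_seq u -> bounded_seq (fun k => - u k).
Proof. by move=> [M hM]; exists M => k; rewrite normrN. Qed.

Lemma bounded_seqM u v : bounded_seq u -> bounded_seq v -> bounded_seq (fun k => u k * v k).
Proof. by move=> [M hM] [N hN]; exists (M * N) => k; rewrite normrM ler_pM. Qed.

Lemma bounded_cst (c : R) : bounded_seq (fun=> c).
Proof. by exists `|c|. Qed.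

Lemma bounded_shift u : bounded_seq u -> bounded_seq (fun k => u k.+1).
Proof. by move=> [M hM]; exists M. Qed.

Lemma null_seqP u : null_seq u <-> forall e, 0 < e -> \forall k \near \oo, `|u k| <= e.
Proof.
split=> [/cvgrPdist_le h e /h|h]; first by apply: filterS => k; rewrite sub0r normrN.
by apply/cvgrPdist_le => e /h; apply: filterS => k; rewrite sub0r normrN.
Qed.

Lemma null_seqD u v : null_seq u -> null_seq v -> null_seq (fun k => u k + v k).
Proof. by move=> hu hv; rewrite /null_seq -[X in _ --> X]addr0; exact: cvgD. Qed.

Lemma null_seqN u : null_seq u -> null_seq (fun k => - u k).
Proof. by move=> hu; rewrite /null_seq -[X in _ --> X]oppr0; exact: cvgN. Qed.

Lemma null_seqM u v : bounded_seq u -> null_seq v -> null_seq (fun k => u k * v k).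
Proof.
move=> [M hM] /null_seqP hv; apply/null_seqP => e e0.
have M0 : 0 <= M := le_trans (normr_ge0 _) (hM 0%N).
have M1 : 0 < M + 1 by rewrite ltr_wpDl.
have := hv _ (divr_gt0 e0 M1); apply: filterS => k hk.
rewrite normrM; apply: (@le_trans _ _ ((M + 1) * `|v k|)).
  by rewrite ler_wpM2r // (le_trans (hM k)) // lerDl.
by rewrite -ler_pdivlMl // mulrC.
Qed.

Lemma null_shift u : null_seq u -> null_seq (fun k => u k.+1).
Proof.
move=> /null_seqP h; apply/null_seqP => e /h [N _ hN].
by exists N => // k Nk; apply: hN; exact: leqW.
Qed.

Lemma null_bounded u : null_seq u -> bounded_seq u.
Proof.
move=> /null_seqP /(_ 1 ltr01) [N _ hN].
exists (1 + \sum_(i < N) `|u i|) => k; have [Nk|kN] := leqP N k.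
  by rewrite (le_trans (hN k Nk)) // lerDl sumr_ge0.
by rewrite (bigD1 (Ordinal kN)) //= addrCA lerDl addr_ge0 // sumr_ge0.
Qed.

Lemma null_sum (I : finType) (u : I -> nat -> R) :
  (forall i, null_seq (u i)) -> null_seq (fun k => \sum_i u i k).
Proof.
move=> hu; elim: (index_enum I) => [|i s ih].
  rewrite (_ : (fun k => _) = fun=> 0); first exact: cvg_cst.
  by apply/funext => k; rewrite big_nil.
rewrite (_ : (fun k => _) = fun k => u i k + \sum_(j <- s) u j k).
  exact: null_seqD.
by apply/funext => k; rewrite big_cons.
Qed.

Lemma bounded_seqX2 u : bounded_seq u -> bounded_seq (fun k => u k ^+ 2).
Proof. by move=> hu; exact: bounded_seqM. Qed.
End NullSequences.

Ltac seq_bounded := repeat (first [ assumption | exact: bounded_cst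
  | (apply: null_bounded; assumption)
  | apply: bounded_seqX2 | apply: bounded_seqD | apply: bounded_seqN | apply: bounded_seqM
  | apply: bounded_shift ]).

Section CoordinateDescent.
Context {R : realType}.
Variables (eta theta x y d mu nf p h : nat -> R) (sigma tau1 tau2 b : R).
Hypothesis eta_gt0 : forall k, 0 < eta k.
Hypothesis eta_cvg : null_seq eta.
Hypothesis tau1_gt0 : 0 < tau1.
Hypothesis sigma_ge0 : 0 <= sigma.
Hypothesis ratio_cvg : (fun k => theta k / eta k) @ \oo --> tau1.
Hypothesis x_bd : bounded_seq x.
Hypothesis mu_bd : bounded_seq mu.
Hypothesis d_bd : bounded_seq d.
Hypothesis h_bd : bounded_seq h.
Hypothesis nf_cvg : null_seq nf.
Hypothesis h_gt0 : forall k, 0 < h k.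
Hypothesis h_diff : null_seq (fun k => h k.+1 - h k).
Hypothesis h_growth : \forall k \near \oo,
  h k.+1 <= h k * (1 + tau2 * eta k * b / 2 + (tau2 * eta k) ^+ 2).
Hypothesis yE : forall k, y k = mu k + sigma * x k.
Hypothesis muS : forall k, mu k.+1 = (1 - theta k) * mu k + theta k * d k.
Hypothesis pE : forall k, p k = h k.+1 * (y k + theta k * (d k - mu k) + nf k.+1).
Hypothesis xS : forall k, x k.+1 = x k - eta k * p k.

Let rho k := theta k / eta k.

Let theta_rho k : theta k = rho k * eta k.
Proof. by rewrite /rho divfK // gt_eqF. Qed.

Let rho_cvg : null_seq (fun k => rho k - tau1).
Proof. by rewrite /null_seq -(subrr tau1); apply: cvgB => //; exact: cvg_cst. Qed.

Let rho_bd : bounded_seq rho.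
Proof.
have -> : rho = fun k => (rho k - tau1) + tau1 by apply/funext => k; rewrite subrK.
by seq_bounded.
Qed.

Let theta_cvg : null_seq theta.
Proof.
rewrite (_ : theta = fun k => rho k * eta k); first exact: null_seqM.
by apply/funext => k; exact: theta_rho.
Qed.

Let y_bd : bounded_seq y.
Proof.
rewrite (_ : y = fun k => mu k + sigma * x k); last by apply/funext.
by seq_bounded.
Qed.

(** What separates the step [p] from its leading part [h * y]. *)
Let pi_ k := (h k.+1 - h k) * y k + h k.+1 * (theta k * (d k - mu k) + nf k.+1).

Let pi_cvg : null_seq pi_.
Proof.
apply: null_seqD.
  rewrite (_ : (fun k => _) = fun k => y k * (h k.+1 - h k)); first exact: null_seqM.
  by apply/funext => k; rewrite mulrC.
apply: null_seqM; first by seq_bounded.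
apply: null_seqD; last exact: null_shift.
rewrite (_ : (fun k => _) = fun k => (d k - mu k) * theta k).
  by apply: null_seqM => //; seq_bounded.
by apply/funext => k; rewrite mulrC.
Qed.

Let p_pi k : p k = h k * y k + pi_ k.
Proof. by rewrite pE /pi_; ring. Qed.

Lemma coordinate_step_bounded : bounded_seq p.
Proof.
rewrite (_ : p = fun k => h k * y k + pi_ k); last by apply/funext.
by seq_bounded.
Qed.

Lemma coordinate_step_close : null_seq (fun k => p k - h k * y k).
Proof.
rewrite (_ : (fun k => _) = pi_) //; apply/funext => k.
by rewrite p_pi addrAC subrr add0r.
Qed.

(** Increments of [y] per unit of clock time. *)
Let Y k := rho k * (d k + sigma * x k - y k) - sigma * p k.

Let yS k : y k.+1 = y k + eta k * Y k.
Proof. by rewrite yE muS xS /Y (theta_rho k) yE; ring. Qed.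

Lemma coordinate_momentum_lip : exists2 C, 0 <= C & forall k, `|y k.+1 - y k| <= C * eta k.
Proof.
have p_bd := coordinate_step_bounded.
have [C hC] : bounded_seq Y by rewrite /Y; seq_bounded.
exists C; first exact: le_trans (hC 0%N).
move=> k; rewrite yS addrAC subrr add0r normrM mulrC (gtr0_norm (eta_gt0 k)).
by rewrite ler_pM2r.
Qed.

(** What the energy balance of one step leaves besides the dissipation: every term
    carries a vanishing factor [rho - tau1], [pi_] or [eta]. *)
Let rem k :=
  h k * y k * ((rho k - tau1) / tau1) * (d k + sigma * x k - y k)
  - sigma / tau1 * (h k * y k) * pi_ k - (d k + sigma * x k) * pi_ k
  + eta k * (h k / (2 * tau1) * (Y k ^+ 2 + tau2 ^+ 2 * y k ^+ 2
       + (tau2 * b / 2 + tau2 ^+ 2 * eta k) * (2 * y k * Y k + eta k * Y k ^+ 2))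
     + sigma / 2 * p k ^+ 2).

Let rem_cvg : null_seq rem.
Proof.
have p_bd := coordinate_step_bounded.
have Y_bd : bounded_seq Y by rewrite /Y; seq_bounded.
apply: null_seqD.
  apply: null_seqD; first apply: null_seqD.
  - rewrite (_ : (fun k => _) =
      fun k => (h k * y k * tau1^-1 * (d k + sigma * x k - y k)) * (rho k - tau1)).
      by apply: null_seqM => //; seq_bounded.
    by apply/funext => k; ring.
  - by apply/null_seqN/null_seqM => //; seq_bounded.
  - by apply/null_seqN/null_seqM => //; seq_bounded.
rewrite (_ : (fun k => _) = fun k => (h k / (2 * tau1) * (Y k ^+ 2 + tau2 ^+ 2 * y k ^+ 2
       + (tau2 * b / 2 + tau2 ^+ 2 * eta k) * (2 * y k * Y k + eta k * Y k ^+ 2))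
     + sigma / 2 * p k ^+ 2) * eta k).
  by apply: null_seqM => //; seq_bounded.
by apply/funext => k; rewrite mulrC.
Qed.

(** The cross terms of the quadratic and of the regularised objective cancel in
    the limit [theta / eta --> tau1]; what is left of the quadratic is a
    dissipation, against which the growth of [h] costs the factor
    [tau2 * b / (4 * tau1)]. *)
Lemma coordinate_descent : exists2 r, null_seq r & \forall k \near \oo,
  (2 * tau1)^-1 * (h k.+1 * y k.+1 ^+ 2 - h k * y k ^+ 2)
   - eta k * ((d k + sigma * x k) * p k) + sigma / 2 * (eta k * p k) ^+ 2
  <= eta k * (r k - (1 - tau2 * b / (4 * tau1)) * (h k * y k ^+ 2)).
Proof.
exists rem => //; apply: filterS h_growth => k hk.
have t1 : tau1 != 0 by rewrite gt_eqF.
set G := 1 + tau2 * eta k * b / 2 + (tau2 * eta k) ^+ 2 in hk.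
apply: (@le_trans _ _ ((2 * tau1)^-1 * (h k * G * y k.+1 ^+ 2 - h k * y k ^+ 2)
   - eta k * ((d k + sigma * x k) * p k) + sigma / 2 * (eta k * p k) ^+ 2)).
  rewrite !lerD2r ler_wpM2l ?invr_ge0 ?mulr_ge0 //; first exact: ltW.
  by rewrite lerD2r ler_wpM2r // sqr_ge0.
rewrite yS -subr_ge0.
rewrite (_ : _ - _ = eta k * (sigma / tau1 * (h k * y k) ^+ 2)).
  apply: mulr_ge0; first exact: ltW.
  by apply: mulr_ge0; [apply: divr_ge0 => //; exact: ltW|exact: sqr_ge0].
rewrite /rem /G p_pi /Y p_pi.
by field.
Qed.

End CoordinateDescent.

Lemma cvg_bounded_seq (R : realType) (u : nat -> R) (l : R) : u @ \oo --> l -> bounded_seq u.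
Proof.
move=> ul; rewrite (_ : u = fun k => (u k - l) + l); last by apply/funext => k; rewrite subrK.
apply: bounded_seqD; last exact: bounded_cst.
by apply: null_bounded; rewrite /null_seq -(subrr l); apply: cvgB => //; exact: cvg_cst.
Qed.

(** * The preconditioner *)

Section Preconditioner.
Context {R : realType}.
Variable eps : R.
Hypothesis eps_gt0 : 0 < eps.

Definition precond1 (u : R) : R := (Num.max u 0 + eps) `^ (- 2^-1).

Let base_gt0 u : 0 < Num.max u 0 + eps.
Proof. by rewrite ltr_wpDl // le_max lexx orbT. Qed.

Lemma precond1_gt0 u : 0 < precond1 u.
Proof. exact: powR_gt0. Qed.

Lemma precond1_sqr u : precond1 u ^+ 2 = (Num.max u 0 + eps)^-1.
Proof.
rewrite /precond1 -powR_mulrn ?powR_ge0 // -powRrM mulNr mulVf ?pnatr_eq0 //.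
by rewrite powR_inv1 // ltW.
Qed.

Let sqr_le (a b : R) : 0 <= b -> a ^+ 2 <= b ^+ 2 -> a <= b.
Proof.
move=> b0 h; have [//|ba] := leP a b; have := ltr_pM b0 b0 ba ba.
by rewrite -!expr2 ltNge h.
Qed.

Lemma precond1_le u : precond1 u <= precond1 0.
Proof.
apply: sqr_le; first exact/ltW/precond1_gt0.
rewrite !precond1_sqr lef_pV2 ?posrE // lerD2r maxxx.
by rewrite le_max lexx orbT.
Qed.

Lemma precond1_ge u (V : R) : `|u| <= V -> precond1 V <= precond1 u.
Proof.
move=> uV; apply: sqr_le; first exact/ltW/precond1_gt0.
rewrite !precond1_sqr lef_pV2 ?posrE // lerD2r ge_max !le_max lexx orbT andbT.
by rewrite (le_trans (ler_norm u) uV).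
Qed.

Lemma precond1_lip u u' : `|precond1 u - precond1 u'| <= precond1 0 ^+ 3 * `|u - u'|.
Proof.
have h0 := precond1_gt0 u; have h0' := precond1_gt0 u'.
have hs := precond1_sqr u; have hs' := precond1_sqr u'.
set h := precond1 u in h0 hs *; set h' := precond1 u' in h0' hs' *.
have hh : 0 < h + h' by rewrite addr_gt0.
have -> : h - h' = (Num.max u' 0 - Num.max u 0) * (h ^+ 2 * h' ^+ 2 / (h + h')).
  have -> : Num.max u' 0 - Num.max u 0 = (h' ^+ 2)^-1 - (h ^+ 2)^-1.
    by rewrite hs hs' !invrK; ring.
  by field; rewrite !gt_eqF.
rewrite normrM mulrC; apply: ler_pM => //.
  rewrite ger0_norm; last first.
    by apply: divr_ge0; [apply: mulr_ge0; exact: sqr_ge0|exact: ltW].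
  rewrite ler_pdivrMr //.
  apply: (@le_trans _ _ (precond1 0 ^+ 3 * h')); last first.
    by rewrite ler_wpM2l ?lerDr ?exprn_ge0 // ltW // precond1_gt0.
  rewrite expr2 [h' ^+ 2]expr2 mulrA ler_wpM2r //; first exact: ltW.
  rewrite exprSr expr2; apply: ler_pM; rewrite ?mulr_ge0 ?precond1_le //; try exact: ltW.
  by apply: ler_pM; rewrite ?precond1_le //; exact: ltW.
have a1 := ler_norm (u - u'); have a2 := ler_norm (u' - u); rewrite distrC in a2.
rewrite ler_norml; have [?|?] := leP u' 0; have [?|?] := leP u 0;
  apply/andP; split; lra.
Qed.

(** When the estimator shrinks by a factor [1 - alpha], the regularised estimator
    [u + eps] only shrinks by [1 - alpha * u / (u + eps)], and its inverse square root
    grows by about half of that rate.  The bound [V] makes [V / (V + eps)] a uniform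
    factor below one. *)
Lemma precond1_growth u u' (alpha V : R) : 0 <= alpha <= 1 / 2 -> `|u| <= V ->
  (1 - alpha) * u <= u' ->
  precond1 u' <= precond1 u * (1 + alpha * (V / (V + eps)) / 2 + alpha ^+ 2).
Proof.
move=> /andP[a0 a1] uV uu'.
have V0 : 0 <= V := le_trans (normr_ge0 _) uV.
have Ve : 0 < V + eps by rewrite ltr_wpDl.
set b := V / (V + eps).
have b0 : 0 <= b by rewrite divr_ge0 // ltW.
have b1 : b <= 1 by rewrite ler_pdivrMr // mul1r lerDl ltW.
set G := 1 + _ + _.
have G0 : 0 <= G by rewrite /G !addr_ge0 ?sqr_ge0 // divr_ge0 // mulr_ge0.
set w := Num.max u 0; have w0 : 0 <= w by rewrite /w le_max lexx orbT.
have wV : w <= V by rewrite /w ge_max V0 andbT (le_trans (ler_norm u)).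
have ww' : (1 - alpha) * w <= Num.max u' 0.
  rewrite /w; have [u0|u0] := leP u 0; first by rewrite mulr0 le_max lexx orbT.
  by rewrite le_max uu'.
apply: sqr_le; first by rewrite mulr_ge0 // ltW // precond1_gt0.
rewrite exprMn !precond1_sqr -/w.
have we : 0 < w + eps by rewrite ltr_wpDl.
have wb : alpha * w <= alpha * b * (w + eps).
  rewrite -mulrA ler_wpM2l // /b mulrAC ler_pdivlMr //.
  by rewrite mulrDr mulrDr [w * V]mulrC lerD2l ler_wpM2r // ltW.
(* [G] is the expansion of [(1 - alpha * b) ^ (-1/2)], with a second-order term that
   covers the remainder for [alpha <= 1/2]. *)
have GG : 1 <= (1 - alpha * b) * G ^+ 2.
  have s0 : 0 <= alpha * b by rewrite mulr_ge0.
  have sa : alpha * b <= alpha by rewrite ler_piMr.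
  rewrite /G; move: s0 sa; set s := alpha * b => s0 sa.
  have -> : (1 - s) * (1 + s / 2 + alpha ^+ 2) ^+ 2 =
    1 + ((2 * alpha ^+ 2 * (1 - s) - s ^+ 2) + (1 - s) * (s ^+ 2 / 4 + s * alpha ^+ 2 + alpha ^+ 4)).
    by field.
  rewrite lerDl addr_ge0 //; first by nra.
  apply: mulr_ge0; first by lra.
  apply: addr_ge0; last exact: exprn_ge0.
  by apply: addr_ge0; [rewrite divr_ge0 ?sqr_ge0|rewrite mulr_ge0 ?sqr_ge0].
rewrite -[leLHS]mul1r ler_pdivrMr // (le_trans GG) //.
have -> : (1 - alpha * b) * G ^+ 2 = (w + eps)^-1 * G ^+ 2 * ((1 - alpha * b) * (w + eps)).
  by field; rewrite gt_eqF.
rewrite ler_wpM2l //; first by rewrite mulr_ge0 ?sqr_ge0 // invr_ge0 ltW.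
by move: ww' wb; lra.
Qed.
End Preconditioner.

(** * Convergence of a sample path with vanishing filtered noise *)

(** Averages of bounded terms stay bounded once the weights are below one. *)
Lemma averaging_bounded (R : realType) n (a : nat -> R) (u b : nat -> 'rV[R]_n) (B : R) :
  null_seq a -> (forall k, 0 <= a k) -> (forall k, `|b k| <= B) ->
  (forall k, u k.+1 = (1 - a k) *: u k + a k *: b k) ->
  exists M, forall k, `|u k| <= M.
Proof.
move=> /null_seqP /(_ 1 ltr01) [N _ hN] a0 bB uS.
have B0 : 0 <= B := le_trans (normr_ge0 _) (bB 0%N).
pose M := B + \sum_(i < N.+1) `|u i|.
have small k : (k <= N)%N -> `|u k| <= M.
  move=> kN; rewrite /M (bigD1 (Ordinal (kN : (k < N.+1)%N))) //= addrCA lerDl.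
  by rewrite addr_ge0 // sumr_ge0.
exists M; elim=> [|k ih]; first exact: small.
have [kN|Nk] := leqP k.+1 N; first exact: small.
rewrite uS (le_trans (ler_normD _ _)) // !normrZ.
have ak : a k <= 1 by have := hN k Nk; rewrite /= ger0_norm.
rewrite (ger0_norm (a0 k)) ger0_norm ?subr_ge0 //.
have -> : M = (1 - a k) * M + a k * M by ring.
rewrite lerD // ler_wpM2l // ?subr_ge0 // (le_trans (bB k)) //.
by rewrite lerDl sumr_ge0.
Qed.

Section Coordinates.
Context {R : realType} {n : nat}.
Implicit Types u : nat -> 'rV[R]_n.

Lemma bounded_coords u : (forall i, bounded_seq (fun k => u k 0 i)) ->
  exists B, forall k, `|u k| <= B.
Proof.
move=> hu; have [B hB] : {B : 'I_n -> R & forall i k, `|u k 0 i| <= B i}.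
  exact: (@boolp.choice 'I_n R (fun i B => forall k, `|u k 0 i| <= B)).
have B0 i : 0 <= B i := le_trans (normr_ge0 _) (hB i 0%N).
exists (\sum_i B i) => k; apply: norm_le_coord => [|i]; first exact: sumr_ge0.
by rewrite (le_trans (hB i k)) // (bigD1 i) //= lerDl sumr_ge0.
Qed.

Lemma null_coords u : (forall i, null_seq (fun k => u k 0 i)) ->
  forall e, 0 < e -> \forall k \near \oo, `|u k| <= e.
Proof.
move=> hu e e0.
have : \forall k \near \oo, forall i, `|u k 0 i| <= e.
  by apply: filter_forall => i; exact: (null_seqP _).1 (hu i) e e0.
by apply: filterS => k hk; apply: norm_le_coord => //; exact: ltW.
Qed.

Lemma lipschitz_coords u (eta : nat -> R) : (forall k, 0 < eta k) ->
  (forall i, exists2 C, 0 <= C & forall k, `|u k.+1 0 i - u k 0 i| <= C * eta k) ->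
  exists2 C, 0 <= C & forall k, `|u k.+1 - u k| <= C * eta k.
Proof.
move=> eta0 hu.
have [C hC] : {C : 'I_n -> R & forall i, 0 <= C i /\
    forall k, `|u k.+1 0 i - u k 0 i| <= C i * eta k}.
  apply: (@boolp.choice 'I_n R (fun i C => 0 <= C /\
    forall k, `|u k.+1 0 i - u k 0 i| <= C * eta k)) => i.
  by have [C C0 hC] := hu i; exists C.
have C0 : 0 <= \sum_i C i by apply: sumr_ge0 => i _; case: (hC i).
exists (\sum_i C i) => // k.
apply: norm_le_coord => [|i]; first by rewrite mulr_ge0 // ltW.
rewrite !mxE; have [_ h] := hC i; apply: (le_trans (h k)).
rewrite ler_wpM2r ?(ltW (eta0 k)) // (bigD1 i) //= lerDl sumr_ge0 // => j _.
by case: (hC j).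
Qed.

Lemma continuous_locally_bounded (f : 'rV[R]_n -> R) (x : 'rV[R]_n) : continuous f ->
  \forall z \near x, `|f z| <= `|f x| + 1.
Proof.
move=> fc; have /cvgrPdist_le /(_ 1 ltr01) : f z @[z --> x] --> f x by exact: fc.
apply: filterS => z hz.
have -> : f z = f x - (f x - f z) by rewrite opprB addrC subrK.
by rewrite (le_trans (ler_normB _ _)) // lerD2l.
Qed.

Lemma reg_fun_continuous sigma (f : 'rV[R]_n -> R) : continuous f ->
  continuous (reg_fun sigma f).
Proof.
move=> fc.
have -> : reg_fun sigma f = fun x => f x + sigma / 2 * dotp x x.
  by apply/funext => x; rewrite /reg_fun enorm_sqr.
move=> x; apply: (@continuousD _ _ _ f (fun x => sigma / 2 * dotp x x)); first exact: fc.
apply: (@continuousM _ _ (fun=> sigma / 2) (fun x : 'rV[R]_n => dotp x x)).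
  exact: cst_continuous.
apply: (@continuous_big R _ +%R) => [|i _ v]; first exact: add_continuous.
by apply: (@continuousM _ _ (fun w : 'rV[R]_n => w 0 i) (fun w : 'rV[R]_n => w 0 i));
  exact: coord_continuous.
Qed.

End Coordinates.

Section Deterministic.
Context {R : realType} {n : nat}.
Variables (sigma : R) (f : 'rV[R]_n -> R) (D : 'rV[R]_n -> set 'rV[R]_n).
Variables (x m v d xi nf : nat -> 'rV[R]_n) (W : 'rV[R]_n * 'rV[R]_n -> 'rV[R]_n).
Variables (eta theta delta : nat -> R) (eps tau1 tau2 Mx Mxi : R).
Hypothesis sigma_gt0 : 0 < sigma.
Hypothesis f_cont : continuous f.
Hypothesis closedD : closed [set p : 'rV[R]_n * 'rV[R]_n | D p.1 p.2].
Hypothesis D0 : forall x, D x !=set0 /\ compact (D x).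
Hypothesis convD : forall x, @convex_set R 'rV[R]_n (D x).
Hypothesis D_loc : forall x : 'rV[R]_n,
  exists B, \forall z \near x, forall v, D z v -> `|v| <= B.
Hypothesis potD : potential f D.
Hypothesis sard :
  [set reg_fun sigma f v | v in [set v | D v (- sigma *: v)]]° = set0.
Hypothesis fw : AFMDW sigma (precond eps) eta theta (fun k => d k + xi k.+1) x m v.
Hypothesis x_enorm : forall k, enorm (x k) <= Mx.
Hypothesis W_loc : forall p : 'rV[R]_n * 'rV[R]_n, bounded_near W (nbhs p).
Hypothesis W_ge0 : forall p i, 0 <= W p 0 i.
Hypothesis tau2_gt0 : 0 < tau2.
Hypothesis vS : forall k,
  v k.+1 = v k - (tau2 * eta k) *: (v k - W (d k + xi k.+1, m k.+1)).
Hypothesis eps_gt0 : 0 < eps.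
Hypothesis eta_gt0 : forall k, 0 < eta k.
Hypothesis theta_gt0 : forall k, 0 < theta k.
Hypothesis theta_div : series theta @ \oo --> +oo.
Hypothesis theta_cvg : null_seq theta.
Hypothesis ratio_cvg : (fun k => theta k / eta k) @ \oo --> tau1.
Hypothesis tau1_ge : tau2 / 4 <= tau1.
Hypothesis tau1_gt0 : 0 < tau1.
Hypothesis delta_cvg : null_seq delta.
Hypothesis d_enlarge : forall k, enlarge (delta k) D (x k) (d k).
Hypothesis xi_enorm : forall k, enorm (xi k) <= Mxi.
Hypothesis nfS : forall k, nf k.+1 = (1 - theta k) *: nf k + theta k *: xi k.+1.
Hypothesis nf_cvg : forall i, null_seq (fun k => nf k 0 i).

Let t1_neq0 : tau1 != 0. Proof. by rewrite gt_eqF. Qed.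

Let eta_cvg : null_seq eta.
Proof.
have h : (fun k => eta k / theta k) @ \oo --> tau1^-1.
  rewrite (_ : (fun k => eta k / theta k) = fun k => (theta k / eta k)^-1).
    exact: cvgV.
  by apply/funext => k; rewrite invf_div.
rewrite (_ : eta = fun k => eta k / theta k * theta k).
  by apply: null_seqM => //; exact: (cvg_bounded_seq h).
by apply/funext => k; rewrite divfK // gt_eqF.
Qed.

Let theta_le : exists2 Ct, 0 < Ct & forall k, theta k <= Ct * eta k.
Proof.
have [M hM] := cvg_bounded_seq ratio_cvg.
exists (M + 1) => [|k]; first by rewrite ltr_wpDl // (le_trans _ (hM 0%N)).
rewrite -ler_pdivrMr // (le_trans (ler_norm _)) // (le_trans (hM k)) //.
by rewrite lerDl.
Qed.

Let theta_ge : \forall k \near \oo, tau1 / 2 * eta k <= theta k.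
Proof.
have h2 : 0 < tau1 / 2 by rewrite divr_gt0.
have : \forall k \near \oo, `|tau1 - theta k / eta k| <= tau1 / 2.
  by move/cvgrPdist_le : ratio_cvg => /(_ _ h2).
apply: filterS => k; rewrite ler_norml => /andP[_ hk].
by rewrite -ler_pdivlMr //; move: hk; set a := theta k / eta k; lra.
Qed.

Let eta_div : series eta @ \oo --> +oo.
Proof.
have [Ct Ct0 hCt] := theta_le; apply/cvgryPge => A.
move/cvgryPge : theta_div => /(_ (Ct * A)); apply: filterS => k hk.
rewrite -(ler_pM2l Ct0); apply: (le_trans hk).
by rewrite /series /= mulr_sumr; apply: ler_sum.
Qed.

Let x_le k : `|x k| <= Mx. Proof. exact: le_trans (norm_le_enorm _) (x_enorm k). Qed.

(** The distance to a value of the field is an infimum, hence the slack [k.+1%:R^-1]. *)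
Let exact_values : exists (z e : nat -> 'rV[R]_n), [/\
  forall k, D (z k) (e k),
  forall k, `|z k - x k| <= delta k &
  forall k, `|d k - e k| <= delta k + k.+1%:R^-1].
Proof.
have [z hz] : {z : nat -> 'rV[R]_n * 'rV[R]_n & forall k,
    [/\ D (z k).1 (z k).2, `|(z k).1 - x k| <= delta k &
      `|d k - (z k).2| <= delta k + k.+1%:R^-1]}.
  apply: (@boolp.choice nat ('rV[R]_n * 'rV[R]_n)%type (fun k z =>
    [/\ D z.1 z.2, `|z.1 - x k| <= delta k & `|d k - z.2| <= delta k + k.+1%:R^-1])) => k.
  have [z zx dz] := d_enlarge k.
  have [||_ [b Db <-] hb] := @inf_adherent R [set enorm (d k - a) | a in D z] k.+1%:R^-1.
  - by rewrite invr_gt0.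
  - split; last by exists 0 => _ [a _ <-]; exact: sqrtr_ge0.
    by have [[a Da] _] := D0 z; exists (enorm (d k - a)); exists a.
  exists (z, b); split => //=; first exact: le_trans (norm_le_enorm _) zx.
  apply: (le_trans (norm_le_enorm _)); apply: (le_trans (ltW hb)).
  by rewrite lerD2r.
exists (fun k => (z k).1), (fun k => (z k).2).
by split => k; have [] := hz k.
Qed.

Let harmonic_null : null_seq (fun k => k.+1%:R^-1 : R).
Proof. exact: cvg_harmonic. Qed.

Let xi_le k : `|xi k| <= Mxi.
Proof. exact: le_trans (norm_le_enorm _) (xi_enorm k). Qed.

Let d_bounded : exists B, forall k, `|d k| <= B.
Proof.
have [z [e [De zx de]]] := exact_values.
have [M hM] := null_bounded delta_cvg.
have [B B0 hB] := bounded_field_on_ball D_loc (M + Mx).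
exists ((M + 1) + B) => k; rewrite -(subrK (e k) (d k)) (le_trans (ler_normD _ _)) //.
have dM : delta k <= M := le_trans (ler_norm _) (hM k).
rewrite lerD //.
  by rewrite (le_trans (de k)) // lerD // invf_le1 // ler1n.
apply: (hB (z k)) => //; rewrite -(subrK (x k) (z k)) (le_trans (ler_normD _ _)) //.
by rewrite lerD // (le_trans (zx k)).
Qed.

Let m_bounded : exists B, forall k, `|m k| <= B.
Proof.
have [B hB] := d_bounded.
apply: (@averaging_bounded R n theta m (fun k => d k + xi k.+1) (B + Mxi)) => //.
- by move=> k; exact: ltW.
- by move=> k; rewrite (le_trans (ler_normD _ _)) // lerD.
- by move=> k; case: (fw k).
Qed.

Let nf_bounded : exists B, forall k, `|nf k| <= B.
Proof.
apply: (@averaging_bounded R n theta nf (fun k => xi k.+1) Mxi) => // k; exact: ltW.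
Qed.

Let W_bounded : exists B, forall k, `|W (d k + xi k.+1, m k.+1)| <= B.
Proof.
have [Bd hd] := d_bounded; have [Bm hm] := m_bounded.
have [B hB] := @compact_uniform_bound R _ _ (fun p B => `|W p| <= B)
  (compact_setX (@compact_normball R n (Bd + Mxi)) (@compact_normball R n Bm))
  (fun z B B' BB' h => le_trans h BB')
  (fun p _ => let: ex_intro2 M _ hM := ex_strict_bound_gt0 (W_loc p) in
     ex_intro _ M (filterS (fun q => @ltW _ _ _ _) hM)).
exists B => k; apply: hB; split => //=.
by rewrite (le_trans (ler_normD _ _)) // lerD.
Qed.

Let v_bounded : exists B, forall k, `|v k| <= B.
Proof.
have [B hB] := W_bounded.
apply: (@averaging_bounded R n (fun k => tau2 * eta k) v
  (fun k => W (d k + xi k.+1, m k.+1)) B) => //.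
- by apply: null_seqM => //; exact: bounded_cst.
- by move=> k; rewrite mulr_ge0 // ltW.
- by move=> k; rewrite vS; apply/rowP => i; rewrite !mxE; ring.
Qed.

(** The momentum without its noise part. *)
Let mu k := m k - nf k.
Let y k := mu k + sigma *: x k.
Let h k i := precond1 eps (v k 0 i).
Let p k := hadamard (precond eps (v k.+1)) (m k.+1 + sigma *: x k).
Let q k := \row_i (h k i * y k 0 i).

Let qE k i : q k 0 i = h k i * y k 0 i.
Proof. by rewrite /q mxE. Qed.

Let muS k : mu k.+1 = (1 - theta k) *: mu k + theta k *: d k.
Proof.
by rewrite /mu nfS; case: (fw k) => -> _; apply/rowP => i; rewrite !mxE; ring.
Qed.

Let xS k : x k.+1 = x k - eta k *: p k.
Proof. by case: (fw k). Qed.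

Let pE k i : p k 0 i = h k.+1 i * (y k 0 i + theta k * (d k 0 i - mu k 0 i) + nf k.+1 0 i).
Proof.
rewrite /p /hadamard mxE /precond mxE; congr (_ * _).
have -> : m k.+1 = mu k.+1 + nf k.+1 by rewrite /mu subrK.
by rewrite muS /y !mxE; ring.
Qed.

Let coord_bounded (u : nat -> 'rV[R]_n) i : (exists B, forall k, `|u k| <= B) ->
  bounded_seq (fun k => u k 0 i).
Proof. by move=> [B hB]; exists B => k; exact: le_trans (coord_le_norm _ _) (hB k). Qed.

Let mu_bounded : exists B, forall k, `|mu k| <= B.
Proof.
have [B hB] := m_bounded; have [B' hB'] := nf_bounded.
by exists (B + B') => k; rewrite (le_trans (ler_normB _ _)) // lerD.
Qed.

Let h_bd i : bounded_seq (fun k => h k i).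
Proof.
by exists (precond1 eps 0) => k; rewrite ger0_norm ?precond1_le // ltW // precond1_gt0.
Qed.

Let h_lip : exists2 C, 0 <= C & forall k i, `|h k.+1 i - h k i| <= C * eta k.
Proof.
have [B hB] := v_bounded; have [B' hB'] := W_bounded.
have B0 : 0 <= B := le_trans (normr_ge0 _) (hB 0%N).
have B'0 : 0 <= B' := le_trans (normr_ge0 _) (hB' 0%N).
have p0 : 0 <= precond1 eps 0 ^+ 3 by rewrite exprn_ge0 // ltW // precond1_gt0.
exists (precond1 eps 0 ^+ 3 * (tau2 * (B + B'))).
  by rewrite mulr_ge0 // mulr_ge0 ?addr_ge0 // ltW.
move=> k i; apply: (le_trans (precond1_lip eps_gt0 _ _)).
rewrite -[leRHS]mulrA ler_wpM2l // vS !mxE addrAC subrr add0r normrN normrM.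
have te : 0 <= tau2 * eta k by rewrite mulr_ge0 // ltW.
rewrite (ger0_norm te) [leRHS]mulrAC ler_wpM2l //.
rewrite (le_trans (ler_normB _ _)) // lerD //.
  exact: le_trans (coord_le_norm _ _) (hB k).
exact: le_trans (coord_le_norm _ _) (hB' k).
Qed.

Let h_diff i : null_seq (fun k => h k.+1 i - h k i).
Proof.
have [C C0 hC] := h_lip; apply/null_seqP => e e0.
have C1 : 0 < C + 1 by rewrite ltr_wpDl.
move/null_seqP : eta_cvg => /(_ _ (divr_gt0 e0 C1)); apply: filterS => k.
rewrite gtr0_norm // => hk; apply: (le_trans (hC k i)).
apply: (@le_trans _ _ ((C + 1) * eta k)); first by rewrite ler_wpM2r ?lerDl // ltW.
by rewrite -ler_pdivlMl // mulrC.
Qed.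

Let Vb : exists2 V, 0 <= V & forall k i, `|v k 0 i| <= V.
Proof.
have [B hB] := v_bounded; exists B; first exact: le_trans (hB 0%N).
by move=> k i; exact: le_trans (coord_le_norm _ _) (hB k).
Qed.

Let h_growth V i : (forall k i, `|v k 0 i| <= V) -> \forall k \near \oo,
  h k.+1 i <= h k i * (1 + tau2 * eta k * (V / (V + eps)) / 2 + (tau2 * eta k) ^+ 2).
Proof.
move=> hV.
have : null_seq (fun k => tau2 * eta k) by apply: null_seqM => //; exact: bounded_cst.
move/null_seqP => /(_ (1 / 2) (divr_gt0 ltr01 (ltr0Sn _ _))); apply: filterS => k.
have t0 : 0 < tau2 * eta k by rewrite mulr_gt0.
rewrite gtr0_norm // => t2; apply: precond1_growth => //; first by rewrite ltW.
rewrite vS !mxE -subr_ge0.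
rewrite (_ : _ - _ = tau2 * eta k * W (d k + xi k.+1, m k.+1) 0 i); last by ring.
by rewrite mulr_ge0 // ltW.
Qed.

Let x_bounded : exists B, forall k, `|x k| <= B. Proof. by exists Mx. Qed.

Let y_bounded : exists B, forall k, `|y k| <= B.
Proof.
have [B hB] := mu_bounded; exists (B + sigma * Mx) => k.
rewrite (le_trans (ler_normD _ _)) // lerD // normrZ (gtr0_norm sigma_gt0).
by rewrite ler_wpM2l // ltW.
Qed.

Let yE i k : y k 0 i = mu k 0 i + sigma * x k 0 i.
Proof. by rewrite /y !mxE. Qed.

Let muSi i k : mu k.+1 0 i = (1 - theta k) * mu k 0 i + theta k * d k 0 i.
Proof. by rewrite muS !mxE. Qed.

Let xSi i k : x k.+1 0 i = x k 0 i - eta k * p k 0 i.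
Proof. by rewrite xS; move: (p k) => pk; rewrite !mxE. Qed.

Let step_bounded i : bounded_seq (fun k => p k 0 i).
Proof.
exact: (coordinate_step_bounded eta_gt0 eta_cvg ratio_cvg (coord_bounded i x_bounded)
  (coord_bounded i mu_bounded) (coord_bounded i d_bounded) (h_bd i) (nf_cvg i) (h_diff i)
  (yE i) (fun k => pE k i)).
Qed.

Let step_close i : null_seq (fun k => p k 0 i - q k 0 i).
Proof.
rewrite (_ : (fun k => _) = fun k => p k 0 i - h k i * y k 0 i).
  exact: (coordinate_step_close eta_gt0 eta_cvg ratio_cvg (coord_bounded i x_bounded)
    (coord_bounded i mu_bounded) (coord_bounded i d_bounded) (h_bd i) (nf_cvg i) (h_diff i)
    (yE i) (fun k => pE k i)).
by apply/funext => k; rewrite qE.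
Qed.

Let p_bounded : exists B, forall k, `|p k| <= B.
Proof. exact: bounded_coords. Qed.

Let pq e : 0 < e -> \forall k \near \oo, `|p k - q k| <= e.
Proof.
apply: (null_coords (u := fun k => p k - q k)) => i.
rewrite (_ : (fun k => _) = fun k => p k 0 i - q k 0 i) //.
by apply/funext => k; move: (p k) (q k) => pk qk; rewrite !mxE.
Qed.

Let y_lip : exists2 C, 0 <= C & forall k, `|y k.+1 - y k| <= C * eta k.
Proof.
apply: lipschitz_coords => // i.
exact: (coordinate_momentum_lip eta_gt0 eta_cvg ratio_cvg (coord_bounded i x_bounded)
  (coord_bounded i mu_bounded) (coord_bounded i d_bounded) (h_bd i) (nf_cvg i) (h_diff i)
  (yE i) (muSi i) (fun k => pE k i) (xSi i)).
Qed.

Let h_le k i : `|h k i| <= precond1 eps 0.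
Proof. by rewrite ger0_norm ?precond1_le // ltW // precond1_gt0. Qed.

Let Hm0 : 0 <= precond1 eps 0. Proof. by rewrite ltW // precond1_gt0. Qed.

Let q_le_y k : `|q k| <= precond1 eps 0 * `|y k|.
Proof.
apply: norm_le_coord => [|i]; first by rewrite mulr_ge0.
by rewrite qE normrM ler_pM // coord_le_norm.
Qed.

Let q_lip : exists C, forall k, `|q k.+1 - q k| <= C * eta k.
Proof.
have [Ch Ch0 hCh] := h_lip; have [Cy Cy0 hCy] := y_lip; have [B hB] := y_bounded.
have B0 : 0 <= B := le_trans (normr_ge0 _) (hB 0%N).
exists (Ch * B + precond1 eps 0 * Cy) => k.
have ek := eta_gt0 k.
apply: norm_le_coord => [|i].
  by apply: mulr_ge0; [rewrite addr_ge0 // mulr_ge0|exact: ltW].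
have -> : (q k.+1 - q k) 0 i =
    (h k.+1 i - h k i) * y k.+1 0 i + h k i * (y k.+1 - y k) 0 i.
  have -> : (q k.+1 - q k) 0 i = q k.+1 0 i - q k 0 i.
    by move: (q k.+1) (q k) => q1 q2; rewrite !mxE.
  by rewrite !qE; move: (y k.+1) (y k) => y1 y2; rewrite !mxE; ring.
rewrite (le_trans (ler_normD _ _)) // !normrM mulrDl lerD //.
  rewrite mulrAC ler_pM // (le_trans (coord_le_norm _ _)) //.
by rewrite -mulrA ler_pM // (le_trans (coord_le_norm _ _)).
Qed.

(** The smooth part of the energy [f + Psi]: the regularisation, and the square of [y]
    in the metric of the preconditioner. *)
Let Psi k := sigma / 2 * dotp (x k) (x k) +
  (2 * tau1)^-1 * \sum_i h k i * y k 0 i ^+ 2.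

(** One step decreases the energy, up to the term that the chain rule
    compensates. *)
Let Psi_step : exists2 c0, 0 < c0 & exists2 r, null_seq r & \forall k \near \oo,
  Psi k.+1 - Psi k <= eta k * dotp (d k) (p k) + eta k * (r k - c0 * `|y k| ^+ 2).
Proof.
have [V V0 hV] := Vb.
have Ve : 0 < V + eps by rewrite ltr_wpDl.
pose b := V / (V + eps).
have b0 : 0 <= b by rewrite divr_ge0 // ltW.
have b1 : b < 1 by rewrite ltr_pdivrMr // mul1r ltrDl.
have hV0 : 0 < precond1 eps V by exact: precond1_gt0.
exists ((1 - b) * precond1 eps V); first by rewrite mulr_gt0 // subr_gt0.
have t4 : 0 < 4 * tau1 by rewrite mulr_gt0.
have tb : tau2 * b / (4 * tau1) <= b.
  rewrite ler_pdivrMr // [leRHS]mulrC ler_wpM2r //.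
  by move: tau1_ge; rewrite ler_pdivrMr // mulrC.
have [r hr] : {r : 'I_n -> nat -> R & forall i, null_seq (r i) /\ \forall k \near \oo,
    (2 * tau1)^-1 * (h k.+1 i * y k.+1 0 i ^+ 2 - h k i * y k 0 i ^+ 2) -
    eta k * ((d k 0 i + sigma * x k 0 i) * p k 0 i) + sigma / 2 * (eta k * p k 0 i) ^+ 2 <=
    eta k * (r i k - (1 - tau2 * b / (4 * tau1)) * (h k i * y k 0 i ^+ 2))}.
  apply: (@boolp.choice 'I_n (nat -> R) (fun i r => null_seq r /\ \forall k \near \oo,
    (2 * tau1)^-1 * (h k.+1 i * y k.+1 0 i ^+ 2 - h k i * y k 0 i ^+ 2) -
    eta k * ((d k 0 i + sigma * x k 0 i) * p k 0 i) + sigma / 2 * (eta k * p k 0 i) ^+ 2 <=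
    eta k * (r k - (1 - tau2 * b / (4 * tau1)) * (h k i * y k 0 i ^+ 2)))) => i.
  have [r r0 hr] := coordinate_descent eta_gt0 eta_cvg tau1_gt0 (ltW sigma_gt0) ratio_cvg
    (coord_bounded i x_bounded) (coord_bounded i mu_bounded) (coord_bounded i d_bounded)
    (h_bd i) (nf_cvg i) (h_diff i) (h_growth i hV) (yE i) (muSi i)
    (fun k => pE k i) (xSi i).
  by exists r.
exists (fun k => \sum_i r i k); first by apply: null_sum => i; case: (hr i).
have hk : \forall k \near \oo, forall i,
    (2 * tau1)^-1 * (h k.+1 i * y k.+1 0 i ^+ 2 - h k i * y k 0 i ^+ 2) -
    eta k * ((d k 0 i + sigma * x k 0 i) * p k 0 i) + sigma / 2 * (eta k * p k 0 i) ^+ 2 <=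
    eta k * (r i k - (1 - tau2 * b / (4 * tau1)) * (h k i * y k 0 i ^+ 2)).
  by apply: filter_forall => i; case: (hr i).
apply: filterS hk => k hk; rewrite -lerBlDl.
have -> : Psi k.+1 - Psi k - eta k * dotp (d k) (p k) = \sum_i
   ((2 * tau1)^-1 * (h k.+1 i * y k.+1 0 i ^+ 2 - h k i * y k 0 i ^+ 2) -
    eta k * ((d k 0 i + sigma * x k 0 i) * p k 0 i) + sigma / 2 * (eta k * p k 0 i) ^+ 2).
  rewrite /Psi /dotp !mulr_sumr -!big_split /= -!sumrB /=; apply: eq_bigr => i _.
  by rewrite xSi; field; rewrite gt_eqF.
apply: (@le_trans _ _ (\sum_i (eta k * r i k -
    eta k * ((1 - b) * precond1 eps V) * (y k 0 i * y k 0 i)))).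
  apply: ler_sum => i _; apply: (le_trans (hk i)).
  rewrite mulrBr lerD2l lerN2 -mulrA ler_pM2l //.
  have -> : (1 - b) * precond1 eps V * (y k 0 i * y k 0 i) =
    (1 - b) * (precond1 eps V * y k 0 i ^+ 2) by ring.
  apply: ler_pM.
  - by rewrite subr_ge0 ltW.
  - by rewrite mulr_ge0 ?sqr_ge0 // ltW.
  - by rewrite lerD2l lerN2.
  - by rewrite ler_wpM2r ?sqr_ge0 // precond1_ge.
rewrite sumrB -!mulr_sumr mulrBr lerD2l lerN2 mulrA.
have dc0 : 0 <= eta k * ((1 - b) * precond1 eps V).
  by apply: mulr_ge0; [exact: ltW|apply: mulr_ge0; [rewrite subr_ge0|]; exact: ltW].
apply: ler_wpM2l => //.
rewrite -/(dotp (y k) (y k)) -enorm_sqr.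
by rewrite ler_pXn2r ?nnegrE ?sqrtr_ge0 // norm_le_enorm.
Qed.

Let Phi k := f (x k) + Psi k.

(** The increments of [f] are not controlled step by step: the one-step estimate on
    [Psi] is summed over a window, where the chain rule for [f] absorbs the terms
    [eta * dotp d p]. *)
Theorem deterministic_convergence :
  [/\ forall xs, cluster (x @ \oo) xs -> D xs (- sigma *: xs),
      y @ \oo --> (0 : 'rV[R]_n) & cvgn (fun k => reg_fun sigma f (x k))].
Proof.
have [c0 c00 [r r0 hr]] := Psi_step.
have [z [e [De zx de]]] := exact_values.
have [Ct Ct0 hCt] := theta_le.
have [Cy Cy0 hCy] := y_lip.
have [By hBy] := y_bounded.
have [P hP] := p_bounded.
have [Cq hCq] := q_lip.
have By0 : 0 <= By := le_trans (normr_ge0 _) (hBy 0%N).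
have zx' a : 0 < a -> \forall k \near \oo, `|z k - x k| <= a.
  move=> a0; move/null_seqP : delta_cvg => /(_ _ a0); apply: filterS => k hk.
  by rewrite (le_trans (zx k)) // (le_trans (ler_norm _)).
have de' a : 0 < a -> \forall k \near \oo, `|d k - e k| <= a.
  move=> a0; have /null_seqP /(_ _ a0) := null_seqD delta_cvg harmonic_null.
  by apply: filterS => k hk; rewrite (le_trans (de k)) // (le_trans (ler_norm _)).
pose r' k := r k + dotp (d k - e k) (p k).
have r'0 : null_seq r'.
  apply: null_seqD => //; apply/null_seqP => a a0.
  have P0 : 0 <= P := le_trans (normr_ge0 _) (hP 0%N).
  have nP : 0 < n%:R * P + 1 by rewrite ltr_wpDl // mulr_ge0.
  apply: filterS (de' _ (divr_gt0 a0 nP)) => k hk.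
  rewrite (le_trans (dotp_le_norm _ _)) //.
  apply: (@le_trans _ _ ((n%:R * P + 1) * `|d k - e k|)).
    by rewrite mulrAC ler_wpM2r // ler_wpDr // ler_wpM2l.
  by rewrite -ler_pdivlMl // mulrC.
have f_bd : exists B, forall k, `|f (x k)| <= B.
  have [B hB] := @compact_uniform_bound R _ _ (fun p B => `|f p| <= B)
    (@compact_normball R n Mx) (fun z B B' BB' h => le_trans h BB')
    (fun p _ => ex_intro _ (`|f p| + 1) (continuous_locally_bounded p f_cont)).
  by exists B => k; apply: hB; exact: x_le.
have V_le k : `|(2 * tau1)^-1 * \sum_i h k i * y k 0 i ^+ 2| <=
    ((2 * tau1)^-1 * (n%:R * (precond1 eps 0 * By))) * `|y k|.
  have t2 : 0 <= (2 * tau1)^-1 by rewrite invr_ge0 mulr_ge0 // ltW.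
  rewrite normrM (ger0_norm t2) -mulrA ler_wpM2l //.
  rewrite (le_trans (ler_norm_sum _ _ _)) //.
  apply: (@le_trans _ _ (\sum_(i < n) precond1 eps 0 * By * `|y k|)).
    apply: ler_sum => i _; rewrite normrM -mulrA ler_pM // expr2 normrM ler_pM //.
      exact: le_trans (coord_le_norm _ _) (hBy k).
    exact: coord_le_norm.
  by rewrite sumr_const card_ord -[leLHS]mulr_natl !mulrA.
have Phi_bd : exists B, forall k, `|Phi k| <= B.
  have [Bf hBf] := f_bd.
  exists (Bf + (sigma / 2 * (n%:R * Mx * Mx) + ((2 * tau1)^-1 * (n%:R * (precond1 eps 0 * By))) * By)) => k.
  rewrite /Phi (le_trans (ler_normD _ _)) // lerD //.
  rewrite /Psi (le_trans (ler_normD _ _)) // lerD //.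
    rewrite normrM ger0_norm ?divr_ge0 ?ler_wpM2l ?(ltW sigma_gt0) //.
      by rewrite divr_ge0 // ltW.
    rewrite (le_trans (dotp_le_norm _ _)) //.
    by apply: ler_pM => //; rewrite ?mulr_ge0 // ler_wpM2l.
  apply: (le_trans (V_le k)); apply: ler_wpM2l => //.
  by rewrite !mulr_ge0 // invr_ge0 mulr_ge0 // ltW.
have [BPhi hBPhi] := Phi_bd.
have Phi_g k : `|Phi k - reg_fun sigma f (x k)| <=
    ((2 * tau1)^-1 * (n%:R * (precond1 eps 0 * By))) * `|y k|.
  rewrite /Phi /Psi /reg_fun enorm_sqr.
  rewrite (_ : _ - _ = (2 * tau1)^-1 * \sum_i h k i * y k 0 i ^+ 2); last by ring.
  exact: V_le.
have window K N : (forall i, (N <= i)%N -> Psi i.+1 - Psi i <=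
      eta i * dotp (d i) (p i) + eta i * (r i - c0 * `|y i| ^+ 2)) ->
    forall k, (N <= k)%N -> (k <= K)%N ->
    Psi K + c0 * \sum_(k <= i < K) eta i * `|y i| ^+ 2 <=
    Psi k + \sum_(k <= i < K) eta i * dotp (e i) (p i) + \sum_(k <= i < K) eta i * r' i.
  move=> hN k Nk; elim: K => [|K ih].
    by rewrite leqn0 => /eqP ->; rewrite !big_geq // mulr0 !addr0.
  rewrite leq_eqVlt => /predU1P[<-|]; first by rewrite !big_geq // mulr0 !addr0.
  rewrite ltnS => kK; rewrite !(big_nat_recr _ _ _ kK) /=.
  have h1 := ih kK; have h2 := hN K (leq_trans Nk kK).
  have dE : dotp (d K) (p K) = dotp (e K) (p K) + dotp (d K - e K) (p K).
    by rewrite -dotpDl addrC subrK.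
  rewrite dE in h2; rewrite /r'; move: h1 h2.
  set A := \sum_(k <= i < K) _; set B := \sum_(k <= i < K) _; set C := \sum_(k <= i < K) _.
  by lra.
have C0' : 0 <= (2 * tau1)^-1 * (n%:R * (precond1 eps 0 * By)).
  by rewrite !mulr_ge0 // invr_ge0 mulr_ge0 // ltW.
apply: (@descent_limits R n D (reg_fun sigma f) closedD _ convD D_loc _ eta theta Phi x p y d e z
  sigma c0 Cy (precond1 eps 0) Ct (tau1 / 2) _ BPhi eta_gt0 eta_div eta_cvg (ltW sigma_gt0) c00
  _ Hm0 C0' theta_gt0 hCt theta_ge xS _ hCy _ zx' de' De hBPhi Phi_g _ Mx x_le sard).
- by move=> xs; apply: compact_closed; [exact: norm_hausdorff|case: (D0 xs)].
- exact: reg_fun_continuous.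
- by rewrite divr_gt0.
- move=> k; rewrite {1}/y muS xS; rewrite /y; move: (mu k) (p k) => mk pk.
  by apply/rowP => i; rewrite !mxE; ring.
- move=> a /pq; apply: filterS => k hk.
  rewrite -(subrK (q k) (p k)) addrC (le_trans (ler_normD _ _)) // lerD //.
- move=> K kK Kle a a0; have a2 : 0 < a / 2 by rewrite divr_gt0.
  have qB : exists B, Mx <= B /\ forall k, `|q k| <= B.
    exists (Mx + precond1 eps 0 * By); split; first by rewrite lerDl mulr_ge0.
    move=> k; rewrite (le_trans (q_le_y k)) // ler_wpDl ?ler_wpM2l //.
    exact: le_trans (x_le 0%N).
  have [B [MB hqB]] := qB.
  have chain := @discrete_chain_rule R n f D f_cont closedD (fun x => (D0 x).1) D_loc potD
    eta x p q e z K Cq P B 1 eta_gt0 eta_div eta_cvg xS hP (fun k => le_trans (x_le k) MB)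
    hqB hCq pq kK Kle zx' De _ a2.
  have [N _ hN] := hr.
  have [N1 _ hN1] := (null_seqP _).1 r'0 _ a2.
  have : \forall k \near \oo, (maxn N N1 <= k)%N by exists (maxn N N1).
  apply: filterS2 chain => k hk; rewrite geq_max => /andP[Nk N1k].
  have hw := window (K k) N hN k Nk (kK k).
  have hsum : \sum_(k <= i < K k) eta i * r' i <= a / 2.
    apply: (@le_trans _ _ (\sum_(k <= i < K k) eta i * (a / 2))).
      rewrite !big_nat; apply: ler_sum => i /andP[ki _]; rewrite ler_pM2l //.
      by rewrite (le_trans (ler_norm _)) //; apply: hN1; exact: leq_trans ki.
    rewrite -mulr_suml clock_sum // ler_piMl //; first exact: ltW.
  rewrite /Phi; move: hk hw hsum; lra.
Qed.

End Deterministic.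

(** * The filtered noise *)

Section NoiseFilter.
Context {R : realType} {n : nat}.
Variable theta : nat -> R.
Hypothesis theta_gt0 : forall k, 0 < theta k.
Hypothesis theta_div : series theta @ \oo --> +oo.
Hypothesis theta_cvg : null_seq theta.
Local Notation s := (series theta).
Local Notation wend := (window_end theta_gt0 theta_div).

(** Contribution of the noise at step [i] to the average at step [K]. *)
Definition filter_weight K i := theta i * \prod_(i.+1 <= l < K) (1 - theta l).

Variables (z nf : nat -> 'rV[R]_n) (M : R).
Hypothesis z_le : forall k, `|z k| <= M.
Hypothesis nfS : forall k, nf k.+1 = (1 - theta k) *: nf k + theta k *: z k.+1.

Let nf_expand k K : (k <= K)%N -> nf K = (\prod_(k <= l < K) (1 - theta l)) *: nf k +
  \sum_(k <= i < K) filter_weight K i *: z i.+1.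
Proof.
elim: K => [|K ih]; first by rewrite leqn0 => /eqP ->; rewrite !big_geq // scale1r addr0.
rewrite leq_eqVlt => /predU1P[->|]; first by rewrite !big_geq // scale1r addr0.
rewrite ltnS => kK; rewrite nfS (ih kK) !(big_nat_recr _ _ _ kK) /=.
rewrite scalerDr scalerA mulrC -addrA; congr (_ + (_ + _)).
  rewrite scaler_sumr !big_nat; apply: eq_bigr => i /andP[ki iK].
  rewrite scalerA /filter_weight (big_nat_recr _ _ _ iK) /=.
  by congr (_ *: _); ring.
by rewrite /filter_weight big_geq // mulr1.
Qed.

(** The inequality [(1 - t) * (1 + u + t) <= 1 + u] telescopes; it is a bound on the
    memory of the filter that avoids exponentials. *)
Let prod_le N k K : (forall i, (N <= i)%N -> theta i <= 1) -> (N <= k)%N -> (k <= K)%N ->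
  0 <= \prod_(k <= l < K) (1 - theta l) /\
  \prod_(k <= l < K) (1 - theta l) * (1 + (s K - s k)) <= 1.
Proof.
move=> hN Nk; elim: K => [|K ih].
  by rewrite leqn0 => /eqP ->; rewrite big_geq // subrr addr0 mulr1.
rewrite leq_eqVlt => /predU1P[->|].
  by rewrite big_geq // subrr addr0 mulr1.
rewrite ltnS => kK; have [p0 p1] := ih kK; rewrite (big_nat_recr _ _ _ kK) /= clockS.
have t1 := hN K (leq_trans Nk kK); have t0 := theta_gt0 K.
have u0 : 0 <= s K - s k by rewrite subr_ge0 clock_le.
move: p0 p1 u0; set p := \prod_(_ <= _ < _) _; set u := s K - s k => p0 p1 u0.
split; first by rewrite mulr_ge0 // subr_ge0.
have -> : s K + theta K - s k = u + theta K by rewrite /u; ring.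
have pu : p <= 1.
  by apply: le_trans p1; rewrite -[leLHS]mulr1 ler_wpM2l // lerDl.
have : p * theta K <= theta K by rewrite ler_piMl // ltW.
nra.
Qed.

(** Over a long window the old noise is forgotten and the new one is the weighted
    sum; every late step is close to the end of such a window. *)
Lemma noise_filter_cvg0 :
  (forall (j : nat) e, 0 < e -> \forall k \near \oo,
     `|\sum_(k <= i < wend j%:R k) filter_weight (wend j%:R k) i *: z i.+1| <= e) ->
  forall e, 0 < e -> \forall k \near \oo, `|nf k| <= e.
Proof.
move=> hz e e0.
have [B hB] : exists B, forall k, `|nf k| <= B.
  apply: (@averaging_bounded R n theta nf (fun k => z k.+1) M) => // k; exact: ltW.
have B0 : 0 <= B := le_trans (normr_ge0 _) (hB 0%N).
have M0 : 0 <= M := le_trans (normr_ge0 _) (z_le 0%N).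
have nf_lip k : `|nf k.+1 - nf k| <= (M + B) * theta k.
  have -> : nf k.+1 - nf k = theta k *: (z k.+1 - nf k).
    by rewrite nfS; apply/rowP => i; rewrite !mxE; ring.
  rewrite normrZ gtr0_norm // mulrC ler_wpM2r //; first exact: ltW.
  by rewrite (le_trans (ler_normB _ _)) // lerD.
have e3 : 0 < e / 3 by rewrite divr_gt0.
(* Long enough for the memory of the filter to reduce [B] to [e / 3]. *)
pose j := (Num.truncn (2 * (B / (e / 3)))).+1.
have jB : B <= (e / 3) * (1 + j%:R / 2).
  have : 2 * (B / (e / 3)) < j%:R by exact: truncnS_gt.
  rewrite mulrA ltr_pdivrMr // => h; move: h e3; set c := e / 3; set t := j%:R; nra.
have j0 : 0 < j%:R :> R by rewrite ltr0n.
have MB : 0 < M + B + 1 by rewrite ltr_wpDl // addr_ge0.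
pose e' := e / 3 / (M + B + 1) / 2.
have e'0 : 0 < e' by rewrite !divr_gt0.
have [N1 _ hN1] := (null_seqP theta).1 theta_cvg 1 ltr01.
have [N2 _ hN2] := (null_seqP theta).1 theta_cvg _ e'0.
have [N3 _ hN3] := hz j _ e3.
have [N4 _ hN4] := window_length_ge theta_gt0 theta_div theta_cvg j0.
pose N := maxn (maxn N1 N2) (maxn N3 N4).
have h1 i : (N <= i)%N -> theta i <= 1.
  move=> Ni; rewrite -[theta i]gtr0_norm //; apply: hN1.
  by apply: leq_trans Ni; rewrite /N -maxnA leq_maxl.
have h2 i : (N <= i)%N -> theta i <= e'.
  move=> Ni; rewrite -[theta i]gtr0_norm //; apply: hN2.
  by apply: leq_trans Ni; rewrite /N -maxnA maxnCA leq_maxl.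
have [N5 _ hN5] : \forall K \near \oo, s N + j%:R <= s K.
  by move/cvgryPge : theta_div; apply.
exists N5 => // K /hN5 /= hK.
pose k := clock_index theta_gt0 theta_div (s K - j%:R).
have Nk : (N <= k)%N by apply: clock_index_ge; rewrite lerBrDr.
have t0 : 0 <= s K - j%:R.
  by rewrite subr_ge0 (le_trans _ hK) // lerDr (clock_ge0 theta_gt0).
have k1 : s k <= s K - j%:R by apply: clock_index_le.
have k2 : s K - j%:R < s k + theta k by rewrite -clockS clock_index_lt.
pose L := wend j%:R k.
have kL : (k <= L)%N by apply: window_end_ge; exact: ltW.
have L1 : s L - s k <= j%:R by apply: window_length_le; exact: ltW.
have L2 : s k + j%:R < s L + theta L by rewrite -clockS clock_index_lt.
have L3 : j%:R / 2 <= s L - s k.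
  apply: hN4; apply: leq_trans Nk; rewrite /N.
  by rewrite [maxn N3 N4]maxnC maxnA leq_max; rewrite leq_max; rewrite leqnn orbT.
have d1 : `|nf K - nf L| <= e / 3.
  rewrite (le_trans (q_dist theta_gt0 nf_lip L K)) //.
  have -> : e / 3 = (M + B + 1) * (e' + e').
    by rewrite /e'; field; rewrite gt_eqF.
  apply: ler_pM => //; rewrite ?addr_ge0 // ?lerDl //.
  have := h2 k Nk; have := h2 L (leq_trans Nk kL).
  by move=> a1 a2; rewrite ler_norml; apply/andP; split; move: k1 k2 L1 L2 a1 a2 e'0; lra.
have d2 : `|nf L| <= e / 3 + e / 3.
  rewrite (nf_expand kL) (le_trans (ler_normD _ _)) // lerD //.
    have [p0 p1] := prod_le h1 Nk kL.
    rewrite normrZ (ger0_norm p0).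
    have j2 : 0 < 1 + j%:R / 2 :> R by rewrite ltr_wpDr // divr_ge0.
    rewrite -(ler_pM2r j2); apply: (@le_trans _ _ B) => //.
    rewrite mulrAC; apply: (@le_trans _ _ (1 * `|nf k|)); last by rewrite mul1r.
    rewrite ler_wpM2r // (le_trans _ p1) // ler_wpM2l // lerD2l //.
  apply: hN3; apply: leq_trans Nk; rewrite /N.
  by rewrite maxnA leq_max; rewrite leq_max leqnn orbT.
have -> : nf K = (nf K - nf L) + nf L by rewrite subrK.
rewrite (le_trans (ler_normD _ _)) // (le_trans (lerD d1 d2)) //.
by rewrite le_eqVlt; apply/orP; left; apply/eqP; field.
Qed.
End NoiseFilter.

(** * Expectations of bounded variables *)

Section BoundedVariables.
Context {d : measure_display} {T : measurableType d} {R : realType}.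
Variable P : probability T R.
Implicit Types X Y Z : T -> R.

Definition bounded_rv X := measurable_fun setT X /\ exists M, forall w, `|X w| <= M.

Local Notation "''E' X" := (\int[P]_w X w) (at level 10, X at level 9).

Lemma bounded_rv_integrable X : bounded_rv X -> P.-integrable setT (EFin \o X).
Proof.
move=> [mX [M hM]]; apply: measurable_bounded_integrable => //.
  by rewrite (@le_lt_trans _ _ 1%:E) ?ltry // probability_le1.
exists M; split; first exact: num_real.
by move=> y My w _ /=; rewrite (le_trans (hM w)) // ltW.
Qed.

Lemma bounded_rvD X Y : bounded_rv X -> bounded_rv Y -> bounded_rv (fun w => X w + Y w).
Proof.
move=> [mX [M hM]] [mY [N hN]]; split; first exact: measurable_funD.
by exists (M + N) => w; rewrite (le_trans (ler_normD _ _)) // lerD.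
Qed.

Lemma bounded_rvM X Y : bounded_rv X -> bounded_rv Y -> bounded_rv (fun w => X w * Y w).
Proof.
move=> [mX [M hM]] [mY [N hN]]; split; first exact: measurable_funM.
by exists (M * N) => w; rewrite normrM ler_pM.
Qed.

Lemma bounded_rv_cst (c : R) : bounded_rv (fun=> c).
Proof. by split; [exact: measurable_cst|exists `|c|]. Qed.

Lemma bounded_rv_indic (A : set T) : measurable A -> bounded_rv \1_A.
Proof.
move=> mA; split; first exact: measurable_indic.
exists 1 => w; rewrite indicE; by case: (w \in A); rewrite ?normr1 ?normr0.
Qed.

Lemma bounded_rv_sum (I : Type) (s : seq I) (X : I -> T -> R) :
  (forall i, bounded_rv (X i)) -> bounded_rv (fun w => \sum_(i <- s) X i w).
Proof.
move=> hX; elim: s => [|i s ih].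
  rewrite (_ : (fun w => _) = fun=> 0); first exact: bounded_rv_cst.
  by apply/funext => w; rewrite big_nil.
rewrite (_ : (fun w => _) = fun w => X i w + \sum_(j <- s) X j w).
  exact: bounded_rvD.
by apply/funext => w; rewrite big_cons.
Qed.

Lemma bounded_rv_exp X : bounded_rv X -> bounded_rv (fun w => expR (X w)).
Proof.
move=> [mX [M hM]]; split; first exact: measurableT_comp.
exists (expR M) => w; rewrite ger0_norm ?expR_ge0 // ler_expR.
by rewrite (le_trans (ler_norm _)).
Qed.

Lemma expectD X Y : bounded_rv X -> bounded_rv Y ->
  'E (fun w => X w + Y w) = 'E X + 'E Y.
Proof. by move=> hX hY; rewrite RintegralD //; exact: bounded_rv_integrable. Qed.

Lemma expectZ (c : R) X : bounded_rv X -> 'E (fun w => c * X w) = c * 'E X.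
Proof. by move=> hX; rewrite RintegralZl //; exact: bounded_rv_integrable. Qed.

Lemma le_expect X Y : bounded_rv X -> bounded_rv Y -> (forall w, X w <= Y w) ->
  'E X <= 'E Y.
Proof. by move=> hX hY h; apply: le_Rintegral => //; exact: bounded_rv_integrable. Qed.

Lemma expect_cst (c : R) : 'E (fun=> c) = c.
Proof. by rewrite Rintegral_cst // [X in fine X](@probability_setT _ _ _ P) mulr1. Qed.

Lemma expect_sum (I : Type) (s : seq I) (X : I -> T -> R) :
  (forall i, bounded_rv (X i)) ->
  'E (fun w => \sum_(i <- s) X i w) = \sum_(i <- s) 'E (X i).
Proof.
move=> hX; elim: s => [|i s ih].
  rewrite big_nil -[RHS](expect_cst 0); apply: eq_Rintegral => w _; by rewrite big_nil.
rewrite big_cons -ih -expectD //; last exact: bounded_rv_sum.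
by apply: eq_Rintegral => w _; rewrite big_cons.
Qed.

Lemma expect_indic X (A : set T) : measurable A ->
  'E (fun w => \1_A w * X w) = \int[P]_(w in A) X w.
Proof.
move=> mA; rewrite [RHS]Rintegral_mkcond; apply: eq_Rintegral => w _.
by rewrite patchE indicE; case: (w \in A); rewrite ?mul1r ?mul0r.
Qed.

Variable G : set_system T.
Hypothesis G_sigma : sigma_algebra setT G.
Hypothesis G_meas : G `<=` measurable.

Lemma measurable_wrtP X : measurable_wrt G X <->
  measurable_fun [set: g_sigma_algebraType G] (X : g_sigma_algebraType G -> R).
Proof.
have GE : @measurable _ (g_sigma_algebraType G) = G by exact: sigma_algebra_id.
split=> [h _ B mB|h B mB]; first by rewrite GE setTI; exact: h.
by have := h measurableT B mB; rewrite GE setTI.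
Qed.

Lemma measurable_wrt_measurable X : measurable_wrt G X -> measurable_fun setT X.
Proof. by move=> h _ B mB; rewrite setTI; apply: G_meas; exact: h. Qed.

(** Layer-cake approximation: a nonnegative number is, up to one, the number of
    integer levels below it. *)
Let layer_cake (u : R) (J : nat) : 0 <= u -> u <= J%:R ->
  `|u - \sum_(j < J) (j.+1%:R <= u)%R%:R| <= 1.
Proof.
move=> u0; elim: J => [|J ih] uJ.
  by rewrite big_ord0 subr0 ger0_norm // (le_trans uJ).
have [uJ'|Ju] := leP u J%:R.
  have uF : (J.+1%:R <= u) = false.
    by apply/negbTE; rewrite -ltNge (le_lt_trans uJ') // ltr_nat.
  by rewrite big_ord_recr /= uF addr0 ih.
have -> : \sum_(j < J.+1) (j.+1%:R <= u)%R%:R = J%:R + (J.+1%:R <= u)%R%:R :> R.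
  rewrite big_ord_recr /=; congr (_ + _).
  rewrite (eq_bigr (fun=> 1)) ?sumr_const ?card_ord // => j _.
  by rewrite (le_trans _ (ltW Ju)) // ler_nat.
have [J1|J1] := leP J.+1%:R u.
  have -> : u = J.+1%:R by apply/eqP; rewrite eq_le uJ J1.
  by rewrite -natr1 subrr normr0.
rewrite addr0 ger0_norm; first by rewrite lerBlDl natr1 ltW.
by rewrite subr_ge0 ltW.
Qed.

(** A bounded variable that integrates to zero over every event of [G] is
    orthogonal to the bounded nonnegative [G]-measurable variables [Z], as these are
    uniform limits of combinations of indicators of the events [j.+1 <= N * Z]. *)
Lemma expect_orthogonal X Z (M B : R) : measurable_fun setT X -> (forall w, `|X w| <= M) ->
  (forall A, G A -> \int[P]_(w in A) X w = 0) ->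
  measurable_wrt G Z -> (forall w, 0 <= Z w <= B) ->
  'E (fun w => Z w * X w) = 0.
Proof.
move=> mX XM X0 GZ ZB.
have bX : bounded_rv X by split => //; exists M.
have bZ : bounded_rv Z.
  split; first exact: measurable_wrt_measurable.
  by exists B => w; have /andP[h1 h2] := ZB w; rewrite ger0_norm.
have M0 : 0 <= M := le_trans (normr_ge0 _) (XM point).
apply/eqP; rewrite -normr_eq0 eq_le normr_ge0 andbT.
apply/ler_addgt0Pr => e e0; rewrite add0r.
have e2 : 0 < e / (M + 1) by rewrite divr_gt0 // ltr_wpDl.
pose N := (Num.truncn ((e / (M + 1))^-1)).+1.
have N0 : 0 < N%:R :> R by rewrite ltr0n.
have Ne : N%:R^-1 <= e / (M + 1).
  by rewrite -[leRHS]invrK lef_pV2 ?posrE ?invr_gt0 // ltW // truncnS_gt.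
pose J := (Num.truncn (N%:R * B)).+1.
pose A (j : nat) := [set w | j.+1%:R <= N%:R * Z w].
have GA j : G (A j).
  have -> : A j = Z @^-1` `[(j.+1%:R / N%:R), +oo[%classic.
    by apply/seteqP; split => w /=; rewrite in_itv /= andbT ler_pdivrMr // mulrC.
  by apply: GZ; exact: measurable_itv.
have mA j : measurable (A j) by apply: G_meas.
pose Z' w : R := N%:R^-1 * \sum_(j < J) \1_(A j) w.
have bS : bounded_rv (fun w => \sum_(j < J) \1_(A j) w).
  by apply: bounded_rv_sum => j; exact: bounded_rv_indic.
have bZ' : bounded_rv Z' by apply: bounded_rvM => //; exact: bounded_rv_cst.
have close w : `|Z w - Z' w| <= N%:R^-1.
  have /andP[h1 h2] := ZB w.
  have -> : Z w - Z' w = N%:R^-1 * (N%:R * Z w - \sum_(j < J) \1_(A j) w).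
    by rewrite mulrBr mulKf ?gt_eqF.
  rewrite normrM gtr0_norm ?invr_gt0 // ler_piMr ?invr_ge0 //.
  rewrite (eq_bigr (fun j : 'I_J => (j.+1%:R <= N%:R * Z w)%R%:R)); last first.
    by move=> j _; rewrite indicE; congr ((nat_of_bool _)%:R); apply/idP/idP => /=; rewrite inE.
  apply: layer_cake; first by rewrite mulr_ge0.
  by rewrite (@le_trans _ _ (N%:R * B)) ?ler_wpM2l // ltW // truncnS_gt.
have E0 : 'E (fun w => Z' w * X w) = 0.
  have -> : 'E (fun w => Z' w * X w) =
      'E (fun w => N%:R^-1 * \sum_(j < J) (\1_(A j) w * X w)).
    by apply: eq_Rintegral => w _; rewrite /Z' -mulrA mulr_suml.
  have bAX (j : 'I_J) : bounded_rv (fun w => \1_(A j) w * X w).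
    by apply: bounded_rvM => //; exact: bounded_rv_indic.
  rewrite expectZ; last exact: bounded_rv_sum.
  rewrite expect_sum // big1 ?mulr0 // => j _.
  by rewrite expect_indic // X0.
have -> : 'E (fun w => Z w * X w) = 'E (fun w => (Z w - Z' w) * X w).
  have -> : 'E (fun w => (Z w - Z' w) * X w) =
      'E (fun w => Z w * X w + (-1) * (Z' w * X w)).
    by apply: eq_Rintegral => w _; ring.
  rewrite expectD ?expectZ ?E0 ?mulr0 ?addr0 //; try exact: bounded_rvM.
  by apply: bounded_rvM; [exact: bounded_rv_cst|exact: bounded_rvM].
have bD : bounded_rv (fun w => (Z w - Z' w) * X w).
  apply: bounded_rvM => //; apply: bounded_rvD => //.
  rewrite (_ : (fun w => - Z' w) = fun w => (-1) * Z' w); last by apply/funext => w; rewrite mulN1r.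
  by apply: bounded_rvM => //; exact: bounded_rv_cst.
rewrite (le_trans (le_normr_Rintegral _ (bounded_rv_integrable bD))) //.
have bN : bounded_rv (fun w => `|(Z w - Z' w) * X w|).
  have [mD [C hC]] := bD; split; first exact: measurableT_comp.
  by exists C => w; rewrite normr_id.
apply: (@le_trans _ _ ('E (fun=> N%:R^-1 * M))).
  apply: le_expect => //; first exact: bounded_rv_cst.
  by move=> w; rewrite normrM ler_pM.
rewrite expect_cst (@le_trans _ _ (e / (M + 1) * M)) ?ler_wpM2r //.
rewrite mulrAC ler_pdivrMr ?ltr_wpDl // ler_pM2l //.
by rewrite lerDl.
Qed.

End BoundedVariables.

(** * Exponential tails of weighted martingale sums *)

(** From [1 - u <= expR (- u)]. *)
Lemma expR_le_quadratic (R : realType) (u : R) : `|u| <= 1 / 2 ->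
  expR u <= 1 + u + 2 * u ^+ 2.
Proof.
rewrite ler_norml => /andP[u1 u2].
have h : 1 - u <= expR (- u) by exact: expR_ge1Dx.
have u0 : 0 < 1 - u by lra.
have -> : expR u = (expR (- u))^-1 by rewrite expRN invrK.
apply: (@le_trans _ _ (1 - u)^-1); first by rewrite lef_pV2 ?posrE ?expR_gt0.
rewrite -[leLHS]mul1r ler_pdivrMr //.
have : 0 <= u ^+ 2 * (1 - 2 * u) by rewrite mulr_ge0 ?sqr_ge0 //; lra.
lra.
Qed.

Section MartingaleTail.
Context {d : measure_display} {T : measurableType d} {R : realType}.
Variables (P : probability T R) (F : nat -> set_system T) (xi : nat -> T -> R) (M : R).
Hypothesis filF : filtration F.
Hypothesis xi_adapted : forall k, measurable_wrt (F k) (xi k).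
Hypothesis xi_le : forall k w, `|xi k w| <= M.
Hypothesis xi_centered : forall k A, F k A -> \int[P]_(w in A) xi k.+1 w = 0.

Local Notation "''E' X" := (\int[P]_w X w) (at level 10, X at level 9).

Let M0 : 0 <= M. Proof. exact: le_trans (normr_ge0 _) (xi_le 0 point). Qed.

Let xi_meas k : measurable_fun setT (xi k).
Proof. by case: filF => _ Fm _; apply: (measurable_wrt_measurable (Fm k)). Qed.

Let xi_brv k : bounded_rv (xi k).
Proof. by split => //; exists M. Qed.

Let partial_sum (c : nat -> R) k K w := \sum_(k <= i < K) c i * xi i.+1 w.

Let partial_sum_brv c k K : bounded_rv (partial_sum c k K).
Proof. by apply: bounded_rv_sum => i; apply: bounded_rvM => //; exact: bounded_rv_cst. Qed.

Let partial_sum_adapted c k K : measurable_wrt (F K) (partial_sum c k K).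
Proof.
case: filF => Fs _ Fmono; apply/(measurable_wrtP (Fs K)).
rewrite /partial_sum (_ : (fun w => _) = fun w => \sum_(k <= i < K | (i < K)%N) c i * xi i.+1 w).
  have -> : (fun w => \sum_(k <= i < K | (i < K)%N) c i * xi i.+1 w) =
     fun w => \sum_(i <- index_iota k K) (if (i < K)%N then c i * xi i.+1 w else 0).
    by apply/funext => w; rewrite big_mkcond.
  apply: measurable_sum => i; case: (ltnP i K) => iK; last exact: measurable_cst.
  apply: measurable_funM; first exact: measurable_cst.
  apply/(measurable_wrtP (Fs K)) => B mB; apply: (Fmono i.+1) => //.
  exact: xi_adapted.
by apply/funext => w; rewrite big_nat_cond [in RHS]big_nat_cond; apply: eq_bigl => i; rewrite andbT -andbA andbb.
Qed.

(** Expanding the exponential of the last increment to second order, the linear term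
    is orthogonal to the past and the quadratic one gives a factor
    [1 + 2 * (l * c K * M) ^+ 2]. *)
Lemma exponential_moment (l : R) (c : nat -> R) k K : (k <= K)%N ->
  (forall i, (k <= i < K)%N -> `|l * c i| * M <= 1 / 2) ->
  'E (fun w => expR (l * partial_sum c k K w)) <=
  expR (2 * l ^+ 2 * M ^+ 2 * \sum_(k <= i < K) c i ^+ 2).
Proof.
elim: K => [|K ih].
  rewrite leqn0 => /eqP -> _; rewrite big_geq // mulr0 expR0.
  rewrite -[leRHS](expect_cst P 1) le_eqVlt; apply/orP; left; apply/eqP.
  by apply: eq_Rintegral => w _; rewrite /partial_sum big_geq // mulr0 expR0.
rewrite leq_eqVlt => /predU1P[<- _|].
  rewrite big_geq // mulr0 expR0.
  rewrite -[leRHS](expect_cst P 1) le_eqVlt; apply/orP; left; apply/eqP.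
  by apply: eq_Rintegral => w _; rewrite /partial_sum big_geq // mulr0 expR0.
rewrite ltnS => kK small.
have {}ih : 'E (fun w => expR (l * partial_sum c k K w)) <=
    expR (2 * l ^+ 2 * M ^+ 2 * \sum_(k <= i < K) c i ^+ 2).
  by apply: (ih kK) => i /andP[ki iK]; apply: small; rewrite ki ltnS ltnW.
have lK : `|l * c K| * M <= 1 / 2 by apply: small; rewrite kK ltnSn.
pose Y w := expR (l * partial_sum c k K w).
have bY : bounded_rv Y.
  by apply: bounded_rv_exp; apply: bounded_rvM => //; exact: bounded_rv_cst.
have [mY [B hB]] := bY.
have Y0 : 'E (fun w => Y w * xi K.+1 w) = 0.
  case: filF => Fs Fm _.
  apply: (@expect_orthogonal _ _ _ P (F K) (Fm K) _ _ M B) => //.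
  - by move=> A; exact: xi_centered.
  - apply/(measurable_wrtP (Fs K)); apply: measurableT_comp => //.
    apply: measurable_funM; first exact: measurable_cst.
    exact/(measurable_wrtP (Fs K)).
  - by move=> w; rewrite expR_ge0 /= (le_trans (ler_norm _)).
pose v := 2 * l ^+ 2 * M ^+ 2 * c K ^+ 2.
have v0 : 0 <= v by do 2 (apply: mulr_ge0; last exact: sqr_ge0); rewrite mulr_ge0 ?sqr_ge0.
have step : 'E (fun w => expR (l * partial_sum c k K.+1 w)) <=
    'E (fun w => (1 + v) * Y w + (l * c K) * (Y w * xi K.+1 w)).
  apply: le_expect.
  - by apply: bounded_rv_exp; apply: bounded_rvM => //; exact: bounded_rv_cst.
  - apply: bounded_rvD; apply: bounded_rvM; try exact: bounded_rv_cst; try exact: bY.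
    exact: bounded_rvM.
  move=> w; have -> : expR (l * partial_sum c k K.+1 w) =
      Y w * expR (l * c K * xi K.+1 w).
    by rewrite /Y -expRD /partial_sum big_nat_recr //= mulrDr mulrA.
  have -> : (1 + v) * Y w + (l * c K) * (Y w * xi K.+1 w) =
     Y w * (1 + l * c K * xi K.+1 w + v) by ring.
  rewrite ler_wpM2l ?expR_ge0 //.
  have ub : `|l * c K * xi K.+1 w| <= 1 / 2.
    by rewrite normrM (le_trans _ lK) // ler_wpM2l.
  apply: (le_trans (expR_le_quadratic ub)); rewrite lerD2l.
  have -> : v = 2 * (l * c K) ^+ 2 * M ^+ 2 by rewrite /v; ring.
  have xM : xi K.+1 w ^+ 2 <= M ^+ 2.
    by rewrite -(real_normK (num_real (xi K.+1 w))) ler_pXn2r ?nnegrE.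
  have -> : 2 * (l * c K * xi K.+1 w) ^+ 2 = 2 * (l * c K) ^+ 2 * xi K.+1 w ^+ 2 by ring.
  by apply: ler_wpM2l => //; rewrite mulr_ge0 ?sqr_ge0.
apply: (le_trans step); rewrite expectD ?expectZ //; last 3 first.
- exact: bounded_rvM.
- by apply: bounded_rvM => //; exact: bounded_rv_cst.
- by apply: bounded_rvM; [exact: bounded_rv_cst|exact: bounded_rvM].
rewrite Y0 mulr0 addr0 big_nat_recr //= mulrDr expRD mulrC.
apply: ler_pM => //.
- by apply: Rintegral_ge0 => w _; exact: expR_ge0.
- by rewrite addr_ge0.
- exact: expR_ge1Dx.
Qed.

(** Markov's inequality for the exponential of the sum. *)
Lemma tail_bound (l r : R) (c : nat -> R) k K : 0 < l -> (k <= K)%N ->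
  (forall i, (k <= i < K)%N -> `|l * c i| * M <= 1 / 2) ->
  (P [set w | (r < partial_sum c k K w)%R] <=
   (expR (2 * l ^+ 2 * M ^+ 2 * (\sum_(k <= i < K) c i ^+ 2) - l * r))%:E)%E.
Proof.
move=> l0 kK small; set A := [set w | _].
have mA : measurable A.
  have [mS _] := partial_sum_brv c k K.
  rewrite (_ : A = partial_sum c k K @^-1` `]r, +oo[%classic).
    by rewrite -[X in measurable X]setTI; apply: mS => //; exact: measurable_itv.
  by apply/seteqP; split => w /=; rewrite in_itv /= andbT.
have EA : 'E \1_A = fine (P A) by rewrite /Rintegral integral_indic // setIT.
have PA : P A \is a fin_num by exact: fin_num_measure.
rewrite -(fineK PA) lee_fin -EA.
have bE : bounded_rv (fun w => expR (l * partial_sum c k K w)).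
  by apply: bounded_rv_exp; apply: bounded_rvM => //; exact: bounded_rv_cst.
apply: (@le_trans _ _ ('E (fun w => expR (- (l * r)) * expR (l * partial_sum c k K w)))).
  apply: le_expect; first exact: bounded_rv_indic.
    by apply: bounded_rvM => //; exact: bounded_rv_cst.
  move=> w; rewrite indicE; have [wA|wA] := boolP (w \in A).
    rewrite mulr1n -[leLHS]expR0 -expRD ler_expR addrC subr_ge0 ler_wpM2l ?(ltW l0) // ltW //.
    by move: wA; rewrite inE.
  by rewrite mulr_ge0 // expR_ge0.
rewrite expectZ // addrC expRD ler_wpM2l ?expR_ge0 //.
exact: exponential_moment.
Qed.

Variables (theta : nat -> R) (K : nat -> nat) (wt : nat -> nat -> R) (Tm : R).
Hypothesis theta_gt0 : forall k, 0 < theta k.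
Hypothesis theta_log : null_seq (fun k => theta k * ln k.+2%:R).
Hypothesis K_ge : forall k, (k <= K k)%N.
Hypothesis K_le : forall k, \sum_(k <= i < K k) theta i <= Tm.
Hypothesis wt_le : \forall k \near \oo, forall i, (k <= i < K k)%N -> `|wt k i| <= theta i.

Let Lg k : R := ln k.+2%:R.

Let Lg_gt0 k : 0 < Lg k. Proof. by rewrite ln_gt0 // ltr1n. Qed.

Let Lg_le k i : (k <= i)%N -> Lg k <= Lg i.
Proof. by move=> ki; rewrite ler_ln ?posrE ?ltr0n // ler_nat. Qed.

Let Tm0 : 0 <= Tm.
Proof. by apply: le_trans (K_le 0); apply: sumr_ge0 => i _; exact: ltW. Qed.

(** The tail bound is summable over all windows: with the exponential parameter
    proportional to [ln k], the bound is a negative power of [k] as soon as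
    [theta k * ln k] is small. *)
Let window_tail r : 0 < r -> exists N, forall k, (N <= k)%N ->
  (P [set w | (r < partial_sum (wt k) k (K k) w)%R] <= ((k.+2%:R ^+ 2)^-1)%:E)%E.
Proof.
move=> r0.
have m1 : 0 < M ^+ 2 + 1 by rewrite ltr_wpDl // sqr_ge0.
have t1 : 0 < Tm + 1 by rewrite ltr_wpDl.
have M1 : 0 < M + 1 by rewrite ltr_wpDl.
(* With the parameter [l = 3 * Lg k / r] the linear term of the exponent is [- 3 * Lg k].
   The first bound on [c] makes the quadratic term at most [Lg k], leaving
   [- 2 * Lg k]; the second one keeps every increment below [1 / 2]. *)
pose c := Num.min (r ^+ 2 / (18 * (M ^+ 2 + 1) * (Tm + 1))) (r / (6 * (M + 1))).
have c0 : 0 < c.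
  by rewrite lt_min; apply/andP; split; apply: divr_gt0 => //; rewrite ?exprn_gt0 ?mulr_gt0.
have c1 : c * (18 * (M ^+ 2 + 1) * (Tm + 1)) <= r ^+ 2.
  by rewrite -ler_pdivlMr ?mulr_gt0 // ge_min lexx.
have c2 : c * (6 * (M + 1)) <= r.
  by rewrite -ler_pdivlMr ?mulr_gt0 // ge_min lexx orbT.
have [N1 _ hN1] := (null_seqP _).1 theta_log _ c0.
have [N2 _ hN2] := wt_le.
exists (maxn N1 N2) => k; rewrite geq_max => /andP[N1k N2k].
have wk i := hN2 k N2k i.
have tL i : (k <= i)%N -> theta i * Lg k <= c.
  move=> ki; apply: (@le_trans _ _ (theta i * Lg i)).
    by rewrite ler_pM2l // Lg_le.
  by apply: le_trans (ler_norm _) _; apply: hN1; exact: leq_trans ki.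
pose l := 3 / r * Lg k.
have l0 : 0 < l by rewrite mulr_gt0 // divr_gt0.
have lr : l * r = 3 * Lg k by rewrite /l mulrAC divfK ?gt_eqF.
have small i : (k <= i < K k)%N -> `|l * wt k i| * M <= 1 / 2.
  move=> hi; have [ki _] := andP hi.
  rewrite normrM (gtr0_norm l0).
  have h1 : l * `|wt k i| <= 3 / r * c.
    rewrite /l -mulrA; apply: ler_wpM2l; first by rewrite divr_ge0 // ltW.
    by rewrite mulrC (le_trans _ (tL i ki)) // ler_wpM2r ?wk // ltW.
  apply: (@le_trans _ _ (3 / r * c * M)); first by rewrite ler_wpM2r.
  have -> : 3 / r * c * M = (3 * c * M) / r by ring.
  rewrite ler_pdivrMr //; have : 0 <= c by exact: ltW. move: c2 M0; nra.
have Lsum : Lg k * \sum_(k <= i < K k) wt k i ^+ 2 <= c * Tm.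
  apply: (@le_trans _ _ (\sum_(k <= i < K k) c * theta i)).
    rewrite mulr_sumr !big_nat; apply: ler_sum => i hi; have [ki _] := andP hi.
    have ww : wt k i ^+ 2 <= theta i ^+ 2.
      by rewrite -(real_normK (num_real (wt k i))) ler_pXn2r ?nnegrE ?wk // ltW.
    apply: (@le_trans _ _ (Lg k * theta i ^+ 2)); first by rewrite ler_wpM2l // ltW.
    by rewrite expr2 mulrA [Lg k * _]mulrC ler_pM2r // tL.
  by rewrite -mulr_sumr ler_wpM2l // ltW.
apply: (le_trans (tail_bound r l0 (K_ge k) small)); rewrite lee_fin.
have kpos : 0 < k.+2%:R :> R by rewrite ltr0n.
have -> : (k.+2%:R ^+ 2)^-1 = expR (- (2 * Lg k)) :> R.
  by rewrite expRN expRM_natl lnK ?posrE.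
rewrite ler_expR lr.
suff : 2 * l ^+ 2 * M ^+ 2 * (\sum_(k <= i < K k) wt k i ^+ 2) <= Lg k by lra.
have -> : 2 * l ^+ 2 * M ^+ 2 * (\sum_(k <= i < K k) wt k i ^+ 2) =
  Lg k * (18 * M ^+ 2 * (Lg k * \sum_(k <= i < K k) wt k i ^+ 2) / r ^+ 2).
  by rewrite /l; field; rewrite gt_eqF.
rewrite ler_piMr ?(ltW (Lg_gt0 k)) // ler_pdivrMr ?exprn_gt0 // mul1r.
apply: (@le_trans _ _ (18 * M ^+ 2 * (c * Tm))).
  by rewrite ler_wpM2l // mulr_ge0 // sqr_ge0.
apply: le_trans c1.
have -> : c * (18 * (M ^+ 2 + 1) * (Tm + 1)) =
  18 * M ^+ 2 * (c * Tm) + c * (18 * (M ^+ 2 + 1 + Tm)) by ring.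
rewrite lerDl; apply: mulr_ge0; first exact: ltW.
by apply: mulr_ge0 => //; apply: addr_ge0 => //; exact: ltW.
Qed.

Let sum_inv_sqr m : \sum_(0 <= k < m) (k.+2%:R ^+ 2)^-1 <= 1 - m.+1%:R^-1 :> R.
Proof.
elim: m => [|m ih]; first by rewrite big_geq // invr1 subrr.
rewrite big_nat_recr //=; apply: (le_trans (lerD ih (lexx _))).
have a0 : 0 < m.+1%:R :> R by rewrite ltr0n.
have -> : m.+2%:R = m.+1%:R + 1 :> R by rewrite -natr1.
set a := m.+1%:R in a0 *.
have a1 : 0 < a + 1 by rewrite addr_gt0.
rewrite -subr_ge0 (_ : _ - _ = (a * (a + 1) ^+ 2)^-1).
  by rewrite invr_ge0 mulr_ge0 ?sqr_ge0 // ltW.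
by field; rewrite !gt_eqF.
Qed.

Let sum_inv_sqr_le1 m : \sum_(0 <= k < m) (k.+2%:R ^+ 2)^-1 <= 1 :> R.
Proof. by apply: (le_trans (sum_inv_sqr m)); rewrite lerBlDr lerDl invr_ge0. Qed.

(** The tails of [window_tail] are summable in the starting index of the window, so
    almost surely only finitely many windows exceed [r]. *)
Lemma window_sums_eventually_le r : 0 < r ->
  {ae P, forall w, \forall k \near \oo, \sum_(k <= i < K k) wt k i * xi i.+1 w <= r}.
Proof.
move=> r0; have [N hN] := window_tail r0.
pose A k := if (N <= k)%N then [set w | r < partial_sum (wt k) k (K k) w] else set0.
have mA k : measurable (A k).
  rewrite /A; case: ifP => // _.
  have [mS _] := partial_sum_brv (wt k) k (K k).
  rewrite (_ : [set w | _] = partial_sum (wt k) k (K k) @^-1` `]r, +oo[%classic).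
    by rewrite -[X in measurable X]setTI; apply: mS => //; exact: measurable_itv.
  by apply/seteqP; split => w /=; rewrite in_itv /= andbT.
have PA k : (P (A k) <= ((k.+2%:R ^+ 2)^-1)%:E)%E.
  rewrite /A; case: ifP => [Nk|_]; first exact: hN.
  by rewrite measure0 lee_fin invr_ge0 sqr_ge0.
have fin : (\sum_(n <oo) P (A n) < +oo)%E.
  apply: (@le_lt_trans _ _ 1%E); last exact: ltry.
  apply: lime_le; first exact: is_cvg_nneseries.
  apply: nearW => m; apply: (@le_trans _ _ (\sum_(0 <= k < m) (((k.+2%:R ^+ 2)^-1 : R)%:E))%E).
    exact: lee_sum.
  by rewrite sumEFin lee_fin; exact: sum_inv_sqr_le1.
have PN := lim_sup_set_cvg0 mA fin.
exists (lim_sup_set A); split => //.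
  apply: bigcap_measurable => // k _; exact: bigcup_measurable.
move=> w /= nw n _; apply: contrapT => h; apply: nw.
exists (maxn n N) => // k /=; rewrite geq_max => /andP[nk Nk].
rewrite leNgt; apply/negP => rk; apply: h; exists k => //.
by rewrite /A Nk.
Qed.

End MartingaleTail.

(** * The filtered noise vanishes almost surely *)

Section NoiseNull.
Context {d : measure_display} {T : measurableType d} {R : realType} {n : nat}.
Variables (P : probability T R) (F : nat -> set_system T).
Hypothesis filF : filtration F.
Variable theta : nat -> R.
Hypothesis theta_gt0 : forall k, 0 < theta k.
Hypothesis theta_log : null_seq (fun k => theta k * ln k.+2%:R).

Lemma window_sums_ae_null (xi : nat -> T -> R) (M Tm : R) (K : nat -> nat) (wt : nat -> nat -> R) :
  (forall k, measurable_wrt (F k) (xi k)) -> (forall k w, `|xi k w| <= M) ->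
  (forall k A, F k A -> \int[P]_(w in A) xi k.+1 w = 0) ->
  (forall k, (k <= K k)%N) -> (forall k, \sum_(k <= i < K k) theta i <= Tm) ->
  (\forall k \near \oo, forall i, (k <= i < K k)%N -> `|wt k i| <= theta i) ->
  {ae P, forall w, null_seq (fun k => \sum_(k <= i < K k) wt k i * xi i.+1 w)}.
Proof.
move=> xiF xiM xi0 K_ge K_le wt_le.
have jr (j : nat) : 0 < j.+1%:R^-1 :> R by rewrite invr_gt0.
have up j := window_sums_eventually_le filF xiF xiM xi0 theta_gt0 theta_log K_ge K_le wt_le (jr j).
have wtN_le : \forall k \near \oo, forall i, (k <= i < K k)%N -> `|- wt k i| <= theta i.
  by apply: filterS wt_le => k h i; rewrite normrN; exact: h.
have dn j := window_sums_eventually_le filF xiF xiM xi0 theta_gt0 theta_log K_ge K_le wtN_le (jr j).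
have := ae_foralln up; have := ae_foralln dn.
apply: filterS2 => w hdn hup; apply/null_seqP => e e0.
have [j je] : exists j : nat, j.+1%:R^-1 <= e.
  by have [j _ hj] := near_infty_natSinv_lt (PosNum e0); exists j; exact: ltW (hj j (leqnn _)).
apply: filterS2 (hdn j) (hup j) => k h1 h2.
rewrite ler_norml (le_trans h2 je) andbT lerNl (le_trans _ je) //.
rewrite -sumrN (le_trans _ h1) // le_eqVlt; apply/orP; left; apply/eqP.
by apply: eq_bigr => i _; rewrite mulNr.
Qed.

Lemma theta_null : null_seq theta.
Proof.
apply/null_seqP => e e0.
have l2 : 0 < ln 2%:R :> R by rewrite ln_gt0 // ltr1n.
apply: filterS ((null_seqP _).1 theta_log _ (mulr_gt0 e0 l2)) => k.
rewrite normrM [`|ln _|]ger0_norm ?ln_ge0 ?ler1n // => h.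
rewrite -(ler_pM2r l2) (le_trans _ h) // ler_wpM2l // ler_ln ?posrE ?ltr0n //.
by rewrite ler_nat.
Qed.

Variable xi : nat -> T -> 'rV[R]_n.
Hypothesis xi_bmd : bounded_martingale_difference P F xi.

Lemma noise_bounded : exists2 M, 0 <= M & {ae P, forall w, forall k, enorm (xi k w) <= M}.
Proof.
case: xi_bmd => _ _ [M hM]; exists (Num.max M 0); first by rewrite le_max lexx orbT.
by apply: filterS hM => w h k; rewrite le_max h.
Qed.

(** Truncating the coordinates changes them on a null set only, and makes the bound
    hold everywhere. *)
Lemma noise_window_sums_null (Tm : R) (K : nat -> nat) (wt : nat -> nat -> R) :
  (forall k, (k <= K k)%N) -> (forall k, \sum_(k <= i < K k) theta i <= Tm) ->
  (\forall k \near \oo, forall i, (k <= i < K k)%N -> `|wt k i| <= theta i) ->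
  {ae P, forall w, forall j : 'I_n, null_seq (fun k => \sum_(k <= i < K k) wt k i * xi i.+1 w 0 j)}.
Proof.
move=> K_ge K_le wt_le; have [M M0 hM] := noise_bounded.
case: xi_bmd => xiF xi0 _; case: (filF) => Fs Fm _.
apply: filter_forall => j.
pose clamp (a : R) := Num.max (- M) (Num.min M a).
have clamp_le a : `|clamp a| <= M.
  rewrite /clamp ler_norml le_max lexx /= ge_max ge_min lexx /= andbT.
  by rewrite (le_trans _ M0) // oppr_le0.
have clampE a : `|a| <= M -> clamp a = a.
  by rewrite ler_norml /clamp => /andP[a1 a2]; rewrite (min_idPr a2) (max_idPr a1).
have mclamp : measurable_fun setT clamp.
  by apply: measurable_maxr => //; exact: measurable_minr.
pose z k w := clamp (xi k w 0 j).
have zF k : measurable_wrt (F k) (z k).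
  move=> B mB; rewrite (_ : z k @^-1` B = (fun w => xi k w 0 j) @^-1` (clamp @^-1` B)) //.
  by apply: xiF; rewrite -[X in measurable X]setTI; exact: mclamp.
have zE : {ae P, forall w, forall k, z k w = xi k w 0 j}.
  apply: filterS hM => w h k; apply: clampE.
  by rewrite (le_trans (coord_le_norm _ _)) // (le_trans (norm_le_enorm _)).
have z0 k A : F k A -> \int[P]_(w in A) z k.+1 w = 0.
  move=> FA; have mA := Fm _ _ FA; case: (xi0 k j) => _ _ _ /(_ _ FA).
  rewrite integral0 => h; rewrite /Rintegral.
  rewrite (ae_eq_integral (fun w => (xi k.+1 w 0 j)%:E)) -?h //.
  - apply: measurable_funTS; apply/measurable_EFinP.
    exact: (measurable_wrt_measurable (Fm k.+1)).
  - apply: measurable_funTS; apply/measurable_EFinP.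
    exact: (measurable_wrt_measurable (Fm k.+1)).
  - by apply: filterS zE => w e _; rewrite e.
have := window_sums_ae_null zF (fun k w => clamp_le _) z0 K_ge K_le wt_le.
apply: filterS2 zE => w e; congr null_seq; apply/funext => k.
by apply: eq_bigr => i _; rewrite e.
Qed.

Hypothesis theta_div : series theta @ \oo --> +oo.

(** The output of the momentum filter when it is fed with the noise [z] alone. *)
Fixpoint noise_filter (z : nat -> 'rV[R]_n) (k : nat) : 'rV[R]_n :=
  if k is k'.+1 then (1 - theta k') *: noise_filter z k' + theta k' *: z k else 0.

(** Windows of every integer length are needed, since the length fixes how much of
    the past the filter forgets. *)
Theorem noise_filter_ae_null :
  {ae P, forall w i, null_seq (fun k => noise_filter (xi ^~ w) k 0 i)}.
Proof.
have [M M0 hM] := noise_bounded.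
have [N _ hN] := (null_seqP _).1 theta_null 1 ltr01.
have hN1 i : (N <= i)%N -> theta i <= 1.
  by move=> Ni; apply: le_trans (ler_norm _) (hN i Ni).
pose K (q : nat) := window_end theta_gt0 theta_div q%:R.
have main q : {ae P, forall w, forall j : 'I_n, null_seq (fun k =>
    \sum_(k <= i < K q k) filter_weight theta (K q k) i * xi i.+1 w 0 j)}.
  apply: (noise_window_sums_null (Tm := q%:R)).
  - by move=> k; apply: window_end_ge.
  - move=> k; rewrite clock_sum; last exact: window_end_ge.
    exact: window_length_le.
  - exists N => // k Nk i /andP[ki _].
    rewrite /filter_weight normrM (gtr0_norm (theta_gt0 i)) ger_pMr //.
    rewrite normr_prod big_nat; apply: prodr_ile1 => l /andP[il _].
    have t1 : theta l <= 1 by apply: hN1; exact: leq_trans (leq_trans Nk ki) (ltnW il).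
    by rewrite normr_ge0 /= ger0_norm ?subr_ge0 // gerBl; exact: ltW.
have := ae_foralln main.
apply: filterS2 hM => w xib h i; apply/null_seqP => e e0.
suff nf0 : \forall k \near \oo, `|noise_filter (xi ^~ w) k| <= e.
  by apply: filterS nf0 => k; apply: le_trans; exact: coord_le_norm.
have xiM k : `|xi k w| <= M by exact: le_trans (norm_le_enorm _) (xib k).
apply: (noise_filter_cvg0 (theta_gt0 := theta_gt0) (theta_div := theta_div) theta_null xiM
  (nf := noise_filter (xi ^~ w))) => // q e' e'0.
apply: null_coords e'0 => j; apply: (cvg_trans _ (h q j)).
apply: near_eq_cvg; apply: nearW => k.
by rewrite summxE; apply: eq_bigr => l _; rewrite mxE.
Qed.
End NoiseNull.

(** * The theorem *)

Lemma locally_lipschitz_continuous (R : realType) (n : nat) (f : 'rV[R]_n -> R) :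
  locally_lipschitz f -> continuous f.
Proof.
move=> fL x; have [U Ux] := fL x; rewrite /lipschitz_on => /pinfty_ex_gt0 [L L0 hL].
have FF : Filter (nbhs x) by exact: nbhs_filter.
suff : f z @[z --> x] --> f x by [].
apply/cvgrPdist_le => e e0.
have eL : 0 < e / L by exact: divr_gt0.
apply: filterS2 (Ux) (near_norm_lt x eL) => y Uy yx.
apply: (le_trans (hL (x, y) (conj (nbhs_singleton Ux) Uy))).
by rewrite mulrC -ler_pdivlMr //= distrC ltW.
Qed.

Lemma stepsize_logs (R : realType) (theta : nat -> R) : (forall k, 0 < theta k) ->
  (fun k => theta k * ln k%:R) @ \oo --> 0 -> null_seq (fun k => theta k * ln k.+2%:R).
Proof.
move=> t0 h.
have h2 : null_seq (fun k => 2 * (theta k * ln k%:R)).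
  by rewrite /null_seq -[X in _ --> X](mulr0 2); exact: cvgMr.
apply/null_seqP => e e0; apply: filterS2 (nbhs_infty_ge 2) ((null_seqP _).1 h2 e e0) => k k2.
have kp : 0 < k%:R :> R by rewrite ltr0n (leq_trans _ k2).
have l : ln k.+2%:R <= 2 * ln k%:R :> R.
  rewrite mulr_natl -lnXn // -natrX ler_ln ?posrE ?ltr0n ?expn_gt0 ?(leq_trans _ k2) //.
  by rewrite ler_nat (leq_trans _ (leq_mul k2 (leqnn k))) // mul2n -addnn -addn2 leq_add2l.
apply: le_trans; rewrite mulrCA !normrM ler_wpM2l //.
rewrite ger0_norm ?ln_ge0 ?ler1n // (le_trans l) //.
by rewrite -normrM ler_norm.
Qed.

Lemma reg_field_stationary (R : realType) (n : nat) (sigma : R)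
  (D : 'rV[R]_n -> set 'rV[R]_n) y : reg_field sigma D y 0 <-> D y (- sigma *: y).
Proof.
rewrite scaleNr; split=> [[u Du /eqP]|h]; first by rewrite addr_eq0 => /eqP <-.
by exists (- (sigma *: y)) => //; rewrite addNr.
Qed.

Theorem theorem4p8
  (disp : measure_display) (T : measurableType disp) (R : realType)
  (P : probability T R) (F : nat -> set_system T) (n : nat)
  (sigma : R) (f : 'rV[R]_n -> R) (Df : 'rV[R]_n -> set 'rV[R]_n)
  (x m v d xi : nat -> T -> 'rV[R]_n)
  (W : 'rV[R]_n * 'rV[R]_n -> 'rV[R]_n)
  (eta theta : R^nat) (eps tau1 tau2 : R)
  (g := reg_fun sigma f) (Dg := reg_field sigma Df)
  (gk := (fun k w => d k w + xi k.+1 w) : nat -> T -> 'rV[R]_n) :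
  0 < sigma -> locally_lipschitz f ->
  (* A1 *)
  path_differentiable f ->
  admits_conservative_field f Df -> (forall y, convex_set (Df y)) ->
  (* A2 *)
  [set g y | y in [set y | Dg y 0]]° = set0 ->
  (* A3 *)
  (-oo < ereal_inf (range (fun y => (g y)%:E)))%E ->
  (* framework *)
  filtration F ->
  (forall k, [/\ random_vector (x k), random_vector (m k),
                 random_vector (v k) & random_vector (d k)]) ->
  {ae P, forall w, AFMDW sigma (precond eps) eta theta
                     (gk ^~ w) (x ^~ w) (m ^~ w) (v ^~ w)} ->
  (* C1 *)
  (exists Mx : R, {ae P, forall w,
     enorm (m 0%N w) <= Mx /\ forall k, enorm (x k w) <= Mx}) ->
  (* C2 *)
  (forall p : 'rV[R]_n * 'rV[R]_n, bounded_near W (nbhs p)) -> (forall p i, 0 <= W p 0 i) ->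
  0 < tau2 ->
  {ae P, forall w, forall k,
     v k.+1 w = v k w - (tau2 * eta k) *: (v k w - W (gk k w, m k.+1 w))} ->
  (* C3 *)
  0 < eps ->
  (* C4 *)
  (forall k, 0 < eta k) -> (forall k, 0 < theta k) ->
  series theta @ \oo --> +oo ->
  (fun k => theta k * ln k%:R) @ \oo --> (0 : R) ->
  (fun k => theta k / eta k) @ \oo --> tau1 ->
  tau2 / 4 <= tau1 -> 0 < tau1 ->
  (* C5 *)
  (exists delta : R^nat, [/\ forall k, 0 <= delta k, delta @ \oo --> (0 : R) &
     {ae P, forall w, forall k, enlarge (delta k) Df (x k w) (d k w)}]) ->
  (* C6 *)
  bounded_martingale_difference P F xi ->
  {ae P, forall w,
    [/\ forall y, cluster ((x ^~ w) @ \oo) y -> stationary Dg y,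
        (fun k => enorm (m k w + sigma *: x k w)) @ \oo --> (0 : R) &
        cvgn (fun k => g (x k w))]}.
Proof.
move=> sigma0 f_lip _ [[closedD D0 _] potD] convD sard _ filF _ fw [Mx hMx] W_loc W_ge0
  tau20 vS eps0 eta0 theta0 theta_div theta_log ratio tau1_ge tau10 [delta [_ delta0 dD]] xi_bmd.
have theta_log2 := stepsize_logs theta0 theta_log.
have theta_null := theta_null theta_log2.
have [Mxi _ hMxi] := noise_bounded xi_bmd.
have nf_null := noise_filter_ae_null filF theta0 theta_log2 xi_bmd theta_div.
have f_cont := locally_lipschitz_continuous f_lip.
have D_loc (y : 'rV[R]_n) : exists B, \forall z \near y, forall u, Df z u -> `|u| <= B.
  by have [B _ hB] := locally_bounded_field closedD D0 convD potD f_lip y; exists B.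
have DgE : [set y | Dg y 0] = [set y | Df y (- sigma *: y)].
  by apply/seteqP; split => y /= /reg_field_stationary.
rewrite DgE in sard.
apply: filterS2 (filterI fw (filterI hMx vS)) (filterI dD (filterI hMxi nf_null)).
move=> w [{}fw [[_ xM] {}vS]] [{}dD [xiM nf0]].
pose nf := noise_filter theta (xi ^~ w).
have nfS k : nf k.+1 = (1 - theta k) *: nf k + theta k *: xi k.+1 w by [].
have [cl y0 gc] := deterministic_convergence sigma0 f_cont closedD D0 convD D_loc potD sard
  fw xM W_loc W_ge0 tau20 vS eps0 eta0 theta0 theta_div theta_null ratio tau1_ge tau10
  delta0 dD xiM nfS nf0.
split=> // [y /cl /reg_field_stationary Dy|]; first by move=> A [_ DA]; exact: DA.
have {}y0 e : 0 < e -> \forall k \near \oo, `|m k w - nf k + sigma *: x k w| <= e.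
  move=> e0; move/cvgrPdist_le : y0 => /(_ e e0); apply: filterS => k.
  by rewrite sub0r normrN.
apply/null_seqP => e e0.
(* [n.+1] instead of [n], as the dimension may be zero. *)
have N0 : 0 < 2 * n.+1%:R :> R by rewrite mulr_gt0.
have eN : 0 < e / (2 * n.+1%:R) by exact: divr_gt0.
apply: filterS2 (y0 _ eN) (null_coords nf0 eN) => k yk nk.
rewrite ger0_norm ?sqrtr_ge0 // (le_trans (enorm_le_norm _)) //.
have -> : m k w + sigma *: x k w = (m k w - nf k + sigma *: x k w) + nf k.
  by rewrite addrAC subrK.
have h : `|m k w - nf k + sigma *: x k w + nf k| <= e / n.+1%:R.
  rewrite (le_trans (ler_normD _ _)) // (le_trans (lerD yk nk)) //.
  by rewrite invfM mulrA -mulrDl -splitr.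
apply: (@le_trans _ _ (n.+1%:R * (e / n.+1%:R))); last by rewrite mulrC divfK.
by rewrite ler_pM // ler_nat.
Qed.
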